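(* Let $K\ge 2$ be an integer, $\alpha\in(0,1)$, $\beta>0$, $c_1,\dots,c_K\in\mathbb{R}$, and let $\varphi_1^{\mathrm{in}},\dots,\varphi_K^{\mathrm{in}}\in C^{1,\alpha}(\mathbb{T}^2)$ be real-valued functions. Let $(\omega^\beta,u^\beta)$ be the solution of the two-dimensional incompressible Euler equation in vorticity form on $\mathbb{T}^2$ with initial vorticity $$\omega_0^\beta(x)=\sum_{k=1}^K c_k\,\frac{e^{\beta\varphi_k^{\mathrm{in}}(x)}}{\sum_{j=1}^K e^{\beta\varphi_j^{\mathrm{in}}(x)}}.$$ For each $k\in\{1,\dots,K\}$ let $\varphi_k^\beta$ be the solution of the transport equation $$\partial_t\varphi_k^\beta+u^\beta\cdot\nabla\varphi_k^\beta=0,\qquad \varphi_k^\beta|_{t=0}=\varphi_k^{\mathrm{in}}.$$ Then for all $t\ge 0$ and $x\in\mathbb{T}^2$, $$\omega^\beta(t,x)=\sum_{k=1}^K c_k\,\pi_k^\beta(t,x),\qquad \pi_k^\beta(t,x)=\frac{e^{\beta\varphi_k^\beta(t,x)}}{\sum_{j=1}^K e^{\beta\varphi_j^\beta(t,x)}}.$$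
   Context: The Euler equation in vorticity form on the flat torus $\mathbb{T}^2$ is $$\partial_t\omega+u\cdot\nabla\omega=0,\qquad u=\nabla^\perp\psi,\qquad -\Delta\psi=\omega-\langle\omega\rangle,$$ where $\langle\omega\rangle$ is the spatial mean of $\omega$ and $\nabla^\perp=(\partial_2,-\partial_1)$. For bounded initial vorticity, ''the solution'' is the unique global Yudovich (bounded-vorticity) solution; its velocity is log-Lipschitz and generates a unique flow of homeomorphisms of $\mathbb{T}^2$. *)

(* Defs.v *)
From HB Require Import structures.
From mathcomp Require Import all_boot all_order all_algebra.
From mathcomp Require Import all_classical all_reals all_analysis.
Set Implicit Arguments.
Unset Strict Implicit.
Unset Printing Implicit Defensive.
Import Order.TTheory GRing.Theory Num.Theory.
Import numFieldNormedType.Exports.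
Local Open Scope classical_set_scope.
Local Open Scope ring_scope.

(* The flat torus is T^2 = R^2 / Z^2: a function on T^2 is a function on R * R
   that is 1-periodic in each variable, and its integral is the integral over
   the unit square. *)

Notation leb2 R := (@lebesgue_measure R \x @lebesgue_measure R)%E.

Section Torus.
Context {R : realType}.
Implicit Types (f g w eta psi : R * R -> R).

Definition on_torus f : Prop :=
  forall x, f (x.1 + 1, x.2) = f x /\ f (x.1, x.2 + 1) = f x.

Definition unit_square : set (R * R) := `[0, 1] `*` `[0, 1].

Definition torus_int f : R := \int[leb2 R]_(x in unit_square) f x.

(* T^2 has area 1, so no normalisation is needed. *)
Definition torus_mean f : R := torus_int f.

Definition C1 (V : normedModType R) (f : V -> R) : Prop :=
  (forall x, differentiable f x) /\ (forall v, continuous ('D_v f)).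

Definition d1 f : R * R -> R := 'D_((1, 0) : R * R) f.
Definition d2 f : R * R -> R := 'D_((0, 1) : R * R) f.

Definition holder (alpha : R) f : Prop :=
  exists M : R, forall x y, `|f x - f y| <= M * `|x - y| `^ alpha.

Definition C1alpha_torus (alpha : R) f : Prop :=
  [/\ on_torus f, C1 f, holder alpha (d1 f) & holder alpha (d2 f)].

Definition grad_perp psi (x : R * R) : R * R := (d2 psi x, - d1 psi x).

(* - Delta psi = w - <w> on T^2 in the sense of distributions, for psi of
   class C^1. *)
Definition weak_poisson psi w : Prop :=
  forall eta, on_torus eta -> C1 eta ->
    torus_int (fun x => d1 psi x * d1 eta x + d2 psi x * d2 eta x) =
    torus_int (fun x => (w x - torus_mean w) * eta x).

(* A bounded w has a stream function in W^{2,p} for every finite p, hence of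
   class C^1. *)
Definition biot_savart w (v : R * R -> R * R) : Prop :=
  exists psi, [/\ on_torus psi, C1 psi, weak_poisson psi w
                & forall x, v x = grad_perp psi x].

End Torus.

Section Transport.
Context {R : realType}.
Implicit Types (f : R -> R * R -> R) (u : R -> R * R -> R * R).

(* L^oo([0, T] x T^2) for every T (on functions, not on a.e. classes). *)
Definition Linfty_loc f : Prop :=
  measurable_fun (`[0, +oo[ `*` setT : set (R * (R * R)))
    (fun p => f p.1 p.2) /\
  forall T : R, exists M : R,
    forall t x, 0 <= t <= T -> `|f t x| <= M.

Definition test_function (chi : R * (R * R) -> R) : Prop :=
  C1 chi /\ forall t, on_torus (fun x => chi (t, x)).

Definition dt (chi : R * (R * R) -> R) : R * (R * R) -> R :=
  'D_((1, (0, 0)) : R * (R * R)) chi.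
Definition dx1 (chi : R * (R * R) -> R) : R * (R * R) -> R :=
  'D_((0, (1, 0)) : R * (R * R)) chi.
Definition dx2 (chi : R * (R * R) -> R) : R * (R * R) -> R :=
  'D_((0, (0, 1)) : R * (R * R)) chi.

(* Bounded weak solution of  d_t f + u . grad f = 0,  f(0) = f0,  for a
   divergence-free velocity u. As the identity holds at every final time T, it
   determines f T up to a null set for every T, not only for almost every T. *)
Definition transport_solution u (f0 : R * R -> R) f : Prop :=
  [/\ forall t, 0 <= t -> on_torus (f t),
      Linfty_loc f
    & forall chi (T : R), test_function chi -> 0 <= T ->
        torus_int (fun x => f T x * chi (T, x)) -
        torus_int (fun x => f0 x * chi (0, x)) =
        \int[lebesgue_measure]_(t in `[0, T])
          torus_int (fun x => f t x *
            (dt chi (t, x) + (u t x).1 * dx1 chi (t, x)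
                           + (u t x).2 * dx2 chi (t, x)))].

Definition yudovich_solution (omega0 : R * R -> R)
    (omega : R -> R * R -> R) u : Prop :=
  [/\ Linfty_loc (fun t x => (u t x).1),
      Linfty_loc (fun t x => (u t x).2),
      forall t, 0 <= t -> biot_savart (omega t) (u t)
    & transport_solution u omega0 omega].

End Transport.

Section Softmax.
Context {R : realType} {K : nat}.

Definition softmax (beta : R) (phi : 'I_K -> R * R -> R) (k : 'I_K)
    (x : R * R) : R :=
  expR (beta * phi k x) / \sum_(j < K) expR (beta * phi j x).

End Softmax.

(* Main.v *)
(* Let D be the sum of the exp(beta * phi_k) and N the sum of the
   c_k * exp(beta * phi_k). Bounded weak solutions of the transport equation form
   an algebra closed under bounded pointwise limits, so D, N, omega * D - N and
   (omega * D - N)^2 are weak solutions; the last one has zero initial datum, and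
   conservation of its mean makes omega * D - N vanish almost everywhere at every
   time.

   Stability under products is the heart of the matter. For solutions f and g one
   follows \int \int f(x) eta(x) g(y) rho(x - y) dx dy, where rho is the
   normalized kernel (cos(pi z1) cos(pi z2))^(2m). As rho(x - y) is a finite sum
   of products of functions of x and of y, its time derivative comes from the
   scalar product rule, and doubling of variables leaves the commutator
   (u(x) - u(y)) . grad rho(x - y). It tends to zero because g has vanishing mean
   oscillation with respect to rho, and because u has one derivative in L^2:
   testing the Poisson equation with a second difference of psi gives
   \int |u(x + z) - u(x)|^2 dx <= C |z|^2. *)

(* The solutions are merely bounded in [x], so the product rule is a renormalization statement in
   the sense of DiPerna and Lions. A separable kernel turns the doubled integral into finitely many
   products of scalar functions of time, and each weak equation is tested in its own variable only.

   The kernel of order m has width m^(-1/2), with moments given by the Wallis recursion. Its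
   gradient is at most a constant times m |sin| times a kernel of the preceding order, which
   explains the shifts between [m.+1] and [m]. The commutator is thus controlled by the mean of m |g
   x - g y| |u x - u y| |sin|. The means of m |u x - u y|^2 and of (m sin^2)^2 are bounded uniformly
   in m, while |g x - g y| is bounded and its mean square tends to zero. Only this third factor is
   small; Young's inequality with a parameter delta isolates it at the price delta^(-3). The limit
   in m is taken first and delta is sent to zero afterwards. *)
Require Import Defs.
From HB Require Import structures.
From mathcomp Require Import all_boot all_order all_algebra.
From mathcomp Require Import all_classical all_reals all_analysis.
From mathcomp Require Import measurable_realfun ring lra.
Set Implicit Arguments.
Unset Strict Implicit.
Unset Printing Implicit Defensive.
Import Order.TTheory GRing.Theory Num.Theory.
Import numFieldNormedType.Exports.
Local Open Scope classical_set_scope.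
Local Open Scope ring_scope.

(** * Bounded measurable functions *)

Section BoundedMeasurable.
Context {R : realType} {d} {T : measurableType d}.
Implicit Types f g : T -> R.

(** The bound is global, not only on the domain of integration, so the class is stable under
    sections, shifts and compositions. On sets of finite measure it settles all integrability
    conditions, those of Fubini included. *)
Definition bm f := measurable_fun setT f /\ exists M : R, forall x, `|f x| <= M.

Lemma bm_cst (c : R) : bm (fun _ => c).
Proof. by split => //; exists `|c|. Qed.

Lemma bmD f g : bm f -> bm g -> bm (fun x => f x + g x).
Proof.
move=> [mf [M Mf]] [mg [N Ng]]; split; first exact: measurable_funD.
by exists (M + N) => x; rewrite (le_trans (ler_normD _ _))// lerD.
Qed.

Lemma bmM f g : bm f -> bm g -> bm (fun x => f x * g x).
Proof.
move=> [mf [M Mf]] [mg [N Ng]]; split; first exact: measurable_funM.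
by exists (M * N) => x; rewrite normrM ler_pM.
Qed.

Lemma bmN f : bm f -> bm (fun x => - f x).
Proof.
move=> [mf [M Mf]]; split; first exact: measurableT_comp.
by exists M => x; rewrite normrN.
Qed.

Lemma bmB f g : bm f -> bm g -> bm (fun x => f x - g x).
Proof. by move=> ? ?; apply: bmD => //; exact: bmN. Qed.

Lemma bmX f n : bm f -> bm (fun x => f x ^+ n).
Proof.
move=> bf; elim: n => [|n ih]; first exact: bm_cst.
by under eq_fun do rewrite exprS; exact: bmM.
Qed.

Lemma bm_norm f : bm f -> bm (fun x => `|f x|).
Proof.
move=> [mf [M Mf]]; split; first exact: measurableT_comp.
by exists M => x; rewrite normr_id.
Qed.

Lemma bm_sum (I : Type) (s : seq I) (F : I -> T -> R) :
  (forall i, bm (F i)) -> bm (fun x => \sum_(i <- s) F i x).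
Proof.
move=> bF; elim: s => [|i s ih].
  by under eq_fun do rewrite big_nil; exact: bm_cst.
by under eq_fun do rewrite big_cons; exact: bmD.
Qed.

End BoundedMeasurable.

Lemma bm_comp {R : realType} {d1 d2} {T1 : measurableType d1}
    {T2 : measurableType d2} (f : T2 -> R) (h : T1 -> T2) :
  measurable_fun setT h -> bm f -> bm (fun x => f (h x)).
Proof.
move=> mh [mf [M Mf]]; split; first exact: measurableT_comp.
by exists M.
Qed.

Section FiniteIntegral.
Context {R : realType} {d} {T : measurableType d}
  (mu : {measure set T -> \bar R}) (D : set T).
Hypotheses (mD : measurable D) (Doo : (mu D < +oo)%E).
Implicit Types f g : T -> R.

Lemma bm_integrable f : bm f -> mu.-integrable D (EFin \o f).
Proof.
move=> [mf [M Mf]].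
apply: (@measurable_bounded_integrable _ _ _ mu f D) => //.
  exact: measurable_funTS.
exists M; split; first by rewrite num_real.
by move=> x Mx y _; apply: le_trans (Mf y) (ltW Mx).
Qed.

Lemma RintD f g : bm f -> bm g ->
  \int[mu]_(x in D) (f x + g x) = \int[mu]_(x in D) f x + \int[mu]_(x in D) g x.
Proof. by move=> bf bg; rewrite RintegralD//; exact: bm_integrable. Qed.

Lemma RintB f g : bm f -> bm g ->
  \int[mu]_(x in D) (f x - g x) = \int[mu]_(x in D) f x - \int[mu]_(x in D) g x.
Proof. by move=> bf bg; rewrite RintegralB//; exact: bm_integrable. Qed.

Lemma RintZl f c : bm f ->
  \int[mu]_(x in D) (c * f x) = c * \int[mu]_(x in D) f x.
Proof. by move=> bf; rewrite RintegralZl//; exact: bm_integrable. Qed.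

Lemma RintZr f c : bm f ->
  \int[mu]_(x in D) (f x * c) = \int[mu]_(x in D) f x * c.
Proof. by move=> bf; rewrite RintegralZr//; exact: bm_integrable. Qed.

Lemma Rint_sum (I : Type) (s : seq I) (F : I -> T -> R) :
  (forall i, bm (F i)) ->
  \int[mu]_(x in D) (\sum_(i <- s) F i x) =
  \sum_(i <- s) \int[mu]_(x in D) F i x.
Proof.
move=> bF; elim: s => [|i s ih].
  rewrite big_nil; under eq_Rintegral do rewrite big_nil.
  by rewrite Rintegral_cst// mul0r.
under eq_Rintegral do rewrite big_cons.
by rewrite big_cons RintD ?ih//; exact: bm_sum.
Qed.

Lemma le_Rint f g : bm f -> bm g -> (forall x, D x -> f x <= g x) ->
  \int[mu]_(x in D) f x <= \int[mu]_(x in D) g x.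
Proof. by move=> bf bg fg; apply: le_Rintegral => //; exact: bm_integrable. Qed.

Lemma normr_Rint f : bm f ->
  `|\int[mu]_(x in D) f x| <= \int[mu]_(x in D) `|f x|.
Proof. by move=> bf; apply: le_normr_Rintegral => //; exact: bm_integrable. Qed.

Lemma normr_Rint_le f g : bm f -> bm g -> (forall x, D x -> `|f x| <= g x) ->
  `|\int[mu]_(x in D) f x| <= \int[mu]_(x in D) g x.
Proof.
move=> bf bg fg; apply: le_trans (normr_Rint bf) _.
by apply: le_Rint => //; exact: bm_norm.
Qed.

Lemma normr_Rint_bound f M : bm f -> (forall x, D x -> `|f x| <= M) ->
  `|\int[mu]_(x in D) f x| <= M * fine (mu D).
Proof.
move=> bf fM; rewrite -Rintegral_cst//; apply: normr_Rint_le => //.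
exact: bm_cst.
Qed.

End FiniteIntegral.

(** * Fubini for bounded functions on sets of finite measure *)

Section Fubini.
Context {R : realType} {d1 d2} {T1 : measurableType d1} {T2 : measurableType d2}
  (m1 : {sigma_finite_measure set T1 -> \bar R})
  (m2 : {sigma_finite_measure set T2 -> \bar R})
  (D1 : set T1) (D2 : set T2).
Hypotheses (mD1 : measurable D1) (m1D1 : (m1 D1 < +oo)%E).
Hypotheses (mD2 : measurable D2) (m2D2 : (m2 D2 < +oo)%E).
Implicit Types f : T1 * T2 -> R.

Lemma bm_section1 f x : bm f -> bm (fun y => f (x, y)).
Proof. by apply: bm_comp; exact: measurable_fun_pair. Qed.

Lemma bm_section2 f y : bm f -> bm (fun x => f (x, y)).
Proof. by apply: bm_comp; exact: measurable_fun_pair. Qed.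

Lemma bm_EFin_Rint2 f x : bm f ->
  (\int[m2]_(y in D2) (f (x, y))%:E)%E = (\int[m2]_(y in D2) f (x, y))%:E.
Proof.
move=> bf; rewrite /Rintegral fineK//.
apply: integrable_fin_num => //.
exact: (bm_integrable mD2 m2D2 (bm_section1 x bf)).
Qed.

Lemma bm_EFin_Rint1 f y : bm f ->
  (\int[m1]_(x in D1) (f (x, y))%:E)%E = (\int[m1]_(x in D1) f (x, y))%:E.
Proof.
move=> bf; rewrite /Rintegral fineK//.
apply: integrable_fin_num => //.
exact: (bm_integrable mD1 m1D1 (bm_section2 y bf)).
Qed.

(** Tonelli wants a nonnegative integrand: [f] is raised by its bound [M] and cut off outside the
    strip over [D2], and the resulting constant [M * fine (m2 D2)] is subtracted again. *)
Lemma bm_Rint2 f : bm f -> bm (fun x => \int[m2]_(y in D2) f (x, y)).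
Proof.
move=> bf; have [mf [M Mf]] := bf; split; last first.
  exists (M * fine (m2 D2)) => x.
  by apply: normr_Rint_bound => //; exact: bm_section1.
pose h z := ((fun z => f z + M) \_ (setT `*` D2)) z.
have mT : measurable ([set: T1] `*` D2) by exact: measurableX.
have h0 z : (0 <= (h z)%:E)%E.
  rewrite lee_fin /h patchE; case: ifPn => // _.
  by have := Mf z; rewrite ler_norml => /andP[+ _]; rewrite -lerBlDr sub0r.
have mh : measurable_fun setT (EFin \o h).
  apply/measurable_EFinP; apply: (measurable_restrictT _ mT).1.
  by apply: measurable_funTS; have [] := bmD bf (bm_cst M).
have -> : (fun x => \int[m2]_(y in D2) f (x, y)) =
    (fun x => fine (fubini_F m2 (EFin \o h) x) - M * fine (m2 D2)).
  apply/funext => x; rewrite /fubini_F.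
  have -> : (\int[m2]_y (EFin \o h) (x, y) =
      \int[m2]_(y in D2) ((fun y => (f (x, y) + M)%:E) y))%E.
    rewrite [RHS]integral_mkcond; apply: eq_integral => y _ /=.
    by rewrite /h !patchE in_setX/= in_setT/=; case: ifP.
  rewrite -[fine _]/(Rintegral _ _ _) RintD//; last exact: bm_cst.
    by rewrite Rintegral_cst// addrK.
  exact: bm_section1.
apply: measurable_funB => //; apply: measurableT_comp => //.
exact: (measurable_fun_fubini_tonelli_F (EFin \o h)).
Qed.

Let m12 : measurable (D1 `*` D2). Proof. exact: measurableX. Qed.

Lemma prod_measure_ltoo : ((m1 \x m2)%E (D1 `*` D2) < +oo)%E.
Proof. by rewrite product_measure1E// lte_mul_pinfty// ge0_fin_numE. Qed.

Let ig f : bm f -> (m1 \x m2)%E.-integrable setT (EFin \o (f \_ (D1 `*` D2))).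
Proof.
move=> bf; rewrite -restrict_EFin; apply: (integrable_mkcond _ m12).1.
exact: (bm_integrable m12 prod_measure_ltoo bf).
Qed.

Lemma Rint_prod f : bm f ->
  \int[(m1 \x m2)%E]_(z in D1 `*` D2) f z =
  \int[m1]_(x in D1) \int[m2]_(y in D2) f (x, y).
Proof.
move=> bf; rewrite Rintegral_mkcond {1}/Rintegral -integral12_prod_meas1; last exact: ig.
rewrite /Rintegral [in RHS]integral_mkcond; congr fine; apply: eq_integral => x _.
rewrite patchE /fubini_F; case: ifPn => xD1; last first.
  rewrite -[RHS](integral0 m2 setT); apply: eq_integral => y _ /=.
  by rewrite patchE in_setX (negbTE xD1).
rewrite -bm_EFin_Rint2// [RHS]integral_mkcond; apply: eq_integral => y _ /=.
by rewrite !patchE in_setX xD1/=; case: ifP.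
Qed.

Lemma Rint_prod_swap f : bm f ->
  \int[(m1 \x m2)%E]_(z in D1 `*` D2) f z =
  \int[m2]_(y in D2) \int[m1]_(x in D1) f (x, y).
Proof.
move=> bf; rewrite Rintegral_mkcond {1}/Rintegral -integral21_prod_meas1; last exact: ig.
rewrite /Rintegral [in RHS]integral_mkcond; congr fine; apply: eq_integral => y _.
rewrite patchE /fubini_G; case: ifPn => yD2; last first.
  rewrite -[RHS](integral0 m1 setT); apply: eq_integral => x _ /=.
  by rewrite patchE in_setX (negbTE yD2) andbF.
rewrite -bm_EFin_Rint1// [RHS]integral_mkcond; apply: eq_integral => x _ /=.
by rewrite !patchE in_setX yD2 andbT; case: ifP.
Qed.

Lemma Rint_Fubini f : bm f ->
  \int[m1]_(x in D1) \int[m2]_(y in D2) f (x, y) =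
  \int[m2]_(y in D2) \int[m1]_(x in D1) f (x, y).
Proof. by move=> bf; rewrite -Rint_prod// Rint_prod_swap. Qed.

End Fubini.

Section BoundedConvergence.
Context {R : realType} {d} {T : measurableType d}
  (mu : {measure set T -> \bar R}) (D : set T).
Hypotheses (mD : measurable D) (Doo : (mu D < +oo)%E).

Lemma Rint_bounded_cvg (f_ : nat -> T -> R) (f : T -> R) (M : R) :
  (forall n, bm (f_ n)) -> bm f ->
  (forall n x, D x -> `|f_ n x| <= M) ->
  (forall x, D x -> f_ n x @[n --> \oo] --> f x) ->
  \int[mu]_(x in D) f_ n x @[n --> \oo] --> \int[mu]_(x in D) f x.
Proof.
move=> bf_ bf fM ff.
have [] := @dominated_convergence _ _ _ mu D mD (fun n => EFin \o f_ n) (EFin \o f)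
  (fun=> M%:E).
- by move=> n; apply/measurable_EFinP; apply: measurable_funTS; have [] := bf_ n.
- by apply/measurable_EFinP; apply: measurable_funTS; have [] := bf.
- by apply: aeW => x /= Dx; apply: cvg_EFin; [exact: nearW|exact: ff].
- exact: (bm_integrable mD Doo (bm_cst M)).
- by apply: aeW => x /= Dx n; rewrite lee_fin fM.
move=> _ _ h; apply: fine_cvg; rewrite fineK; first exact: h.
by apply: integrable_fin_num => //; exact: (bm_integrable mD Doo bf).
Qed.

End BoundedConvergence.

(** * Translation invariance of Lebesgue measure on the line *)

Section Lebesgue.
Context {R : realType}.
Local Notation leb := (@lebesgue_measure R).

(** The image of Lebesgue measure under a translation agrees with it on half-open intervals, and
    these determine the measure. *)
Lemma leb_shift (A : set R) (c : R) : measurable A ->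
  leb ((fun x => x + c) @^-1` A) = leb A.
Proof.
have mc : measurable_fun [set: measurableTypeR R]
    (fun x : measurableTypeR R => (x + c : measurableTypeR R)).
  exact: measurable_funD.
move=> mA; apply/esym.
pose m : {measure set (measurableTypeR R) -> \bar R} :=
  measure_function_pushforward__canonical__measure_function_Measure leb mc.
suff : forall A, measurable A -> leb A = m A by exact.
apply: lebesgue_measure_unique => X /ocitvP[->|[[a b]/= ab ->]].
  by rewrite !measure0.
rewrite /m/= /pushforward.
have -> : (fun x => x + c) @^-1` `]a, b] = `]a - c, b - c]%classic.
  by apply/seteqP; split => x/=; rewrite !in_itv/= ltrBlDr lerBrDr.
rewrite !lebesgue_measure_itv/= !lte_fin ab.
by rewrite ltrD2r ab -!EFinB; congr EFin; ring.
Qed.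

Lemma leb01 : leb `[0%R, 1%R] = 1%E.
Proof. by rewrite lebesgue_measure_itv/= lte_fin ltr01 -EFinB subr0. Qed.

Lemma leb_itv_ltoo (a b : R) : (leb `[a, b] < +oo)%E.
Proof. by rewrite lebesgue_measure_itv/=; case: ifP => // _; rewrite -EFinB ltry. Qed.

End Lebesgue.

(** * Integration over the torus *)

Section TorusMeasure.
Context {R : realType}.
Local Notation leb := (@lebesgue_measure R).
Local Notation I01 := (`[0%R, 1%R]%classic : set R).

Lemma measurable_ball2 (x : R * R) (r : R) : measurable (ball x r).
Proof.
by apply: measurableX; exact: measurable_ball.
Qed.

(** The sigma-algebra on [R * R] is the product one, so an open set has to be written as a countable
    union of boxes: those with rational centre and radius that it contains. *)
Lemma open_measurable2 (U : set (R * R)) : open U -> measurable U.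
Proof.
move=> oU.
pose B (p q r : rat) : set (R * R) :=
  let A := ball (ratr p : R, ratr q : R) (ratr r : R) in
  if asbool (A `<=` U) then A else set0.
have -> : U = \bigcup_p \bigcup_q \bigcup_r B p q r.
  apply/seteqP; split=> [[x y] Uxy|z [p _ [q _ [r _]]]]; last first.
    by rewrite /B; case: asboolP => // AU /AU.
  have /nbhs_ballP[e/= e0 eU] : nbhs (x, y) U by exact: open_nbhs_nbhs.
  (* A radius between e/4 and e/2 around a centre less than e/4 away catches the point, and the box
     stays within distance e of it. *)
  have e4 : 0 < e / 4 by rewrite divr_gt0.
  have /rat_in_itvoo[r] : e / 4 < e / 2 by lra.
  rewrite in_itv/= => /andP[r1 r2].
  have /rat_in_itvoo[p] : x - e / 4 < x by lra.
  rewrite in_itv/= => /andP[p1 p2].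
  have /rat_in_itvoo[q] : y - e / 4 < y by lra.
  rewrite in_itv/= => /andP[q1 q2].
  exists p => //; exists q => //; exists r => //; rewrite /B; case: asboolP.
    move=> _; split; rewrite /ball/= ltr_norml; apply/andP; split; lra.
  case=> -[a b] [/= ]; rewrite /ball/= !ltr_norml => /andP[a1 a2] /andP[b1 b2].
  apply: eU; split; rewrite /ball/= ltr_norml; apply/andP; split; lra.
do 3 (apply: bigcupT_measurable_rat => ?).
by rewrite /B; case: asboolP => // _; exact: measurable_ball2.
Qed.

Lemma continuous_measurable2 (f : R * R -> R) :
  continuous f -> measurable_fun setT f.
Proof.
move=> /continuousP cf; apply: (measurability _ (RGenOpens.measurableE R)).
move=> _ [_ [a [b ->] <-]]; rewrite setTI; apply: open_measurable2.
exact/cf/interval_open.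
Qed.

Lemma on_torus_addz (f : R * R -> R) (m n : int) x : on_torus f ->
  f (x.1 + m%:~R, x.2 + n%:~R) = f x.
Proof.
move=> tf.
have step1 (k : nat) y : f (y.1 + k%:R, y.2) = f y.
  elim: k y => [|k ih] y; first by rewrite addr0; case: y.
  by rewrite -natr1 addrA (tf (y.1 + k%:R, y.2)).1 ih.
have step2 (k : nat) y : f (y.1, y.2 + k%:R) = f y.
  elim: k y => [|k ih] y; first by rewrite addr0; case: y.
  by rewrite -natr1 addrA (tf (y.1, y.2 + k%:R)).2 ih.
have step1z (k : int) y : f (y.1 + k%:~R, y.2) = f y.
  case: k => k; first exact: step1.
  by rewrite -(step1 k.+1) NegzE/= mulrNz subrK; case: y.
have step2z (k : int) y : f (y.1, y.2 + k%:~R) = f y.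
  case: k => k; first exact: step2.
  by rewrite -(step2 k.+1) NegzE/= mulrNz subrK; case: y.
by rewrite (step1z m (x.1, x.2 + n%:~R)) step2z.
Qed.

Lemma torus_reduce (f : R * R -> R) x : on_torus f ->
  exists2 y, unit_square y & f x = f y.
Proof.
move=> tf; exists (x.1 - (Num.floor x.1)%:~R, x.2 - (Num.floor x.2)%:~R).
  split; rewrite /= in_itv/=.
    by rewrite subr_ge0 floor_le/= lerBlDr addrC -intrD1 ltW// floorD1_gt.
  by rewrite subr_ge0 floor_le/= lerBlDr addrC -intrD1 ltW// floorD1_gt.
by rewrite -[RHS](on_torus_addz (Num.floor x.1) (Num.floor x.2) _ tf)/= !subrK; case: x.
Qed.

Lemma bm_continuous (f : R * R -> R) : on_torus f -> continuous f -> bm f.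
Proof.
move=> tf cf; split; first exact: continuous_measurable2.
have : compact (f @` unit_square).
  apply: continuous_compact; first exact: continuous_subspaceT.
  by apply: compact_setX; exact: segment_compact.
move=> /compact_bounded [M [_ /(_ (M + 1))]].
rewrite ltrDl ltr01 => /(_ isT) h; exists (M + 1) => x.
have [y sqy ->] := torus_reduce x tf.
by apply: h; exists y.
Qed.

Lemma torus_intE (f : R * R -> R) : bm f -> torus_int f =
  \int[leb]_(a in I01) \int[leb]_(b in I01) f (a, b).
Proof.
move=> bf; apply: (Rint_prod (m1 := leb) (m2 := leb)) => //; exact: leb_itv_ltoo.
Qed.

Lemma torus_intE_swap (f : R * R -> R) : bm f -> torus_int f =
  \int[leb]_(b in I01) \int[leb]_(a in I01) f (a, b).
Proof.
move=> bf; apply: (Rint_prod_swap (m1 := leb) (m2 := leb)) => //; exact: leb_itv_ltoo.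
Qed.

Lemma leb2_sigma_finite : sigma_finite setT (leb2 R).
Proof.
have /sigma_finiteP[F [TF ndF Foo]] := sigma_finiteT leb.
exists (fun n => F n `*` F n).
 rewrite -setXTT TF predeqE => -[x y]; split.
    move=> [/= [n _ Fnx] [k _ Gky]]; exists (maxn n k) => //; split.
    - by move: x Fnx; exact/subsetPset/ndF/leq_maxl.
    - by move: y Gky; exact/subsetPset/ndF/leq_maxr.
  by move=> [n _ []/= ? ?]; split; exists n.
move=> k; have [? ?] := Foo k.
split; first exact: measurableX.
by rewrite product_measure1E// lte_mul_pinfty// ge0_fin_numE.
Qed.

(** Fubini is applied with the torus itself as a factor, which requires the plane measure as a
    bundled sigma-finite measure. *)
Definition leb2s : {sigma_finite_measure set (measurableTypeR R * measurableTypeR R)%type -> \bar R} :=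
  HB.pack (leb2 R) (Measure_isSigmaFinite.Build _ _ _ (leb2 R) leb2_sigma_finite).

Lemma measurable_unit_square : measurable (@unit_square R).
Proof. exact: measurableX. Qed.

Lemma leb2_unit_square : leb2 R unit_square = 1%E.
Proof. by rewrite /unit_square product_measure1E//= leb01 mule1. Qed.

Lemma leb2_unit_square_ltoo : (leb2 R unit_square < +oo)%E.
Proof. by rewrite leb2_unit_square ltry. Qed.

End TorusMeasure.

(** For nonnegative [c] the interval of integration becomes [c, 1 + c]; the part beyond 1 is carried
    back to [0, c] by periodicity. With [c] at most 1 in modulus, one such wrap suffices. *)
Lemma leb_int1_shift {R : realType} (h : R -> R) (c : R) : bm h ->
  (forall s, h (s + 1) = h s) -> `|c| <= 1 ->
  \int[@lebesgue_measure R]_(s in `[0%R, 1%R]) h (s + c) =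
  \int[@lebesgue_measure R]_(s in `[0%R, 1%R]) h s.
Proof.
move=> bh ph.
have shift (D : set R) (k : R -> R) (e : R) : bm k -> measurable D -> (@lebesgue_measure R D < +oo)%E ->
    \int[@lebesgue_measure R]_(s in (fun x => x + e) @^-1` D) k (s + e) =
    \int[@lebesgue_measure R]_(s in D) k s.
  move=> bk mD Doo.
  have mc : measurable_fun [set: measurableTypeR R]
    (fun x : measurableTypeR R => (x + e : measurableTypeR R)).
    exact: measurable_funD.
  have mD' : measurable ((fun x => x + e) @^-1` D).
    by rewrite -[X in measurable X]setTI; exact: mc.
  have Doo' : (@lebesgue_measure R ((fun x : R => (x + e)%R) @^-1` D) < +oo)%E by rewrite leb_shift.
  rewrite /Rintegral; congr fine.
  rewrite -(@integral_pushforward _ _ _ _ _ _ mc _ D (EFin \o k))//.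
  - by apply: eq_measure_integral => A mA _ /=; rewrite /pushforward leb_shift.
  - by apply/measurable_EFinP; have [] := bk.
  - have bks : bm (fun x : R => k (x + e)) by apply: (bm_comp (h := fun x : R => (x + e : R))) bk.
    exact: (bm_integrable (mu := @lebesgue_measure R) mD' Doo' bks).
have itvs (a b e : R) : (fun x => x + e) @^-1` `[a, b] = `[a - e, b - e]%classic.
  by apply/seteqP; split => x/=; rewrite !in_itv/= lerBlDr lerBrDr.
have shiftI (k : R -> R) (a b e : R) : bm k ->
    \int[@lebesgue_measure R]_(s in `[a, b]) k (s + e) =
    \int[@lebesgue_measure R]_(s in `[a + e, b + e]) k s.
  move=> bk; rewrite -(shift `[a + e, b + e]%classic _ e)//; last exact: leb_itv_ltoo.
  by rewrite itvs !addrK.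
have split (a b d : R) (k : R -> R) : bm k -> a <= b -> b <= d ->
   \int[@lebesgue_measure R]_(s in `[a, d]) k s =
   \int[@lebesgue_measure R]_(s in `[a, b]) k s + \int[@lebesgue_measure R]_(s in `[b, d]) k s.
  move=> bk ab bd.
  have ik (x y : R) : (@lebesgue_measure R).-integrable `[x, y] (EFin \o k).
    by apply: bm_integrable => //; exact: leb_itv_ltoo.
  apply/eqP; rewrite addrC -subr_eq; apply/eqP.
  rewrite (@Rintegral_itvB _ _ (BLeft a) (BRight d) b)// ?bnd_simp//.
  apply: Rintegral_itv_obnd_cbnd.
  by apply: integrableS (ik b d) => //; apply: subset_itvr; rewrite bnd_simp.
have pos (k : R -> R) (e : R) : bm k -> (forall s, k (s + 1) = k s) -> 0 <= e <= 1 ->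
    \int[@lebesgue_measure R]_(s in `[0%R, 1%R]) k (s + e) =
    \int[@lebesgue_measure R]_(s in `[0%R, 1%R]) k s.
  move=> bk pk /andP[e0 e1]; rewrite shiftI// add0r.
  rewrite (split e 1 (1 + e))//; last by rewrite lerDl.
  have -> : \int[@lebesgue_measure R]_(s in `[1, 1 + e]) k s =
            \int[@lebesgue_measure R]_(s in `[0, e]) k s.
    transitivity (\int[@lebesgue_measure R]_(s in `[0, e]) k (s + 1)).
      by rewrite shiftI// add0r addrC.
    by apply: eq_Rintegral => s _; rewrite pk.
  by rewrite addrC -split.
rewrite ler_norml => /andP[c1 c2]; have [c0|/ltW c0] := leP 0 c.
  by apply: pos => //; rewrite c0.
have bhc : bm (fun s : R => h (s + c)).
  by apply: (bm_comp (h := fun s : R => (s + c : R))) => //; exact: measurable_funD.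
(* For negative [c] the nonnegative case is read backwards: shifting [h (s + c)] by [- c] gives back
   [h]. *)
rewrite -(pos (fun s => h (s + c)) (- c))//.
- by apply: eq_Rintegral => s _; rewrite subrK.
- by move=> s; rewrite addrAC ph.
- by rewrite oppr_ge0 c0 lerNl c1.
Qed.

Section TorusIntegral.
Context {R : realType}.
Implicit Types f g : R * R -> R.
Let msq := @measurable_unit_square R.
Let sqoo := @leb2_unit_square_ltoo R.

Lemma eq_tint f g : f =1 g -> torus_int f = torus_int g.
Proof. by move=> fg; congr torus_int; apply/funext. Qed.

Lemma tintD f g : bm f -> bm g ->
  torus_int (fun x => f x + g x) = torus_int f + torus_int g.
Proof.
exact: (RintD (mu := leb2 R) msq sqoo).
Qed.

Lemma tintB f g : bm f -> bm g ->
  torus_int (fun x => f x - g x) = torus_int f - torus_int g.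
Proof.
exact: (RintB (mu := leb2 R) msq sqoo).
Qed.

Lemma tintZl f c : bm f -> torus_int (fun x => c * f x) = c * torus_int f.
Proof.
exact: (RintZl (mu := leb2 R) msq sqoo).
Qed.

Lemma tintZr f c : bm f -> torus_int (fun x => f x * c) = torus_int f * c.
Proof.
exact: (RintZr (mu := leb2 R) msq sqoo).
Qed.

Lemma tint_sum (I : Type) (s : seq I) (F : I -> R * R -> R) :
  (forall i, bm (F i)) ->
  torus_int (fun x => \sum_(i <- s) F i x) = \sum_(i <- s) torus_int (F i).
Proof.
exact: (Rint_sum (mu := leb2 R) msq sqoo).
Qed.

Lemma tint_cst c : torus_int (fun _ : R * R => c) = c.
Proof.
rewrite /torus_int Rintegral_cst; last exact: measurable_unit_square.
have -> : fine (leb2 R unit_square) = 1 by rewrite [leb2 R _]leb2_unit_square.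
by rewrite mulr1.
Qed.

Lemma le_tint f g : bm f -> bm g -> (forall x, f x <= g x) ->
  torus_int f <= torus_int g.
Proof.
by move=> bf bg fg; exact: (le_Rint (mu := leb2 R) msq sqoo).
Qed.

Lemma tint_ge0 f : (forall x, 0 <= f x) -> 0 <= torus_int f.
Proof. by move=> f0; apply: Rintegral_ge0. Qed.

Lemma normr_tint f : bm f -> `|torus_int f| <= torus_int (fun x => `|f x|).
Proof.
exact: (normr_Rint (mu := leb2 R) msq sqoo).
Qed.

Lemma normr_tint_le f g : bm f -> bm g -> (forall x, `|f x| <= g x) ->
  `|torus_int f| <= torus_int g.
Proof.
move=> bf bg fg; apply: le_trans (normr_tint bf) _.
by apply: le_tint => //; exact: bm_norm.
Qed.

Lemma normr_tint_bound f M : bm f -> (forall x, `|f x| <= M) ->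
  `|torus_int f| <= M.
Proof. by move=> bf fM; rewrite -[leRHS]tint_cst; apply: normr_tint_le => //; exact: bm_cst. Qed.

Lemma bm_tint d (T : measurableType d) (H : T * (R * R) -> R) : bm H ->
  bm (fun x => torus_int (fun y => H (x, y))).
Proof.
exact: (bm_Rint2 (m2 := @leb2s R) msq sqoo).
Qed.

Lemma tint_swap (H : (R * R) * (R * R) -> R) : bm H ->
  torus_int (fun x => torus_int (fun y => H (x, y))) =
  torus_int (fun y => torus_int (fun x => H (x, y))).
Proof.
exact: (Rint_Fubini (m1 := @leb2s R) (m2 := @leb2s R) msq sqoo msq sqoo).
Qed.

Lemma tint_itv_swap (a b : R) (H : R * (R * R) -> R) : bm H ->
  \int[lebesgue_measure]_(t in `[a, b]) torus_int (fun y => H (t, y)) =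
  torus_int (fun y => \int[lebesgue_measure]_(t in `[a, b]) H (t, y)).
Proof.
exact: (Rint_Fubini (m1 := lebesgue_measure) (m2 := @leb2s R) (measurable_itv _) (leb_itv_ltoo _ _) msq sqoo).
Qed.

Lemma tint_shift f (z : R * R) : bm f -> on_torus f -> `|z.1| <= 1 -> `|z.2| <= 1 ->
  torus_int (fun x => f (x + z)) = torus_int f.
Proof.
move=> bf tf z1 z2.
have bs : bm (fun x : R * R => f (x + z)).
  apply: (bm_comp (h := fun x : R * R => (x + z : R * R))) bf.
  by apply: measurable_fun_pair => /=; exact: measurable_funD.
rewrite (torus_intE bs) (torus_intE bf).
transitivity (\int[@lebesgue_measure R]_(a in `[0%R, 1%R])
   \int[@lebesgue_measure R]_(b in `[0%R, 1%R]) f (a + z.1, b)).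
  apply: eq_Rintegral => a _ /=.
  apply: (leb_int1_shift (h := fun b => f (a + z.1, b))) => //.
    exact: bm_section1.
  by move=> b; rewrite (tf (a + z.1, b)).2.
apply: (leb_int1_shift (h := fun a => \int[@lebesgue_measure R]_(b in `[0%R, 1%R]) f (a, b))) => //.
  by apply: bm_Rint2 => //; exact: leb_itv_ltoo.
by move=> a; apply: eq_Rintegral => b _; rewrite (tf (a, b)).1.
Qed.

Lemma tint_cvg (f_ : nat -> R * R -> R) f (M : R) :
  (forall n, bm (f_ n)) -> bm f -> (forall n x, `|f_ n x| <= M) ->
  (forall x, f_ n x @[n --> \oo] --> f x) ->
  torus_int (f_ n) @[n --> \oo] --> torus_int f.
Proof.
move=> bf_ bf fM ff.
exact: (Rint_bounded_cvg (mu := leb2 R) msq sqoo bf_ bf (fun n x _ => fM n x) (fun x _ => ff x)).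
Qed.

Lemma on_torusD f g : on_torus f -> on_torus g -> on_torus (fun x => f x + g x).
Proof. by move=> tf tg x; have [-> ->] := tf x; have [-> ->] := tg x. Qed.

Lemma on_torusM f g : on_torus f -> on_torus g -> on_torus (fun x => f x * g x).
Proof. by move=> tf tg x; have [-> ->] := tf x; have [-> ->] := tg x. Qed.

Lemma on_torusB f g : on_torus f -> on_torus g -> on_torus (fun x => f x - g x).
Proof. by move=> tf tg x; have [-> ->] := tf x; have [-> ->] := tg x. Qed.

Lemma on_torus_comp (h : R -> R) f : on_torus f -> on_torus (fun x => h (f x)).
Proof. by move=> tf x; have [-> ->] := tf x. Qed.

Lemma on_torus_shift f (z : R * R) : on_torus f -> on_torus (fun x => f (x + z)).
Proof.
move=> tf x; have [h1 h2] := tf (x + z); split; [rewrite -h1|rewrite -[RHS]h2];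
  by congr f; apply/pair_equal_spec; split => //=; rewrite addrAC.
Qed.

Lemma on_torus_cst (c : R) : on_torus (fun=> c).
Proof. by []. Qed.

End TorusIntegral.

(** * Functions of class C^1 *)

Section C1Lines.
Context {R : realType} {V : normedModType R}.
Implicit Types F : V -> R.

Lemma C1_continuous F : C1 F -> continuous F.
Proof. by move=> [dF _] x; exact: differentiable_continuous. Qed.

Lemma C1_derivable F x v : C1 F -> derivable F x v.
Proof. by move=> [dF _]; exact: diff_derivable. Qed.

Lemma C1_line_is_derive F (x z : V) (s : R) : C1 F ->
  is_derive s 1 (fun r : R => F (x + r *: z)) ('D_z F (x + s *: z)).
Proof.
move=> cF; have dF : derivable F (x + s *: z) z by exact: C1_derivable.
have e : (fun h : R => h^-1 *: (F (x + (h *: 1 + s) *: z) - F (x + s *: z))) =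
         (fun h : R => h^-1 *: (F (h *: z + (x + s *: z)) - F (x + s *: z))).
  apply/funext => h; congr (_ *: (F _ - _)).
  by rewrite scalerDl [h *: 1]mulr1 addrCA.
apply: DeriveDef.
  by rewrite /derivable /= e.
by rewrite /derive /= e.
Qed.

Lemma C1_line_continuous F (x z : V) : C1 F ->
  continuous (fun s : R => 'D_z F (x + s *: z)).
Proof.
move=> cF s.
apply: (@continuous_comp _ _ _ (fun s : R => x + s *: z) ('D_z F)).
  by apply: cvgD; [exact: cvg_cst|apply: cvgZr_tmp; exact: cvg_id].
exact: cF.2.
Qed.

Lemma C1_line_FTC F (x z : V) : C1 F ->
  \int[lebesgue_measure]_(s in `[0%R, 1%R]) 'D_z F (x + s *: z) = F (x + z) - F x.
Proof.
move=> cF; pose g (s : R) := F (x + s *: z).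
have dg (s : R) : is_derive s (1 : R) g ('D_z F (x + s *: z)) by exact: C1_line_is_derive.
have cg : continuous g.
  by move=> s; apply: differentiable_continuous; apply/derivable1_diffP.
rewrite /Rintegral (@continuous_FTC2 _ _ g)//=.
- by rewrite /g scale1r scale0r addr0.
- by apply: continuous_subspaceT; exact: C1_line_continuous.
- split; first by move=> s _; exact: (@ex_derive _ _ _ _ _ _ _ (dg s)).
    by apply: cvg_at_right_filter; exact: cg.
  by apply: cvg_at_left_filter; exact: cg.
- by move=> s _; rewrite derive1E derive_val.
Qed.

Lemma C1D F G : C1 F -> C1 G -> C1 (fun x => F x + G x).
Proof.
move=> cF cG; split=> [x|v]; first exact: differentiableD (cF.1 x) (cG.1 x).
have -> : 'D_v (fun x => F x + G x) = (fun x => 'D_v F x + 'D_v G x).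
  by apply/funext => x; rewrite deriveD//; exact: C1_derivable.
by move=> x; apply: cvgD; [exact: cF.2|exact: cG.2].
Qed.

Lemma C1M F G : C1 F -> C1 G -> C1 (fun x => F x * G x).
Proof.
move=> cF cG; split=> [x|v]; first exact: differentiableM (cF.1 x) (cG.1 x).
have -> : 'D_v (fun x => F x * G x) = (fun x => F x * 'D_v G x + G x * 'D_v F x).
  by apply/funext => x; rewrite deriveM//; exact: C1_derivable.
move=> x; apply: cvgD.
  exact: (cvgM (@C1_continuous F cF x) (cG.2 v x)).
exact: (cvgM (@C1_continuous G cG x) (cF.2 v x)).
Qed.

Lemma C1_cst (c : R) : C1 (fun _ : V => c).
Proof.
split=> [x|v]; first exact: differentiable_cst.
have -> : 'D_v (fun _ : V => c) = fun=> 0 by apply/funext => x; exact: derive_cst.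
exact: cst_continuous.
Qed.

Lemma C1Zl (c : R) F : C1 F -> C1 (fun x => c * F x).
Proof. by move=> cF; apply: C1M => //; exact: C1_cst. Qed.

Lemma C1N F : C1 F -> C1 (fun x => - F x).
Proof. by move=> /(C1Zl (-1)); under eq_fun do rewrite mulN1r. Qed.

Lemma C1B F G : C1 F -> C1 G -> C1 (fun x => F x - G x).
Proof. by move=> cF cG; exact: (C1D cF (C1N cG)). Qed.

Lemma derive_shiftE F (z v x : V) : 'D_v (fun x => F (x + z)) x = 'D_v F (x + z).
Proof. by rewrite /derive; under eq_fun do rewrite /= -addrA. Qed.

Lemma C1_shift F (z : V) : C1 F -> C1 (fun x => F (x + z)).
Proof.
move=> cF; split=> [x|v].
  by apply: differentiable_comp; [exact: differentiableD|exact: cF.1].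
have -> : 'D_v (fun x => F (x + z)) = (fun x => 'D_v F (x + z)).
  by apply/funext => x; exact: derive_shiftE.
move=> x; apply: (@continuous_comp _ _ _ (fun x => x + z) ('D_v F)).
  by apply: cvgD; [exact: cvg_id|exact: cvg_cst].
exact: cF.2.
Qed.

Lemma deriveZlE F (c : R) (v x : V) : C1 F -> 'D_v (fun x => c * F x) x = c * 'D_v F x.
Proof. by move=> cF; rewrite (deriveZ c)//; exact: C1_derivable. Qed.

Lemma deriveDE F G (v x : V) : C1 F -> C1 G ->
  'D_v (fun x => F x + G x) x = 'D_v F x + 'D_v G x.
Proof. by move=> cF cG; rewrite deriveD//; exact: C1_derivable. Qed.

Lemma deriveBE F G (v x : V) : C1 F -> C1 G ->
  'D_v (fun x => F x - G x) x = 'D_v F x - 'D_v G x.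
Proof. by move=> cF cG; rewrite deriveB//; exact: C1_derivable. Qed.

Lemma deriveME F G (v x : V) : C1 F -> C1 G ->
  'D_v (fun x => F x * G x) x = F x * 'D_v G x + 'D_v F x * G x.
Proof. by move=> cF cG; rewrite deriveM//; [rewrite [G x *: _]mulrC|exact: C1_derivable..]. Qed.

End C1Lines.

Section C1Comp.
Context {R : realType} {U V : normedModType R}.

Lemma derive_comp_linear (L : {linear U -> V}) (F : V -> R) (v x : U) :
  'D_v (fun x => F (L x)) x = 'D_(L v) F (L x).
Proof. by rewrite /derive; under eq_fun do rewrite /= linearP. Qed.

Lemma C1_comp_linear (L : {linear U -> V}) (F : V -> R) :
  continuous L -> C1 F -> C1 (fun x => F (L x)).
Proof.
move=> cL cF; split=> [x|v].
  apply: (@differentiable_comp _ _ _ _ L F); last exact: cF.1.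
  exact: linear_differentiable.
have -> : 'D_v (fun x => F (L x)) = (fun x => 'D_(L v) F (L x)).
  by apply/funext => x; exact: derive_comp_linear.
by move=> x; apply: (@continuous_comp _ _ _ L ('D_(L v) F)); [exact: cL|exact: cF.2].
Qed.

End C1Comp.

Section C1Torus.
Context {R : realType}.
Implicit Types F G eta : R * R -> R.

Lemma derive_d1d2 F (z x : R * R) : C1 F -> 'D_z F x = z.1 * d1 F x + z.2 * d2 F x.
Proof.
move=> cF; rewrite /d1 /d2 !deriveE; try exact: cF.1.
case: z => a b /=.
have -> : (a, b) = a *: (1, 0) + b *: ((0, 1) : R * R).
  by apply/pair_equal_spec; split => /=; rewrite ?scaler0 ?addr0 ?add0r [_ *: _]mulr1.
by rewrite linearD !linearZZ.
Qed.

Lemma on_torus_derive F v : on_torus F -> on_torus ('D_v F).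
Proof.
move=> tF x.
have e1 : (fun y : R * R => F (y + (1, 0))) = F.
  apply/funext => y; rewrite -[RHS](tF y).1.
  by congr F; apply/pair_equal_spec; split => //=; rewrite addr0.
have e2 : (fun y : R * R => F (y + (0, 1))) = F.
  apply/funext => y; rewrite -[RHS](tF y).2.
  by congr F; apply/pair_equal_spec; split => //=; rewrite addr0.
have -> : (x.1 + 1, x.2) = x + (1, 0).
  by apply/pair_equal_spec; split => //=; rewrite addr0.
have -> : (x.1, x.2 + 1) = x + (0, 1).
  by apply/pair_equal_spec; split => //=; rewrite addr0.
by rewrite -!derive_shiftE e1 e2.
Qed.

Lemma bm_C1 F : on_torus F -> C1 F -> bm F.
Proof. by move=> tF cF; apply: bm_continuous => //; exact: C1_continuous. Qed.

Lemma bm_derive F v : on_torus F -> C1 F -> bm ('D_v F).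
Proof. by move=> tF cF; apply: bm_continuous; [exact: on_torus_derive|exact: cF.2]. Qed.

Lemma bm_d1 F : on_torus F -> C1 F -> bm (d1 F).
Proof. exact: bm_derive. Qed.

Lemma bm_d2 F : on_torus F -> C1 F -> bm (d2 F).
Proof. exact: bm_derive. Qed.

Lemma tint_d1 F : on_torus F -> C1 F -> torus_int (d1 F) = 0.
Proof.
move=> tF cF; rewrite torus_intE_swap; last exact: bm_d1.
transitivity (\int[@lebesgue_measure R]_(b in `[0%R, 1%R]) (0 : R)); last first.
  by rewrite Rintegral_cst// mul0r.
apply: eq_Rintegral => b _.
transitivity (\int[lebesgue_measure]_(s in `[0%R, 1%R]) 'D_(1, 0) F ((0, b) + s *: (1, 0))).
  apply: eq_Rintegral => a _; rewrite /d1.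
  have -> // : (a, b) = (0, b) + a *: (1, 0).
  by apply/pair_equal_spec; split => /=; rewrite ?add0r ?[_ *: 1]mulr1 ?[_ *: 0]mulr0 ?addr0.
rewrite C1_line_FTC//; apply/eqP; rewrite subr_eq0; apply/eqP.
by rewrite -(tF (0, b)).1; congr F; apply/pair_equal_spec; split => //=; rewrite addr0.
Qed.

Lemma tint_d2 F : on_torus F -> C1 F -> torus_int (d2 F) = 0.
Proof.
move=> tF cF; rewrite torus_intE; last exact: bm_d2.
transitivity (\int[@lebesgue_measure R]_(b in `[0%R, 1%R]) (0 : R)); last first.
  by rewrite Rintegral_cst// mul0r.
apply: eq_Rintegral => a _.
transitivity (\int[lebesgue_measure]_(s in `[0%R, 1%R]) 'D_(0, 1) F ((a, 0) + s *: (0, 1))).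
  apply: eq_Rintegral => b _; rewrite /d2.
  have -> // : (a, b) = (a, 0) + b *: (0, 1).
  by apply/pair_equal_spec; split => /=; rewrite ?add0r ?[_ *: 1]mulr1 ?[_ *: 0]mulr0 ?addr0.
rewrite C1_line_FTC//; apply/eqP; rewrite subr_eq0; apply/eqP.
by rewrite -(tF (a, 0)).2; congr F; apply/pair_equal_spec; split => //=; rewrite addr0.
Qed.

Lemma tint_IBP2 F G : on_torus F -> C1 F -> on_torus G -> C1 G ->
  torus_int (fun x => d2 F x * G x) = - torus_int (fun x => F x * d2 G x).
Proof.
move=> tF cF tG cG; have := tint_d2 (on_torusM tF tG) (C1M cF cG).
have -> : d2 (fun x => F x * G x) = fun x => F x * d2 G x + d2 F x * G x.
  by apply/funext => x; exact: deriveME.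
rewrite tintD; last 2 first.
- by apply: bmM; [exact: bm_C1|exact: bm_d2].
- by apply: bmM; [exact: bm_d2|exact: bm_C1].
by move=> /eqP; rewrite addrC addr_eq0 => /eqP.
Qed.

End C1Torus.

(** * Translation estimate for the stream function *)

Section Energy.
Context {R : realType}.
Implicit Types F G psi w eta : R * R -> R.

Lemma Rint01_cst (c : R) : \int[@lebesgue_measure R]_(s in `[0%R, 1%R]) c = c.
Proof.
rewrite Rintegral_cst//.
have -> : fine (@lebesgue_measure R `[0%R, 1%R]) = 1 by rewrite [X in fine X]leb01.
by rewrite mulr1.
Qed.

Lemma normr_Rint01_bound (h : R -> R) (M : R) : bm h -> (forall s, `|h s| <= M) ->
  `|\int[@lebesgue_measure R]_(s in `[0%R, 1%R]) h s| <= M.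
Proof.
move=> bh hM; rewrite -[leRHS]Rint01_cst.
apply: (normr_Rint_le (mu := @lebesgue_measure R)) => //; first exact: leb_itv_ltoo.
exact: bm_cst.
Qed.

(** Nonnegativity of the variance, on an interval of length one. *)
Lemma Rint01_sqr_le (h : R -> R) : bm h ->
  (\int[@lebesgue_measure R]_(s in `[0%R, 1%R]) h s) ^+ 2 <=
  \int[@lebesgue_measure R]_(s in `[0%R, 1%R]) (h s ^+ 2).
Proof.
move=> bh; set c := \int[lebesgue_measure]_(s in _) h s.
have m01 : measurable (`[0%R, 1%R]%classic : set R) by exact: measurable_itv.
have : 0 <= \int[@lebesgue_measure R]_(s in `[0%R, 1%R]) ((h s - c) ^+ 2).
  by apply: Rintegral_ge0 => s _; exact: sqr_ge0.
have -> : (fun s => (h s - c) ^+ 2) = (fun s => h s ^+ 2 + ((- 2 * c) * h s + c ^+ 2)).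
  by apply/funext => s; ring.
have bcst (k : R) : bm (fun _ : measurableTypeR R => k) by exact: bm_cst.
have b2 : bm (fun s : measurableTypeR R => h s ^+ 2) by exact: bmX.
have b1 : bm (fun s : measurableTypeR R => - 2 * c * h s) by exact: bmM.
rewrite (RintD (mu := @lebesgue_measure R) m01 (leb_itv_ltoo _ _) b2 (bmD b1 (bcst _))).
rewrite (RintD (mu := @lebesgue_measure R) m01 (leb_itv_ltoo _ _) b1 (bcst _)).
rewrite (RintZl (mu := @lebesgue_measure R) m01 (leb_itv_ltoo _ _))//.
rewrite Rint01_cst -/c; lra.
Qed.

Lemma measurable_line (x z : R * R) : measurable_fun [set: R] (fun s : R => x + s *: z).
Proof.
by apply: measurable_fun_pair => /=; apply: measurable_funD => //; exact: measurable_funM.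
Qed.

Lemma bm_line G (x z : R * R) : bm G -> bm (fun s : R => G (x + s *: z)).
Proof. by apply: bm_comp; exact: measurable_line. Qed.

Lemma measurable_addr (z : R * R) : measurable_fun [set: R * R] (fun x : R * R => (x + z : R * R)).
Proof. by apply: measurable_fun_pair => /=; exact: measurable_funD. Qed.

Lemma bm_addr G (z : R * R) : bm G -> bm (fun x : R * R => G (x + z)).
Proof. by apply: bm_comp; exact: measurable_addr. Qed.

Lemma bm_sweep G (z : R * R) : bm G -> bm (fun p : R * (R * R) => G (p.2 + p.1 *: z)).
Proof.
apply: (bm_comp (h := fun p : R * (R * R) => (p.2 + p.1 *: z : R * R))).
have m1 : measurable_fun setT (fun p : R * (R * R) => p.1) by exact: measurable_fst.
have m2 : measurable_fun setT (fun p : R * (R * R) => p.2.1).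
  exact: (measurableT_comp measurable_fst measurable_snd).
have m3 : measurable_fun setT (fun p : R * (R * R) => p.2.2).
  exact: (measurableT_comp measurable_snd measurable_snd).
apply: measurable_fun_pair => /=; apply: measurable_funD => //; exact: measurable_funM.
Qed.

(** The increment is the mean of ['D_z F] along the segment from x to x + z. Jensen moves the square
    inside, and after Fubini each point of the segment contributes the same integral by translation
    invariance. *)
Lemma tint_diff_sqr_le F (z : R * R) : on_torus F -> C1 F ->
  `|z.1| <= 1 -> `|z.2| <= 1 ->
  torus_int (fun x => (F (x + z) - F x) ^+ 2) <= torus_int (fun x => 'D_z F x ^+ 2).
Proof.
move=> tF cF z1 z2.
have bF := bm_C1 tF cF; have bD := bm_derive z tF cF.
have bD2 : bm (fun x : R * R => 'D_z F x ^+ 2) by exact: bmX.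
have bS := bm_sweep z bD2.
have bI : bm (fun x : R * R => \int[@lebesgue_measure R]_(s in `[0%R, 1%R]) 'D_z F (x + s *: z) ^+ 2).
  have := bm_Rint2 (m2 := @lebesgue_measure R) (measurable_itv `[0%R, 1%R]) (leb_itv_ltoo _ _)
    (f := fun p : (R * R) * R => 'D_z F (p.1 + p.2 *: z) ^+ 2); apply.
  apply: (bm_comp (h := fun p : (R * R) * R => (p.2, p.1))) bS.
  by apply: measurable_fun_pair; [exact: measurable_snd|exact: measurable_fst].
apply: (@le_trans _ _ (torus_int (fun x =>
  \int[@lebesgue_measure R]_(s in `[0%R, 1%R]) 'D_z F (x + s *: z) ^+ 2))).
  apply: le_tint => //; first by apply/bmX/bmB => //; exact: bm_addr.
  by move=> x; rewrite -C1_line_FTC//; exact: (Rint01_sqr_le (bm_line x z bD)).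
rewrite -(tint_itv_swap 0 1 bS) /=.
rewrite le_eqVlt; apply/orP; left; apply/eqP.
transitivity (\int[@lebesgue_measure R]_(t in `[0%R, 1%R]) torus_int (fun x => 'D_z F x ^+ 2)).
  apply: eq_Rintegral => t; rewrite inE/= in_itv/= => /andP[t0 t1].
  have tz (a : R) : `|a| <= 1 -> `|t * a| <= 1.
    by move=> a1; rewrite normrM (ger0_norm t0) mulr_ile1.
  apply: (tint_shift (f := fun x => 'D_z F x ^+ 2)) => //; [|exact: tz..].
  exact: (on_torus_comp (fun r => r ^+ 2) (on_torus_derive z tF)).
exact: Rint01_cst.
Qed.

(** Discrete counterpart of integrating - a a'' by parts to get the integral of a'^2: one of the two
    halves of the second difference is translated by [z]. *)
Lemma tint_second_diff (a : R * R -> R) (z : R * R) : bm a -> on_torus a ->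
  `|z.1| <= 1 -> `|z.2| <= 1 ->
  torus_int (fun x => a x * (2 * a x - a (x + z) - a (x - z))) =
  torus_int (fun x => (a (x + z) - a x) ^+ 2).
Proof.
move=> ba ta z1 z2.
have baz := bm_addr z ba; have bam := bm_addr (- z) ba.
have -> : (fun x => a x * (2 * a x - a (x + z) - a (x - z))) =
   (fun x => (a x * (a x - a (x + z)) + a x * (a x - a (x - z)))) by apply/funext => x; ring.
have -> : (fun x => (a (x + z) - a x) ^+ 2) =
   (fun x => a x * (a x - a (x + z)) + a (x + z) * (a (x + z) - a x)) by apply/funext => x; ring.
rewrite !tintD; [congr (_ + _)|exact: (bmM ba (bmB ba baz))|exact: (bmM baz (bmB baz ba))|exact: (bmM ba (bmB ba baz))|exact: (bmM ba (bmB ba bam))].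
rewrite -(tint_shift (f := fun x => a x * (a x - a (x - z))) (z := z))//.
- by apply: eq_tint => x; rewrite addrK.
- exact: (bmM ba (bmB ba bam)).
- by apply: on_torusM => //; apply: on_torusB => //; exact: on_torus_shift.
Qed.

(* The H^2 bound for the stream function, in finite-difference form: test the
   Poisson equation with minus the second difference of psi. *)
Lemma poisson_translation psi w (B : R) (z : R * R) :
  on_torus psi -> C1 psi -> weak_poisson psi w -> bm w ->
  (forall x, `|w x - torus_mean w| <= B) -> `|z.1| <= 1 -> `|z.2| <= 1 ->
  torus_int (fun x => (d1 psi (x + z) - d1 psi x) ^+ 2 +
                      (d2 psi (x + z) - d2 psi x) ^+ 2) <=
  B ^+ 2 * (z.1 ^+ 2 + z.2 ^+ 2).
Proof.
move=> tp cp wp bw wB z1 z2.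
set E := torus_int _; set q := _ + z.2 ^+ 2.
pose eta x := 2 * psi x - psi (x + z) - psi (x - z).
have cpz : C1 (fun x => psi (x + z)) by exact: C1_shift.
have cpm : C1 (fun x => psi (x - z)) by exact: C1_shift.
have c2p : C1 (fun x => 2 * psi x) by exact: C1Zl.
have tpz : on_torus (fun x => psi (x + z)) by exact: on_torus_shift.
have tpm : on_torus (fun x => psi (x - z)) by exact: on_torus_shift.
have teta : on_torus eta.
  by apply: on_torusB => //; apply: on_torusB => //; apply: on_torusM.
have ceta : C1 eta by exact: (C1B (C1B c2p cpz) cpm).
have deta v x : 'D_v eta x = 2 * 'D_v psi x - 'D_v psi (x + z) - 'D_v psi (x - z).
  rewrite (deriveBE _ _ (C1B c2p cpz) cpm) (deriveBE _ _ c2p cpz) (deriveZlE _ _ _ cp).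
  by rewrite !derive_shiftE.
have bd1 := bm_d1 tp cp; have bd2 := bm_d2 tp cp.
have td1 : on_torus (d1 psi) by exact: on_torus_derive.
have td2 : on_torus (d2 psi) by exact: on_torus_derive.
have bD1 : bm (fun x : R * R => (d1 psi (x + z) - d1 psi x) ^+ 2).
  by apply/bmX/bmB => //; exact: bm_addr.
have bD2 : bm (fun x : R * R => (d2 psi (x + z) - d2 psi x) ^+ 2).
  by apply/bmX/bmB => //; exact: bm_addr.
have EE : E = torus_int (fun x => (w x - torus_mean w) * eta x).
  rewrite -(wp _ teta ceta) /E (tintD bD1 bD2) -(tint_second_diff bd1 td1 z1 z2) -(tint_second_diff bd2 td2 z1 z2).
  rewrite -tintD; last 2 first.
  - by apply: bmM => //; apply: bmB; [apply: bmB; [apply: bmM => //; exact: bm_cst|exact: bm_addr]|exact: bm_addr].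
  - by apply: bmM => //; apply: bmB; [apply: bmB; [apply: bmM => //; exact: bm_cst|exact: bm_addr]|exact: bm_addr].
  by apply: eq_tint => x; rewrite /d1 /d2 !deta.
pose del x := psi (x + z) - psi x.
have tdel : on_torus del by exact: on_torusB.
have cdel : C1 del by exact: C1B.
have beta : bm eta by exact: bm_C1.
have beta2 : bm (fun x : R * R => eta x ^+ 2) by exact: bmX.
(* After translation by [z], [eta] is minus the increment of the increment [del]. The derivative of
   [del] along [z] is bounded by Cauchy-Schwarz in the plane, which produces |z|^2 times the energy
   [E] itself. *)
have eta2 : torus_int (fun x => eta x ^+ 2) <= q * E.
  rewrite -(tint_shift (f := fun x => eta x ^+ 2) (z := z))//; last exact: (on_torus_comp (fun r => r ^+ 2)).
  have -> : (fun x => eta (x + z) ^+ 2) = (fun x => (del (x + z) - del x) ^+ 2).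
    by apply/funext => x; rewrite /eta /del addrK; ring.
  apply: le_trans (tint_diff_sqr_le tdel cdel z1 z2) _.
  rewrite -(tintZl q (bmD bD1 bD2)).
  apply: le_tint; first exact: (bmX 2 (bm_derive z tdel cdel)).
    exact: (bmM (bm_cst q) (bmD bD1 bD2)).
  move=> x; rewrite derive_d1d2// /q.
  have -> : d1 del x = d1 psi (x + z) - d1 psi x by rewrite /d1 (deriveBE _ _ cpz cp) derive_shiftE.
  have -> : d2 del x = d2 psi (x + z) - d2 psi x by rewrite /d2 (deriveBE _ _ cpz cp) derive_shiftE.
  set a := d1 psi _ - _; set b := d2 psi _ - _; rewrite -subr_ge0.
  have -> : (z.1 ^+ 2 + z.2 ^+ 2) * (a ^+ 2 + b ^+ 2) - (z.1 * a + z.2 * b) ^+ 2 =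
    (z.1 * b - z.2 * a) ^+ 2 by ring.
  exact: sqr_ge0.
have q0 : 0 <= q by rewrite addr_ge0// sqr_ge0.
(* The case z = 0 is separated because [q] = |z|^2 is used as a weight and inverted below. *)
have [qz|qz] := eqVneq q 0.
  have := eta2; rewrite qz mul0r mulr0 => eta2'.
  move: qz => /eqP; rewrite paddr_eq0 ?sqr_ge0// !sqrf_eq0 => /andP[/eqP a0 /eqP b0].
  have z0 : z = 0 by move: a0 b0; case: (z) => ? ? /= -> ->.
  rewrite /E z0; under eq_fun do rewrite addr0 !subrr expr0n/= addr0.
  by rewrite tint_cst.
have q1 : 0 < q by rewrite lt0r qz.
(* Young's inequality with weight [q] on (w - mean) * eta: by [eta2] the term eta^2 / (2 q)
   integrates to at most E / 2, which is absorbed on the left. *)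
suff : E <= q * B ^+ 2 / 2 + E / 2 by lra.
rewrite {1}EE.
have bwm : bm (fun x => (w x - torus_mean w) * eta x).
  by apply: bmM => //; apply: bmB => //; exact: bm_cst.
apply: (@le_trans _ _ (torus_int (fun x => q * B ^+ 2 / 2 + (2 * q)^-1 * eta x ^+ 2))).
  apply: le_tint => //.
    by apply: bmD; [exact: bm_cst|apply: bmM => //; exact: bm_cst].
  move=> x; set v := w x - _.
  have vB : v ^+ 2 <= B ^+ 2 by rewrite -(real_normK (num_real v)) lerXn2r ?nnegrE ?normr_ge0// (le_trans _ (wB x)).
  rewrite -subr_ge0.
  have -> : q * B ^+ 2 / 2 + (2 * q)^-1 * eta x ^+ 2 - v * eta x =
     q / 2 * (B ^+ 2 - v ^+ 2) + (2 * q)^-1 * (eta x - q * v) ^+ 2 by field; rewrite qz.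
  by rewrite addr_ge0// mulr_ge0// ?subr_ge0// ?sqr_ge0// ?divr_ge0 ?invr_ge0 ?mulr_ge0.
rewrite tintD; [|exact: bm_cst|by apply: bmM => //; exact: bm_cst].
rewrite tint_cst tintZl// lerD2l.
apply: le_trans (ler_wpM2l _ eta2) _; first by rewrite invr_ge0 mulr_ge0.
by rewrite le_eqVlt; apply/orP; left; apply/eqP; field; rewrite qz.
Qed.

(** The quotient is the mean of ['D_e F] over a short segment. Bounded convergence is used twice,
    along the segment and on the torus, both times with the sup bound of ['D_e F]. *)
Lemma tint_diff_quotient_cvg F G (e : R * R) (h : nat -> R) :
  on_torus F -> C1 F -> bm G -> (forall n, h n != 0) -> h n @[n --> \oo] --> 0 ->
  torus_int (fun x => G x * ((F (x + h n *: e) - F x) / h n)) @[n --> \oo] -->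
  torus_int (fun x => G x * 'D_e F x).
Proof.
move=> tF cF bG h0 hc.
have bF := bm_C1 tF cF; have bD := bm_derive e tF cF.
have qE n x : (F (x + h n *: e) - F x) / h n =
    \int[@lebesgue_measure R]_(s in `[0%R, 1%R]) 'D_e F (x + s *: (h n *: e)).
  rewrite -C1_line_FTC//.
  have -> : (fun s : R => 'D_(h n *: e) F (x + s *: (h n *: e))) =
     (fun s : R => 'D_e F (x + s *: (h n *: e)) * h n).
    apply/funext => s; rewrite !(derive_d1d2 _ _ cF).
    have -> : (h n *: e).1 = h n * e.1 by [].
    have -> : (h n *: e).2 = h n * e.2 by [].
    ring.
  rewrite (RintZr (mu := @lebesgue_measure R) (measurable_itv _) (leb_itv_ltoo _ _)).
    by rewrite mulfK.
  exact: (bm_line x (h n *: e) bD).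
have [_ [M MD]] := bD; have [_ [N NG]] := bG.
apply: (tint_cvg (M := N * M)).
- move=> n; apply: bmM => //; apply: bmM; last exact: bm_cst.
  by apply: bmB => //; exact: bm_addr.
- exact: bmM.
- move=> n x; rewrite normrM ler_pM// qE.
  by apply: normr_Rint01_bound => // ; exact: (bm_line x (h n *: e) bD).
- move=> x; apply: cvgM; first exact: cvg_cst.
  under eq_cvg do rewrite qE.
  have -> : 'D_e F x = \int[@lebesgue_measure R]_(s in `[0%R, 1%R]) 'D_e F x.
    by rewrite Rint01_cst.
  apply: (Rint_bounded_cvg (mu := @lebesgue_measure R) (measurable_itv _) (leb_itv_ltoo _ _)
    (fun n => bm_line x (h n *: e) bD) (bm_cst _) (fun n s _ => MD _)).
  move=> s _.
  have hx : x + s *: (h n *: e) @[n --> \oo] --> x.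
    rewrite -[X in _ --> X]addr0; apply: cvgD; first exact: cvg_cst.
    rewrite -(scaler0 _ s); apply: cvgZl_tmp; rewrite -(scale0r e); exact: cvgZr_tmp.
  exact: (cvg_comp _ _ hx (cF.2 e x)).
Qed.

Lemma tint_grad_perp psi eta : on_torus psi -> C1 psi -> on_torus eta -> C1 eta ->
  torus_int (fun x => (grad_perp psi x).1 * d1 eta x + (grad_perp psi x).2 * d2 eta x) = 0.
Proof.
move=> tp cp te ce.
have bd1p := bm_d1 tp cp; have bd2p := bm_d2 tp cp.
have bd1e := bm_d1 te ce; have bd2e := bm_d2 te ce.
have bp := bm_C1 tp cp; have be := bm_C1 te ce.
pose h n : R := n.+1%:R^-1.
have h0 n : h n != 0 by rewrite invr_eq0 pnatr_eq0.
have hc : h n @[n --> \oo] --> (0 : R) by exact: cvg_harmonic.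
have hN : - h n @[n --> \oo] --> (0 : R) by rewrite -oppr0; exact: cvgN.
have A := tint_diff_quotient_cvg (e := (1, 0)) te ce bd2p h0 hc.
have hN0 n : - h n != 0 by rewrite oppr_eq0.
have C := tint_diff_quotient_cvg (e := (1, 0)) tp cp bd2e hN0 hN.
rewrite /grad_perp /=.
have -> : (fun x => d2 psi x * d1 eta x + - d1 psi x * d2 eta x) =
   (fun x => d2 psi x * d1 eta x - d2 eta x * d1 psi x) by apply/funext => x; ring.
rewrite tintB; [|exact: bmM..].
apply/eqP; rewrite subr_eq0; apply/eqP.
apply: cvg_unique A _; first exact: Rhausdorff.
suff -> : (fun n => torus_int (fun x => d2 psi x * ((eta (x + h n *: (1, 0)) - eta x) / h n))) =
    (fun n => torus_int (fun x => d2 eta x * ((psi (x + - h n *: (1, 0)) - psi x) / - h n))).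
  exact: C.
apply/funext => n; set z : R * R := h n *: (1, 0).
have z1 : `|z.1| <= 1.
  by rewrite /z /= [_ *: _]mulr1 ger0_norm ?invr_ge0// invf_le1 ?ler1n.
have z2 : `|z.2| <= 1 by rewrite /z /= [_ *: _]mulr0 normr0.
have -> : (fun x => d2 psi x * ((eta (x + z) - eta x) / h n)) =
   (fun x => (h n)^-1 * (d2 psi x * (eta (x + z) - eta x))) by apply/funext => x; ring.
rewrite tintZl; last by apply: bmM => //; apply: bmB => //; exact: bm_addr.
have ts := on_torus_shift z te; have cs := C1_shift z ce.
rewrite (tint_IBP2 tp cp (on_torusB ts te) (C1B cs ce)).
have -> : (fun x => psi x * d2 (fun x => eta (x + z) - eta x) x) =
   (fun x => psi x * d2 eta (x + z) - psi x * d2 eta x).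
  by apply/funext => x; rewrite /d2 deriveBE// derive_shiftE mulrBr.
rewrite tintB; [|by apply: bmM => //; exact: bm_addr|exact: bmM].
have -> : torus_int (fun x => psi x * d2 eta (x + z)) = torus_int (fun x => psi (x - z) * d2 eta x).
  rewrite -(tint_shift (f := fun x => psi (x - z) * d2 eta x) (z := z))//.
  - by apply: eq_tint => x; rewrite addrK.
  - by apply: bmM => //; exact: bm_addr.
  - by apply: on_torusM; [exact: on_torus_shift|exact: on_torus_derive].
have -> : (fun x => d2 eta x * ((psi (x + - h n *: (1, 0)) - psi x) / - h n)) =
  (fun x => - (h n)^-1 * (psi (x - z) * d2 eta x - psi x * d2 eta x)).
  by apply/funext => x; rewrite /z scaleNr invrN; ring.
rewrite tintZl ?tintB//; try (by apply: bmM => //; exact: bm_addr); try exact: bmM.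
  by ring.
by apply: bmB; [apply: bmM => //; exact: bm_addr|exact: bmM].
Qed.

End Energy.

(** * The trigonometric kernel *)

Section TrigKernel.
Context {R : realType}.
Implicit Types (s t : R) (m : nat).

(** With this scaling a unit shift changes the sign of [cpi] and [spi], so exactly the monomials of
    even total degree in them are 1-periodic. *)
Definition cpi s := cos (pi * s).

Definition spi s := sin (pi * s).

Lemma cpi_spi s : cpi s ^+ 2 + spi s ^+ 2 = 1.
Proof. exact: cos2Dsin2. Qed.

Lemma cpi_addr1 s : cpi (s + 1) = - cpi s.
Proof. by rewrite /cpi mulrDr mulr1 cosDpi. Qed.

Lemma spi_addr1 s : spi (s + 1) = - spi s.
Proof. by rewrite /spi mulrDr mulr1 sinDpi. Qed.

Lemma cpiN s : cpi (- s) = cpi s.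
Proof. by rewrite /cpi mulrN cosN. Qed.

Lemma spiN s : spi (- s) = - spi s.
Proof. by rewrite /spi mulrN sinN. Qed.

Lemma cpiB s t : cpi (s - t) = cpi s * cpi t + spi s * spi t.
Proof. by rewrite /cpi mulrBr cosB. Qed.

Lemma spiB s t : spi (s - t) = spi s * cpi t - cpi s * spi t.
Proof. by rewrite /spi mulrBr sinB. Qed.

Lemma is_derive_cpi s : is_derive s (1 : R) cpi (- (pi * spi s)).
Proof.
have d : is_derive s (1 : R) (fun r : R => pi * r) pi.
  by apply: is_derive_eq; rewrite [_ *: _]mulr1.
have := @is_derive1_comp _ cos (fun r : R => pi * r) s _ _ (is_derive_cos _) d.
by rewrite mulNr mulrC.
Qed.

Lemma is_derive_spi s : is_derive s (1 : R) spi (pi * cpi s).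
Proof.
have d : is_derive s (1 : R) (fun r : R => pi * r) pi.
  by apply: is_derive_eq; rewrite [_ *: _]mulr1.
have := @is_derive1_comp _ sin (fun r : R => pi * r) s _ _ (is_derive_sin _) d.
by rewrite mulrC.
Qed.

Lemma C1_of_is_derive (G g : R -> R) :
  (forall s, is_derive s (1 : R) G (g s)) -> continuous g -> C1 G.
Proof.
move=> dG cg.
have df x : differentiable G x by apply/derivable1_diffP.
split=> // v.
have -> : 'D_v G = fun x => v * g x.
  apply/funext => x; rewrite deriveE//.
  rewrite -[v in LHS]mulr1 -[v * 1]/(v *: (1 : R)) linearZZ -deriveE//.
  by rewrite derive_val.
by move=> x; apply: cvgM; [exact: cvg_cst|exact: cg].
Qed.

Lemma continuous_cpi : continuous cpi.
Proof.
move=> s; apply: differentiable_continuous; apply/derivable1_diffP.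
exact: (@ex_derive _ _ _ _ _ _ _ (is_derive_cpi s)).
Qed.

Lemma continuous_spi : continuous spi.
Proof.
move=> s; apply: differentiable_continuous; apply/derivable1_diffP.
exact: (@ex_derive _ _ _ _ _ _ _ (is_derive_spi s)).
Qed.

Lemma C1_cpi : C1 cpi.
Proof.
apply: (C1_of_is_derive is_derive_cpi) => s.
by apply: cvgN; apply: cvgM; [exact: cvg_cst|exact: continuous_spi].
Qed.

Lemma C1_spi : C1 spi.
Proof.
apply: (C1_of_is_derive is_derive_spi) => s.
by apply: cvgM; [exact: cvg_cst|exact: continuous_cpi].
Qed.

Lemma C1X {V : normedModType R} (F : V -> R) n : C1 F -> C1 (fun x => F x ^+ n).
Proof.
move=> cF; elim: n => [|n ih]; first exact: C1_cst.
by under eq_fun do rewrite exprS; exact: C1M.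
Qed.

Lemma deriveXE {V : normedModType R} (F : V -> R) n (v x : V) : C1 F ->
  'D_v (fun x => F x ^+ n) x = n%:R * F x ^+ n.-1 * 'D_v F x.
Proof.
move=> cF; elim: n => [|n ih]; first by rewrite !mul0r; exact: derive_cst.
under eq_fun do rewrite exprS.
rewrite (deriveME _ _ cF (C1X n cF)) ih /=.
case: n {ih} => [|n] /=; first by rewrite expr0; ring.
by rewrite -[n.+2%:R]natr1 exprS; ring.
Qed.

Lemma derive_cpi s : 'D_1 cpi s = - (pi * spi s).
Proof. by have d := is_derive_cpi s; rewrite derive_val. Qed.

Lemma derive_spi s : 'D_1 spi s = pi * cpi s.
Proof. by have d := is_derive_spi s; rewrite derive_val. Qed.

Lemma FTC01 (G g : R -> R) : (forall s, is_derive s (1 : R) G (g s)) -> continuous g ->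
  \int[lebesgue_measure]_(s in `[0%R, 1%R]) g s = G 1 - G 0.
Proof.
move=> dG cg; rewrite -{2}[1]add0r -C1_line_FTC; last exact: C1_of_is_derive cg.
by apply: eq_Rintegral => s _; rewrite derive_val add0r [_ *: 1]mulr1.
Qed.

Definition ck m s := (cpi s ^+ 2) ^+ m.

(** Wallis integrals. Ratios of consecutive values suffice for all moments of the kernel. *)
Definition ci m : R := \int[lebesgue_measure]_(s in `[0%R, 1%R]) ck m s.

Lemma ckS m s : ck m.+1 s = cpi s ^+ 2 * ck m s.
Proof. by rewrite /ck exprS. Qed.

Lemma ck_ge0 m s : 0 <= ck m s.
Proof. by rewrite exprn_ge0// sqr_ge0. Qed.

Lemma ck_addr1 m s : ck m (s + 1) = ck m s.
Proof. by rewrite /ck cpi_addr1 sqrrN. Qed.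

Lemma ckN m s : ck m (- s) = ck m s.
Proof. by rewrite /ck cpiN. Qed.

Lemma bm_cpi : bm cpi.
Proof.
split; first exact: continuous_measurable_fun continuous_cpi.
by exists 1 => s; exact: cos_max.
Qed.

Lemma bm_spi : bm spi.
Proof.
split; first exact: continuous_measurable_fun continuous_spi.
by exists 1 => s; exact: sin_max.
Qed.

Lemma bm_ck m : bm (ck m).
Proof. by apply: bmX; apply: bmX; exact: bm_cpi. Qed.

Lemma C1_ck m : C1 (ck m).
Proof. by apply: C1X; apply: C1X; exact: C1_cpi. Qed.

Lemma derive_ck m s : 'D_1 (ck m) s = - (2 * m%:R * pi) * spi s * cpi s * ck m.-1 s.
Proof.
rewrite (deriveXE _ _ _ (C1X 2 C1_cpi)) (deriveXE _ _ _ C1_cpi) derive_cpi /ck /= expr1.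
by ring.
Qed.

(* Integrate the derivative of [ck m s * (cpi s * spi s)] over a period. *)
Lemma ci_rec m : (2 * m%:R + 2) * ci m.+1 = (2 * m%:R + 1) * ci m.
Proof.
pose G s := ck m s * (cpi s * spi s).
pose g s := pi * ((2 * m%:R + 2) * ck m.+1 s - (2 * m%:R + 1) * ck m s).
have dG s : is_derive s (1 : R) G (g s).
  have ccs : C1 (fun s => cpi s * spi s) := C1M C1_cpi C1_spi.
  have cG : C1 G := C1M (C1_ck m) ccs.
  have -> : g s = 'D_1 G s; last exact/derivableP/C1_derivable.
  rewrite (deriveME _ _ (C1_ck m) ccs) (deriveME _ _ C1_cpi C1_spi).
  rewrite derive_ck derive_cpi derive_spi /g /ck [in LHS]exprS.
  have e : spi s ^+ 2 = 1 - cpi s ^+ 2 by rewrite -(cpi_spi s) addrAC subrr add0r.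
  case: m {G g cG} => [|k] /=.
    by rewrite !expr0; ring: e.
  have -> : (cpi s ^+ 2) ^+ k.+1 = cpi s ^+ 2 * (cpi s ^+ 2) ^+ k by rewrite exprS.
  by rewrite -[k.+1%:R]natr1; ring: e.
have cg : continuous g.
  have cck n : continuous (ck n) by exact: C1_continuous (C1_ck n).
  move=> s; apply: cvgM; first exact: cvg_cst.
  by apply: cvgB; apply: cvgM; [exact: cvg_cst|exact: cck|exact: cvg_cst|exact: cck].
have := FTC01 dG cg; rewrite /G.
have -> : spi 1 = 0 by rewrite /spi mulr1 sinpi.
have -> : spi 0 = 0 by rewrite /spi mulr0 sin0.
rewrite !mulr0 subrr /g.
have b1 : bm (fun s => (2 * m%:R + 2) * ck m.+1 s) by exact: (bmM (bm_cst _) (bm_ck _)).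
have b2 : bm (fun s => (2 * m%:R + 1) * ck m s) by exact: (bmM (bm_cst _) (bm_ck _)).
have mI : measurable (`[0%R, 1%R]%classic : set R) by exact: measurable_itv.
rewrite (RintZl (mu := lebesgue_measure) mI (leb_itv_ltoo _ _) _ (bmB b1 b2)).
rewrite (RintB (mu := lebesgue_measure) mI (leb_itv_ltoo _ _) b1 b2).
rewrite !(RintZl (mu := lebesgue_measure) mI (leb_itv_ltoo _ _) _ (bm_ck _)) -!/(ci _).
move=> /eqP; rewrite mulf_eq0 gt_eqF ?pi_gt0//= subr_eq0 => /eqP ->.
by [].
Qed.

Lemma ci0 : ci 0 = 1.
Proof. by rewrite /ci /ck; under eq_Rintegral do rewrite expr0; exact: Rint01_cst. Qed.

Lemma ciS m : ci m.+1 = (2 * m%:R + 1) / (2 * m%:R + 2) * ci m.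
Proof.
have h : 2 * m%:R + 2 != 0 :> R by rewrite gt_eqF// addr_gt0// ltr_pwDr// mulr_ge0.
by apply: (mulfI h); rewrite ci_rec; field.
Qed.

Lemma ci_gt0 m : 0 < ci m.
Proof.
elim: m => [|m ih]; first by rewrite ci0.
by rewrite ciS mulr_gt0// divr_gt0// ltr_wpDl// mulr_ge0.
Qed.

Lemma int01_period_int (h : R -> R) (k : int) s :
  (forall s, h (s + 1) = h s) -> h (s + k%:~R) = h s.
Proof.
move=> ph; have := on_torus_addz (f := fun x : R * R => h x.1) k 0 (s, 0).
by apply => x /=; rewrite ph.
Qed.

Lemma int01_reflect (h : R -> R) (c : R) : bm h ->
  (forall s, h (s + 1) = h s) -> (forall s, h (- s) = h s) ->
  \int[lebesgue_measure]_(s in `[0%R, 1%R]) h (c - s) =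
  \int[lebesgue_measure]_(s in `[0%R, 1%R]) h s.
Proof.
move=> bh ph eh; pose c' := c - (Num.floor c)%:~R.
have c0 : 0 <= c' by rewrite subr_ge0 floor_le.
have c1 : c' <= 1 by rewrite lerBlDr addrC -intrD1 ltW// floorD1_gt.
rewrite -(leb_int1_shift (h := h) (c := - c') bh ph); last by rewrite normrN ger0_norm.
apply: eq_Rintegral => s _; rewrite -eh opprB -(int01_period_int (Num.floor c) _ ph).
by congr h; rewrite /c'; ring.
Qed.

Lemma tint_conv_prod (a b : R -> R) (x : R * R) : bm a -> bm b ->
  (forall s, a (s + 1) = a s) -> (forall s, a (- s) = a s) ->
  (forall s, b (s + 1) = b s) -> (forall s, b (- s) = b s) ->
  torus_int (fun y => a (x.1 - y.1) * b (x.2 - y.2)) =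
  (\int[lebesgue_measure]_(s in `[0%R, 1%R]) a s) *
  (\int[lebesgue_measure]_(s in `[0%R, 1%R]) b s).
Proof.
move=> ba bb pa ea pb eb.
have mI : measurable (`[0%R, 1%R]%classic : set R) by exact: measurable_itv.
have bs (h : R -> R) (c : R) : bm h -> bm (fun s : R => h (c - s)).
  apply: (bm_comp (h := fun s : R => c - s)).
  by apply: measurable_funB.
have bs1 := bs _ x.1 ba; have bs2 := bs _ x.2 bb.
rewrite torus_intE; last first.
  apply: bmM; first exact: (bm_comp (h := fst) measurable_fst bs1).
  exact: (bm_comp (h := snd) measurable_snd bs2).
rewrite -(int01_reflect x.1 ba pa ea) -(int01_reflect x.2 bb pb eb).
rewrite -(RintZr (mu := lebesgue_measure) mI (leb_itv_ltoo _ _) _ bs1).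
apply: eq_Rintegral => s _ /=.
by rewrite (RintZl (mu := lebesgue_measure) mI (leb_itv_ltoo _ _) _ bs2).
Qed.

Definition kern m (z : R * R) : R := ck m z.1 / ci m * (ck m z.2 / ci m).

Lemma kern_ge0 m z : 0 <= kern m z.
Proof. by rewrite mulr_ge0// divr_ge0 ?ck_ge0// ltW// ci_gt0. Qed.

Lemma bm_ckn m : bm (fun s => ck m s / ci m).
Proof. exact: (bmM (bm_ck m) (bm_cst _)). Qed.

Lemma int01_ckn m : \int[lebesgue_measure]_(s in `[0%R, 1%R]) (ck m s / ci m) = 1.
Proof.
rewrite (RintZr (mu := lebesgue_measure) _ (leb_itv_ltoo _ _) _ (bm_ck m)).
  by rewrite divff// gt_eqF// ci_gt0.
exact: measurable_itv.
Qed.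

Lemma tint_kern m x : torus_int (fun y => kern m (x - y)) = 1.
Proof.
have per s : ck m (s + 1) / ci m = ck m s / ci m by rewrite ck_addr1.
have ev s : ck m (- s) / ci m = ck m s / ci m by rewrite ckN.
have := tint_conv_prod x (bm_ckn m) (bm_ckn m) per ev per ev.
by rewrite int01_ckn mulr1.
Qed.

(** Writing sin^2 = 1 - cos^2 leaves one minus a Wallis ratio. This is the second moment of the
    kernel in one variable, so its width is of order m^(-1/2). *)
Lemma int01_spi2 m : \int[lebesgue_measure]_(s in `[0%R, 1%R])
  (spi s ^+ 2 * (ck m s / ci m)) = (2 * m%:R + 2)^-1.
Proof.
have mI : measurable (`[0%R, 1%R]%classic : set R) by exact: measurable_itv.
have h : 2 * m%:R + 2 != 0 :> R by rewrite gt_eqF// addr_gt0// ltr_pwDr// mulr_ge0.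
have c0 := lt0r_neq0 (ci_gt0 m).
transitivity (\int[lebesgue_measure]_(s in `[0%R, 1%R])
  (ck m s * (ci m)^-1 - ck m.+1 s * (ci m)^-1)).
  apply: eq_Rintegral => s _; rewrite ckS.
  have -> : spi s ^+ 2 = 1 - cpi s ^+ 2 by rewrite -(cpi_spi s) addrAC subrr add0r.
  by ring.
rewrite (RintB (mu := lebesgue_measure) mI (leb_itv_ltoo _ _) (bm_ckn m) (bmM (bm_ck m.+1) (bm_cst _))).
rewrite !(RintZr (mu := lebesgue_measure) mI (leb_itv_ltoo _ _) _ (bm_ck _)) -!/(ci _).
by rewrite ciS; field; rewrite h c0.
Qed.

(** Expand (1 - cos^2)^2 and use two Wallis ratios. The decay like m^(-2) is what compensates the
    factor M^2 in [commutator_young]. *)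
Lemma int01_spi4 m : \int[lebesgue_measure]_(s in `[0%R, 1%R])
  (spi s ^+ 4 * (ck m s / ci m)) = 3 / ((2 * m%:R + 2) * (2 * m%:R + 4)).
Proof.
have mI : measurable (`[0%R, 1%R]%classic : set R) by exact: measurable_itv.
have h : 2 * m%:R + 2 != 0 :> R by rewrite gt_eqF// addr_gt0// ltr_pwDr// mulr_ge0.
have h4 : 2 * m%:R + 4 != 0 :> R by rewrite gt_eqF// addr_gt0// ltr_pwDr// mulr_ge0.
have c0 := lt0r_neq0 (ci_gt0 m).
transitivity (\int[lebesgue_measure]_(s in `[0%R, 1%R])
  ((ck m s * (ci m)^-1 - ck m.+1 s * (2 / ci m)) + ck m.+2 s * (ci m)^-1)).
  apply: eq_Rintegral => s _; rewrite !ckS.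
  have e : spi s ^+ 2 = 1 - cpi s ^+ 2 by rewrite -(cpi_spi s) addrAC subrr add0r.
  have -> : spi s ^+ 4 = (1 - cpi s ^+ 2) ^+ 2 by rewrite -e -exprM.
  by ring.
rewrite (RintD (mu := lebesgue_measure) mI (leb_itv_ltoo _ _)
  (bmB (bm_ckn m) (bmM (bm_ck m.+1) (bm_cst _))) (bmM (bm_ck m.+2) (bm_cst _))).
rewrite (RintB (mu := lebesgue_measure) mI (leb_itv_ltoo _ _) (bm_ckn m) (bmM (bm_ck m.+1) (bm_cst _))).
rewrite !(RintZr (mu := lebesgue_measure) mI (leb_itv_ltoo _ _) _ (bm_ck _)) -!/(ci _).
by rewrite !ciS -[m.+1%:R]natr1; field; rewrite h c0 h4.
Qed.

Lemma tint_kern_spi1 m n x : ~~ odd n ->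
  torus_int (fun y => spi (x.1 - y.1) ^+ n * kern m (x - y)) =
  \int[lebesgue_measure]_(s in `[0%R, 1%R]) (spi s ^+ n * (ck m s / ci m)).
Proof.
move=> on.
have sN s : (- spi s) ^+ n = spi s ^+ n.
  by rewrite exprNn -signr_odd (negbTE on) expr0 mul1r.
have bs : bm (fun s => spi s ^+ n * (ck m s / ci m)) by exact: (bmM (bmX n bm_spi) (bm_ckn m)).
have := tint_conv_prod x bs (bm_ckn m).
rewrite int01_ckn mulr1 => <-.
- by apply: eq_tint => y; rewrite /kern mulrA.
- by move=> s; rewrite spi_addr1 ck_addr1 sN.
- by move=> s; rewrite spiN ckN sN.
- by move=> s; rewrite ck_addr1.
- by move=> s; rewrite ckN.
Qed.

Lemma tint_kern_spi2 m n x : ~~ odd n ->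
  torus_int (fun y => spi (x.2 - y.2) ^+ n * kern m (x - y)) =
  \int[lebesgue_measure]_(s in `[0%R, 1%R]) (spi s ^+ n * (ck m s / ci m)).
Proof.
move=> on.
have sN s : (- spi s) ^+ n = spi s ^+ n.
  by rewrite exprNn -signr_odd (negbTE on) expr0 mul1r.
have bs : bm (fun s => spi s ^+ n * (ck m s / ci m)) by exact: (bmM (bmX n bm_spi) (bm_ckn m)).
have := tint_conv_prod x (bm_ckn m) bs.
rewrite int01_ckn mul1r => <-.
- by apply: eq_tint => y; rewrite /kern mulrCA.
- by move=> s; rewrite ck_addr1.
- by move=> s; rewrite ckN.
- by move=> s; rewrite spi_addr1 ck_addr1 sN.
- by move=> s; rewrite spiN ckN sN.
Qed.

Lemma measurable_sub2 : measurable_fun [set: (R * R) * (R * R)]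
  (fun p : (R * R) * (R * R) => (p.1 - p.2 : R * R)).
Proof.
have m1 : measurable_fun setT (fun p : (R * R) * (R * R) => p.1.1).
  exact: (measurableT_comp measurable_fst measurable_fst).
have m2 : measurable_fun setT (fun p : (R * R) * (R * R) => p.1.2).
  exact: (measurableT_comp measurable_snd measurable_fst).
have m3 : measurable_fun setT (fun p : (R * R) * (R * R) => p.2.1).
  exact: (measurableT_comp measurable_fst measurable_snd).
have m4 : measurable_fun setT (fun p : (R * R) * (R * R) => p.2.2).
  exact: (measurableT_comp measurable_snd measurable_snd).
by apply: measurable_fun_pair; exact: measurable_funB.
Qed.

Lemma bm_sub2 (G : R * R -> R) : bm G -> bm (fun p : (R * R) * (R * R) => G (p.1 - p.2)).
Proof. exact: (bm_comp measurable_sub2). Qed.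

Lemma C1_fst (a : R -> R) : C1 a -> C1 (fun x : R * R => a x.1).
Proof. by apply: (C1_comp_linear (L := fst)) => x; exact: cvg_fst. Qed.

Lemma C1_snd (a : R -> R) : C1 a -> C1 (fun x : R * R => a x.2).
Proof. by apply: (C1_comp_linear (L := snd)) => x; exact: cvg_snd. Qed.

Lemma C1_kern m : C1 (kern m).
Proof.
have c : C1 (fun s => ck m s / ci m) by exact: (C1M (C1_ck m) (C1_cst _)).
exact: (C1M (C1_fst c) (C1_snd c)).
Qed.

Lemma on_torus_kern m : on_torus (kern m).
Proof. by move=> x; rewrite /kern /= !ck_addr1. Qed.

Lemma bm_kern m : bm (kern m).
Proof. exact: bm_C1 (@on_torus_kern m) (C1_kern m). Qed.

Lemma d1_prod (a b : R -> R) (x : R * R) : C1 a -> C1 b ->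
  d1 (fun x => a x.1 * b x.2) x = 'D_1 a x.1 * b x.2.
Proof.
move=> ca cb; rewrite /d1 (deriveME _ _ (C1_fst ca) (C1_snd cb)).
rewrite (derive_comp_linear fst) (derive_comp_linear snd) /=.
by rewrite [X in _ * X + _](_ : _ = 0) ?mulr0 ?add0r// deriveE ?linear0//; exact: cb.1.
Qed.

Lemma d2_prod (a b : R -> R) (x : R * R) : C1 a -> C1 b ->
  d2 (fun x => a x.1 * b x.2) x = a x.1 * 'D_1 b x.2.
Proof.
move=> ca cb; rewrite /d2 (deriveME _ _ (C1_fst ca) (C1_snd cb)).
rewrite (derive_comp_linear fst) (derive_comp_linear snd) /=.
by rewrite [X in _ + X * _](_ : _ = 0) ?mul0r ?addr0// deriveE ?linear0//; exact: ca.1.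
Qed.

Lemma derive_ckn m s : 'D_1 (fun s => ck m s / ci m) s = 'D_1 (ck m) s / ci m.
Proof.
have -> : (fun s => ck m s / ci m) = (fun s => (ci m)^-1 * ck m s).
  by apply/funext => r; rewrite mulrC.
by rewrite (deriveZlE _ _ _ (C1_ck m)) mulrC.
Qed.

Lemma ck_le m s : ck m.+1 s <= ck m s.
Proof.
rewrite ckS; apply: ler_piMl; first exact: ck_ge0.
by have := cpi_spi s; have := sqr_ge0 (spi s); lra.
Qed.

Lemma ci_le2 m : (ci m.+1)^-1 <= 2 / ci m.
Proof.
have h := ci_gt0 m; have h1 : 0 < 2 * m%:R + 1 :> R by rewrite ltr_wpDl// mulr_ge0.
rewrite ciS invfM ler_pM2r ?invr_gt0// invf_div ler_pdivrMr//.
by have := @ler0n R m; lra.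
Qed.

(** Differentiation costs one factor cos^2, so the bound is by the kernel of order [m]. The constant
    is 2 from the exponent, 4 as a bound for pi, and 2 from the change of normalization in
    [ci_le2]. *)
Lemma norm_derive_ckn m s : `|'D_1 (fun s => ck m.+1 s / ci m.+1) s| <=
  16 * m.+1%:R * `|spi s| * (ck m s / ci m).
Proof.
rewrite derive_ckn derive_ck /= normrM normfV (ger0_norm (ltW (ci_gt0 _))).
have -> : `|- (2 * m.+1%:R * pi) * spi s * cpi s * ck m s| =
   2 * m.+1%:R * pi * `|spi s| * `|cpi s| * ck m s.
  by rewrite !normrM normrN !normrM (ger0_norm (ck_ge0 _ _)) (ger0_norm (pi_ge0 R)) !normr_nat.
have pi4 : pi <= 4 :> R by have := @pihalf_lt2 R; lra.
have c1 : `|cpi s| <= 1 by exact: cos_max.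
apply: (@le_trans _ _ (2 * m.+1%:R * 4 * `|spi s| * 1 * ck m s * (2 / ci m))); last first.
  by rewrite le_eqVlt; apply/orP; left; apply/eqP; ring.
apply: ler_pM; [|by rewrite invr_ge0 ltW// ci_gt0| |exact: ci_le2].
  by rewrite ?mulr_ge0 ?pi_ge0 ?ck_ge0.
apply: ler_wpM2r; first exact: ck_ge0.
apply: ler_pM => //; first by rewrite ?mulr_ge0 ?pi_ge0.
by apply: ler_wpM2r => //; apply: ler_wpM2l.
Qed.

Lemma ckn_le m s : ck m.+1 s / ci m.+1 <= 2 * (ck m s / ci m).
Proof.
apply: (@le_trans _ _ (ck m s * (2 / ci m))); last by rewrite mulrCA.
apply: ler_pM; [exact: ck_ge0|by rewrite invr_ge0 ltW// ci_gt0|exact: ck_le|exact: ci_le2].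
Qed.

(** The constant 32 is 16 from the differentiated factor times 2 for lowering the order of the other
    one. *)
Lemma norm_d1_kern m z : `|d1 (kern m.+1) z| <= 32 * m.+1%:R * `|spi z.1| * kern m z.
Proof.
have c : C1 (fun s => ck m.+1 s / ci m.+1) by exact: (C1M (C1_ck m.+1) (C1_cst _)).
rewrite (d1_prod z c c) normrM.
have k0 : 0 <= ck m.+1 z.2 / ci m.+1 by rewrite divr_ge0 ?ck_ge0// ltW// ci_gt0.
rewrite (ger0_norm k0).
apply: le_trans (ler_pM _ k0 (norm_derive_ckn m z.1) (ckn_le m z.2)) _ => //.
by rewrite /kern le_eqVlt; apply/orP; left; apply/eqP; ring.
Qed.

Lemma norm_d2_kern m z : `|d2 (kern m.+1) z| <= 32 * m.+1%:R * `|spi z.2| * kern m z.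
Proof.
have c : C1 (fun s => ck m.+1 s / ci m.+1) by exact: (C1M (C1_ck m.+1) (C1_cst _)).
rewrite (d2_prod z c c) normrM.
have k0 : 0 <= ck m.+1 z.1 / ci m.+1 by rewrite divr_ge0 ?ck_ge0// ltW// ci_gt0.
rewrite (ger0_norm k0).
apply: le_trans (ler_pM k0 _ (ckn_le m z.1) (norm_derive_ckn m z.2)) _ => //.
by rewrite /kern le_eqVlt; apply/orP; left; apply/eqP; ring.
Qed.

(* The addition formula for the cosine makes the kernel a finite sum of
   products of periodic C^1 functions of x and of y. *)
Lemma kern_separable m : exists (I : finType) (E E' : I -> R * R -> R),
  (forall i, [/\ on_torus (E i), C1 (E i), on_torus (E' i) & C1 (E' i)]) /\
  forall x y, kern m (x - y) = \sum_i E i x * E' i y.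
Proof.
(* These are the monomials of the binomial expansion of (cos cos + sin sin)^N. Each has even total
   degree [N] in one variable, hence period 1. *)
pose N := m.*2; pose tm (i : nat) s := cpi s ^+ (N - i) * spi s ^+ i.
have ctm i : C1 (tm i) by exact: (C1M (C1X _ C1_cpi) (C1X _ C1_spi)).
have ptm i s : (i <= N)%N -> tm i (s + 1) = tm i s.
  move=> iN; rewrite /tm cpi_addr1 spi_addr1 exprNn (exprNn (spi s)).
  rewrite mulrACA -exprD subnK// /N -muln2 mulnC exprM sqrrN expr1n.
  by rewrite expr1n mul1r.
pose I : finType := ('I_N.+1 * 'I_N.+1)%type.
pose b (i : nat) : R := ('C(N, i))%:R / ci m.
pose E' (p : I) (x : R * R) := tm p.1 x.1 * tm p.2 x.2.
pose E (p : I) (x : R * R) := (b p.1 * b p.2) * E' p x.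
exists I, E, E'; split=> [p|x y].
  have cE : C1 (E' p) by exact: (C1M (C1_fst (ctm _)) (C1_snd (ctm _))).
  have tE : on_torus (E' p) by move=> x; rewrite /E' /= !ptm// -ltnS.
  split; [|exact: C1Zl|exact: tE|exact: cE].
  by move=> x; rewrite /E !(tE x).1 !(tE x).2.
have ckE s t : ck m (s - t) / ci m = \sum_(i < N.+1) b i * tm i s * tm i t.
  rewrite /ck -exprM mul2n -/N cpiB exprDn mulr_suml; apply: eq_bigr => i _.
  by rewrite /b /tm -mulr_natl !exprMn; ring.
rewrite /kern /= !ckE big_distrlr /= pair_big /=.
by apply: eq_bigr => p _; rewrite /E /E'; ring.
Qed.

End TrigKernel.

(** * Mean oscillation of bounded functions *)

Section Mollification.
Context {R : realType}.
Implicit Types (f g h : R * R -> R) (H : (R * R) * (R * R) -> R) (m : nat).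

Lemma kernN m (z : R * R) : kern m (- z) = kern m z.
Proof. by rewrite /kern /= !ckN. Qed.

Lemma kern_subC m (x y : R * R) : kern m (x - y) = kern m (y - x).
Proof. by rewrite -kernN opprB. Qed.

(** Mean over pairs of nearby points: on the square of the torus the weight is a probability density
    with both marginals uniform, see [dint_fst] and [dint_snd]. *)
Definition dint m H : R :=
  torus_int (fun x => torus_int (fun y => H (x, y) * kern m (x - y))).

Lemma bm_Hkern m H : bm H -> bm (fun p : (R * R) * (R * R) => H p * kern m (p.1 - p.2)).
Proof. by move=> bH; apply: bmM => //; exact: bm_sub2 (bm_kern m). Qed.

Lemma bm_dint1 m H : bm H ->
  bm (fun x : R * R => torus_int (fun y => H (x, y) * kern m (x - y))).
Proof. by move=> bH; exact: (bm_tint (bm_Hkern m bH)). Qed.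

Lemma bm_dint2 m H (x : R * R) : bm H -> bm (fun y => H (x, y) * kern m (x - y)).
Proof. by move=> bH; exact: (bm_section1 x (bm_Hkern m bH)). Qed.

Lemma dintD m H H' : bm H -> bm H' ->
  dint m (fun p => H p + H' p) = dint m H + dint m H'.
Proof.
move=> bH bH'; rewrite /dint -(tintD (bm_dint1 m bH) (bm_dint1 m bH')).
apply: eq_tint => x; rewrite -(tintD (bm_dint2 m x bH) (bm_dint2 m x bH')).
by apply: eq_tint => y; rewrite mulrDl.
Qed.

Lemma dintZl m c H : bm H -> dint m (fun p => c * H p) = c * dint m H.
Proof.
move=> bH; rewrite /dint -(tintZl c (bm_dint1 m bH)).
apply: eq_tint => x; rewrite -(tintZl c (bm_dint2 m x bH)).
by apply: eq_tint => y; rewrite mulrA.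
Qed.

Lemma le_dint m H H' : bm H -> bm H' -> (forall p, H p <= H' p) ->
  dint m H <= dint m H'.
Proof.
move=> bH bH' HH'; apply: (le_tint (bm_dint1 m bH) (bm_dint1 m bH')) => x.
apply: (le_tint (bm_dint2 m x bH) (bm_dint2 m x bH')) => y.
by apply: ler_wpM2r => //; exact: kern_ge0.
Qed.

Lemma dint_ge0 m H : (forall p, 0 <= H p) -> 0 <= dint m H.
Proof.
by move=> H0; do 2 (apply: tint_ge0 => ?); rewrite mulr_ge0// kern_ge0.
Qed.

Lemma dint_fst m h : bm h -> dint m (fun p => h p.1) = torus_int h.
Proof.
move=> bh; apply: eq_tint => x /=.
have bk : bm (fun y : R * R => kern m (x - y)) by exact: (bm_section1 x (bm_sub2 (bm_kern m))).
by rewrite (tintZl _ bk) tint_kern mulr1.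
Qed.

Lemma dint_swap m H : bm H -> dint m H = dint m (fun p => H (p.2, p.1)).
Proof.
move=> bH; rewrite /dint (tint_swap (bm_Hkern m bH)).
by do 2 (apply: eq_tint => ?); rewrite kern_subC.
Qed.

Lemma bm_fst h : bm h -> bm (fun p : (R * R) * (R * R) => h p.1).
Proof. exact: (bm_comp measurable_fst). Qed.

Lemma bm_snd h : bm h -> bm (fun p : (R * R) * (R * R) => h p.2).
Proof. exact: (bm_comp measurable_snd). Qed.

Lemma dint_snd m h : bm h -> dint m (fun p => h p.2) = torus_int h.
Proof. by move=> bh; rewrite dint_swap ?dint_fst//; exact: bm_snd. Qed.

Lemma dint_cst m c : dint m (fun=> c) = c.
Proof. by rewrite (dint_fst m (bm_cst c)) tint_cst. Qed.

Lemma normr_dint_le m H H' : bm H -> bm H' -> (forall p, `|H p| <= H' p) ->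
  `|dint m H| <= dint m H'.
Proof.
move=> bH bH' HH'; apply: (normr_tint_le (bm_dint1 m bH) (bm_dint1 m bH')) => x.
apply: (normr_tint_le (bm_dint2 m x bH) (bm_dint2 m x bH')) => y.
by rewrite normrM (ger0_norm (kern_ge0 _ _)) ler_wpM2r// kern_ge0.
Qed.

Lemma cvg0_lin2 (a b : nat -> R) (c d : R) :
  a n @[n --> \oo] --> (0 : R) -> b n @[n --> \oo] --> (0 : R) ->
  c * a n + d * b n @[n --> \oo] --> (0 : R).
Proof.
move=> a0 b0; have h := cvgD (cvgM (cvg_cst c) a0) (cvgM (cvg_cst d) b0).
by rewrite !mulr0 addr0 in h; exact: h.
Qed.

Definition osc m g : R := dint m (fun p => (g p.1 - g p.2) ^+ 2).

Lemma bm_osc g : bm g -> bm (fun p : (R * R) * (R * R) => (g p.1 - g p.2) ^+ 2).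
Proof. by move=> bg; apply: bmX; apply: bmB; [exact: bm_fst|exact: bm_snd]. Qed.

Lemma osc_ge0 m g : 0 <= osc m g.
Proof. by apply: dint_ge0 => p; exact: sqr_ge0. Qed.

(** [osc0_bm] will show that every [bm] function qualifies. The closure properties that follow turn
    the sets with such an indicator into a sigma-algebra, which takes the place of approximation by
    continuous functions. *)
Definition osc0 g := bm g /\ osc m g @[m --> \oo] --> (0 : R).

Lemma osc0_le g (e : nat -> R) : bm g -> (forall m, osc m g <= e m) ->
  e m @[m --> \oo] --> (0 : R) -> osc0 g.
Proof.
move=> bg ge e0; split; first exact: bg.
apply/cvgrPdist_le => d d0; move/cvgrPdist_le : e0 => /(_ _ d0).
apply: filterS => m; rewrite !sub0r !normrN (ger0_norm (osc_ge0 m g)) => h.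
exact: (le_trans (ge m) (le_trans (ler_norm _) h)).
Qed.

(** Insert h at both points and bound the square of a sum of three terms. Each marginal contributes
    the same squared distance, so 3 becomes 6. *)
Lemma osc_close m g h : bm g -> bm h ->
  osc m g <= 6 * torus_int (fun x => (g x - h x) ^+ 2) + 3 * osc m h.
Proof.
move=> bg bh; have bgh : bm (fun x => (g x - h x) ^+ 2) by exact: (bmX 2 (bmB bg bh)).
have b1 := bm_fst bgh; have b2 := bm_snd bgh; have bo := bm_osc bh.
have -> : 6 * torus_int (fun x => (g x - h x) ^+ 2) + 3 * osc m h =
  dint m (fun p => 3 * (((g p.1 - h p.1) ^+ 2 + (g p.2 - h p.2) ^+ 2) + (h p.1 - h p.2) ^+ 2)).
  rewrite (dintZl m 3 (bmD (bmD b1 b2) bo)) (dintD m (bmD b1 b2) bo) (dintD m b1 b2).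
  by rewrite (dint_fst m bgh) (dint_snd m bgh) /osc; ring.
apply: le_dint; [exact: bm_osc|exact: (bmM (bm_cst 3) (bmD (bmD b1 b2) bo))|].
move=> [x y] /=; set a := g x; set b := g y; set c := h x; set d := h y.
rewrite -subr_ge0.
have -> : 3 * ((a - c) ^+ 2 + (b - d) ^+ 2 + (c - d) ^+ 2) - (a - b) ^+ 2 =
  ((a - c) - (c - d)) ^+ 2 + ((a - c) + (b - d)) ^+ 2 + ((c - d) + (b - d)) ^+ 2 by ring.
by rewrite !addr_ge0// sqr_ge0.
Qed.

Lemma osc0_close g : bm g ->
  (forall e : R, 0 < e -> exists2 h, osc0 h & torus_int (fun x => (g x - h x) ^+ 2) <= e) ->
  osc0 g.
Proof.
move=> bg gh; split => //; apply/cvgrPdist_le => e e0.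
(* The tolerances e/12 and e/6 meet the factors 6 and 3 of [osc_close] and give e/2 each. *)
have [h [bh oh] ghe] := gh (e / 12) (divr_gt0 e0 (ltr0n _ 12)).
have e6 : 0 < e / 6 by rewrite divr_gt0.
move/cvgrPdist_le : oh => /(_ _ e6) oh.
near=> m; rewrite sub0r normrN ger0_norm ?osc_ge0//.
apply: le_trans (osc_close m bg bh) _.
have : `|0 - osc m h| <= e / 6 by near: m.
rewrite sub0r normrN ger0_norm ?osc_ge0//; lra.
Unshelve. all: by end_near. Qed.

Lemma osc0_cvg (g_ : nat -> R * R -> R) g (M : R) : bm g ->
  (forall n, osc0 (g_ n)) -> (forall n x, `|g_ n x| <= M) ->
  (forall x, g_ n x @[n --> \oo] --> g x) -> osc0 g.
Proof.
move=> bg og gM gc; apply: osc0_close => // e e0.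
have [_ [N gN]] := bg.
have : torus_int (fun x => (g x - g_ n x) ^+ 2) @[n --> \oo] --> torus_int (fun _ : R * R => 0 : R).
  apply: (tint_cvg (M := (N + M) ^+ 2)).
  - by move=> n; apply: bmX; apply: bmB => //; have [] := og n.
  - exact: bm_cst.
  - move=> n x; rewrite normrX lerXn2r ?nnegrE//.
      by apply: addr_ge0; [exact: le_trans (gN x)|exact: le_trans (gM n x)].
    by rewrite (le_trans (ler_normB _ _))// lerD.
  - move=> x; have -> : (0 : R) = (g x - g x) ^+ 2 by rewrite subrr expr0n.
    under eq_fun do rewrite expr2; rewrite expr2.
    by apply: cvgM; apply: cvgB; [exact: cvg_cst|exact: gc|exact: cvg_cst|exact: gc].
rewrite tint_cst => /cvgrPdist_le /(_ _ e0) [k _ /(_ k (leqnn k))].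
rewrite sub0r normrN => h; exists (g_ k) => //.
by rewrite (le_trans (ler_norm _)).
Qed.

Lemma osc0_cst (c : R) : osc0 (fun=> c).
Proof.
apply: (osc0_le (e := fun=> 0)); [exact: bm_cst| |exact: cvg_cst].
by move=> m; rewrite /osc; under [X in dint m X]eq_fun do rewrite subrr expr0n /=; rewrite dint_cst.
Qed.

Lemma osc0D f g : osc0 f -> osc0 g -> osc0 (fun x => f x + g x).
Proof.
move=> [bf cf] [bg cg].
apply: (osc0_le (e := fun m => 2 * osc m f + 2 * osc m g)); first exact: (bmD bf bg).
  have b2f := bmM (bm_cst 2) (bm_osc bf); have b2g := bmM (bm_cst 2) (bm_osc bg).
  move=> m; have := dintD m b2f b2g.
  rewrite (dintZl m 2 (bm_osc bf)) (dintZl m 2 (bm_osc bg)) => <-; apply: (le_dint m (bm_osc (bmD bf bg)) (bmD b2f b2g)).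
  move=> [x y] /=; rewrite -subr_ge0.
  have -> : 2 * (f x - f y) ^+ 2 + 2 * (g x - g y) ^+ 2 - (f x + g x - (f y + g y)) ^+ 2 =
    ((f x - f y) - (g x - g y)) ^+ 2 by ring.
  exact: sqr_ge0.
exact: (cvg0_lin2 2 2 cf cg).
Qed.

Lemma osc0Zl (c : R) f : osc0 f -> osc0 (fun x => c * f x).
Proof.
move=> [bf cf]; apply: (osc0_le (e := fun m => c ^+ 2 * osc m f)).
- exact: (bmM (bm_cst c) bf).
- move=> m; rewrite -(dintZl m _ (bm_osc bf)).
  apply: (le_dint m (bm_osc (bmM (bm_cst c) bf)) (bmM (bm_cst _) (bm_osc bf))).
  by move=> [x y] /=; rewrite -mulrBr exprMn.
- by rewrite -(mulr0 (c ^+ 2)); apply: cvgM => //; exact: cvg_cst.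
Qed.

Lemma osc0M f g : osc0 f -> osc0 g -> osc0 (fun x => f x * g x).
Proof.
move=> [bf cf] [bg cg]; have [_ [M fM]] := bf; have [_ [N gN]] := bg.
apply: (osc0_le (e := fun m => 2 * N ^+ 2 * osc m f + 2 * M ^+ 2 * osc m g)); first exact: (bmM bf bg).
  move=> m; rewrite -(dintZl m _ (bm_osc bf)) -(dintZl m _ (bm_osc bg)).
  have b2f := bmM (bm_cst (2 * N ^+ 2)) (bm_osc bf).
  have b2g := bmM (bm_cst (2 * M ^+ 2)) (bm_osc bg).
  rewrite -(dintD m b2f b2g); apply: (le_dint m (bm_osc (bmM bf bg)) (bmD b2f b2g)).
  move=> [x y] /=.
  have fM2 : f y ^+ 2 <= M ^+ 2.
    by rewrite -(real_normK (num_real (f y))) lerXn2r ?nnegrE ?normr_ge0// (le_trans _ (fM y)).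
  have gN2 : g x ^+ 2 <= N ^+ 2.
    by rewrite -(real_normK (num_real (g x))) lerXn2r ?nnegrE ?normr_ge0// (le_trans _ (gN x)).
  have h1 := ler_wpM2r (sqr_ge0 (f x - f y)) gN2.
  have h2 := ler_wpM2r (sqr_ge0 (g x - g y)) fM2.
  have h3 := sqr_ge0 (g x * (f x - f y) - f y * (g x - g y)).
  have -> : f x * g x - f y * g y = g x * (f x - f y) + f y * (g x - g y) by ring.
  nra.
exact: (cvg0_lin2 _ _ cf cg).
Qed.

Lemma osc0_lip (phi : R -> R) h : osc0 h -> bm (fun x => phi (h x)) ->
  (forall r s, `|phi r - phi s| <= `|r - s|) -> osc0 (fun x => phi (h x)).
Proof.
move=> [bh ch] bph lip; apply: (osc0_le bph _ ch) => m.
apply: (le_dint m (bm_osc bph) (bm_osc bh)).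
move=> [x y] /=; rewrite -(real_normK (num_real (_ - _))).
by rewrite -[leRHS](real_normK (num_real (_ - _))) lerXn2r ?nnegrE ?normr_ge0.
Qed.

Lemma osc0_prod (n : nat) (F : nat -> R * R -> R) :
  (forall k, osc0 (F k)) -> osc0 (fun x => \prod_(k < n) F k x).
Proof.
move=> oF; elim: n => [|n ih].
  by under eq_fun do rewrite big_ord0; exact: osc0_cst.
by under eq_fun do rewrite big_ord_recr /=; exact: (osc0M ih (oF n)).
Qed.

Lemma osc0_sum (n : nat) (F : nat -> R * R -> R) :
  (forall k, osc0 (F k)) -> osc0 (fun x => \sum_(k < n) F k x).
Proof.
move=> oF; elim: n => [|n ih].
  by under eq_fun do rewrite big_ord0; exact: osc0_cst.
by under eq_fun do rewrite big_ord_recr /=; exact: (osc0D ih (oF n)).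
Qed.

Lemma clip01_lip (r s : R) :
  `|Num.min 1 (Num.max 0 r) - Num.min 1 (Num.max 0 s)| <= `|r - s|.
Proof.
rewrite /Num.min /Num.max.
have d1 : r - s <= `|r - s| by exact: ler_norm.
have d2 : s - r <= `|r - s| by rewrite distrC ler_norm.
by case: (ltP 0 r) => h1; case: (ltP 0 s) => h2; rewrite ?ltr10;
  case: (ltP 1 r) => h3; case: (ltP 1 s) => h4;
  rewrite ler_norml; apply/andP; split; lra.
Qed.

(* In the next lemmas [pr] is one of the two coordinates of the torus. *)
Lemma osc0_ray (pr : R * R -> R) (a : R) : measurable_fun setT pr ->
  (forall w : R -> R, bm w -> torus_int (fun x => w (pr x)) =
     \int[lebesgue_measure]_(s in `[0%R, 1%R]) w s) ->
  (forall m, dint m (fun p => spi (pr p.1 - pr p.2) ^+ 2) = (2 * m%:R + 2)^-1) ->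
  osc0 (fun x => \1_(`]-oo, a[%classic : set R) (pr x)).
Proof.
move=> mpr tpr dpr.
have bcomp (w : R -> R) : bm w -> bm (fun x => w (pr x)) by exact: bm_comp.
have bind (A : set R) : measurable A -> bm (\1_A : R -> R).
  move=> mA; split; first exact: measurable_indic.
  by exists 1 => s; rewrite indicE; case: (_ \in _); rewrite ?normr1 ?normr0.
have bray : bm (\1_(`]-oo, a[%classic : set R) : R -> R) by apply: bind; exact: measurable_itv.
(* The indicator need only be matched on ]0, 1], a full period up to a null set. This disposes of
   [a] outside ]0, 1] and lets a periodic [w] replace the ray. *)
have close (w : R -> R) : osc0 (fun x => w (pr x)) -> bm w ->
    (forall s, 0 < s <= 1 -> w s = (s < a)%R%:R) ->
    osc0 (fun x => \1_(`]-oo, a[%classic : set R) (pr x)).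
  move=> ow bw ew; apply: osc0_close; first exact: (bcomp _ bray).
  move=> e e0; exists (fun x => w (pr x)) => //.
  have b2 : bm (fun s : R => (\1_(`]-oo, a[%classic : set R) s - w s) ^+ 2).
    exact: (bmX 2 (bmB bray bw)).
  have l1 : (@lebesgue_measure R `]0%R, 1%R]%classic < +oo)%E.
    by rewrite lebesgue_measure_itv/= lte_fin ltr01 -EFinB ltry.
  rewrite (tpr _ b2) -Rintegral_itv_obnd_cbnd; last first.
    apply: (bm_integrable (mu := lebesgue_measure) _ _ b2); first exact: measurable_itv.
    exact: l1.
  rewrite (_ : \int[lebesgue_measure]_(s in _) _ = 0) ?ltW//.
  transitivity (\int[@lebesgue_measure R]_(s in `]0%R, 1%R]) (0 : R)).
    apply: eq_Rintegral => s; rewrite inE/= in_itv/= => /ew ->.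
    rewrite indicE; have -> : (s \in (`]-oo, a[%classic : set R)) = (s < a).
      by apply/idP/idP; rewrite inE/= in_itv.
    by rewrite subrr expr0n.
  by rewrite Rintegral_cst// mul0r.
have [a0|a0] := leP a 0.
  apply: (close (fun=> 0)); [exact: osc0_cst|exact: bm_cst|].
  by move=> s /andP[s0 _]; rewrite ltNge (le_trans a0 (ltW s0)).
have [a1|a1] := ltP 1 a.
  apply: (close (fun=> 1)); [exact: osc0_cst|exact: bm_cst|].
  by move=> s /andP[_ s1]; rewrite (le_lt_trans s1 a1).
(* On ]0, 1] this trigonometric function is positive exactly when s < a, so its sign encodes the
   ray. *)
pose h (s : R) := spi s * spi (a - s).
have bh : bm h.
  apply: (bmM bm_spi); apply: (bm_comp (h := fun s : R => a - s)) bm_spi.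
  exact: measurable_funB.
(* The increment factors through sin(pi (s - t)), so the oscillation of [h] is at most the second
   moment of the kernel. *)
have hB s t : h s - h t = spi (s - t) * spi (a - s - t).
  rewrite /h !spiB !cpiB.
  have e1 : cpi s ^+ 2 = 1 - spi s ^+ 2 by rewrite -(cpi_spi s) addrK.
  have e2 : cpi t ^+ 2 = 1 - spi t ^+ 2 by rewrite -(cpi_spi t) addrK.
  ring: e1 e2.
have oh : osc0 (fun x => h (pr x)).
  apply: (@osc0_le _ (fun m => (2 * m%:R + 2)^-1)); first exact: bcomp.
    move=> m; rewrite -dpr; apply: (le_dint m (bm_osc (bcomp _ bh))).
      apply: bmX; apply: (bm_comp (h := fun p : (R * R) * (R * R) => pr p.1 - pr p.2)) bm_spi.
      apply: measurable_funB; first exact: (measurableT_comp mpr measurable_fst).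
      exact: (measurableT_comp mpr measurable_snd).
    move=> [x y] /=; rewrite hB exprMn ler_piMr ?sqr_ge0//.
    by have := cpi_spi (a - pr x - pr y); have := sqr_ge0 (cpi (a - pr x - pr y)); lra.
  have h2 : (fun m : nat => (2 * m%:R + 2)^-1 : R) = (fun m => 2^-1 * harmonic m).
    by apply/funext => m; rewrite /harmonic /= -invfM -[m.+1%:R]natr1 mulrDr mulr1.
  rewrite h2 -(mulr0 2^-1); apply: cvgM; [exact: cvg_cst|exact: cvg_harmonic].
pose phi (n : nat) (r : R) := Num.min 1 (Num.max 0 (n%:R * r)).
(* Clipping n h to [0, 1] is a Lipschitz operation, and the clipped functions converge pointwise to
   the indicator of h > 0. *)
have ob n : osc0 (fun x => Num.min 1 (Num.max 0 (n%:R * h (pr x)))).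
  apply: (osc0_lip (phi := fun r => Num.min 1 (Num.max 0 r)) (osc0Zl n%:R oh)).
    split; last first.
      exists 1 => x; rewrite ger0_norm ?ge_min ?lexx// le_min ler01/= le_max lexx.
      by [].
    apply: measurable_minr => //; apply: measurable_maxr => //.
    by have [] := bmM (bm_cst n%:R) (bcomp _ bh).
  exact: clip01_lip.
have bpos : bm (fun s : R => (0 < h s)%R%:R : R).
  have -> : (fun s : R => (0 < h s)%R%:R : R) = \1_[set s | 0 < h s].
    apply/funext => s; rewrite indicE; congr ((nat_of_bool _)%:R).
    by apply/idP/idP; rewrite inE.
  apply: bind; have mh : measurable_fun setT h by have [] := bh.
  have mb : measurable_fun setT (fun s => 0 < h s) by exact: measurable_fun_ltr.
  by rewrite -[X in measurable X]setTI; apply: mb.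
apply: (close (fun s => (0 < h s)%R%:R)).
- apply: (@osc0_cvg _ _ 1 _ ob).
  + exact: (bcomp _ bpos).
  + move=> n x; rewrite ger0_norm ?ge_min ?lexx// le_min ler01/= le_max lexx.
    by [].
  + move=> x; have [hx|hx] := ltP 0 (h (pr x)).
      apply: cvg_near_cst; exists (Num.truncn (h (pr x))^-1).+1 => // n /= nh.
      have : 1 <= n%:R * h (pr x).
        rewrite -ler_pdivrMr// div1r (le_trans (ltW (truncnS_gt _)))//.
        by rewrite ler_nat.
      by move=> h1; rewrite max_r ?min_l// (le_trans ler01 h1).
    apply: cvg_near_cst; apply: nearW => n.
    by rewrite max_l ?min_r// mulr_ge0_le0.
- exact: bpos.
- move=> s /andP[s0 s1]; congr ((nat_of_bool _)%:R); rewrite /h.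
  have ps (r : R) : 0 < r < 1 -> 0 < spi r.
    move=> /andP[r0 r1]; apply: sin_gt0_pi; rewrite mulr_gt0 ?pi_gt0//=.
    by rewrite gtr_pMr ?pi_gt0.
  have ps0 (r : R) : 0 <= r <= 1 -> 0 <= spi r.
    move=> /andP[r0 r1]; apply: sin_ge0_pi; rewrite mulr_ge0 ?pi_ge0//=.
    by rewrite ger_pMr ?pi_gt0.
  have [sa|sa] := ltP s a.
    by rewrite mulr_gt0// ps// ?s0 ?(lt_le_trans sa)// subr_gt0 sa/=; lra.
  apply/negbTE; rewrite -leNgt -opprB spiN mulrN oppr_le0 mulr_ge0//.
    by rewrite ps0// ltW.
  by rewrite ps0// subr_ge0 sa/=; lra.
Qed.

(** The map [phi] allows the same lemma to serve sets of reals pulled back along a coordinate and,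
    with the identity, sets of the plane. *)
Lemma osc0_sigma_algebra (T : Type) (phi : R * R -> T) :
  sigma_algebra setT [set A : set T | osc0 (fun x => \1_A (phi x))].
Proof.
split => /=.
- by under eq_fun do rewrite indic0; exact: osc0_cst.
- move=> A oA.
  have -> : (fun x => \1_(setT `\` A) (phi x)) = (fun x => 1 + -1 * \1_A (phi x) : R).
    by apply/funext => x; rewrite setTD !indicE in_setC; case: (_ \in _); rewrite ?mulr1 ?mulr0 ?subrr ?addr0.
  exact: (osc0D (osc0_cst 1) (osc0Zl (-1) oA)).
- move=> A oA.
  have oc k : osc0 (fun x => 1 + -1 * \1_(A k) (phi x)).
    exact: (osc0D (osc0_cst 1) (osc0Zl (-1) (oA k))).
  (* Indicator of the union of the first n sets, through the product of the indicators of the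
     complements. At each point it is eventually constant in n. *)
  pose g n x : R := 1 + -1 * \prod_(k < n) (1 + -1 * \1_(A k) (phi x)).
  have og n : osc0 (g n) by exact: (osc0D (osc0_cst 1) (osc0Zl (-1) (osc0_prod n oc))).
  have p01 n x : 0 <= \prod_(k < n) (1 + -1 * \1_(A k) (phi x) : R) <= 1.
    elim: n => [|n ih]; first by rewrite big_ord0 ler01 lexx.
    rewrite big_ord_recr/= indicE; move: ih => /andP[i0 i1].
    by case: (_ \in _) => /=; rewrite ?mulr1n ?mulr0n; apply/andP; split; lra.
  have gc x : g n x @[n --> \oo] --> (\1_(\bigcup_k A k) (phi x) : R).
    apply: cvg_near_cst; have [[k _ Akx]|nA] := pselect ((\bigcup_k A k) (phi x)).
      exists k.+1 => // n /= kn.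
      rewrite /g indicE mem_set; last by exists k.
      rewrite (bigD1 (Ordinal kn))//= indicE mem_set//.
      by rewrite mulr1 subrr mul0r mulr0 addr0.
    apply: nearW => n; rewrite /g indicE memNset//.
    rewrite big1 ?mulr1 ?subrr// => i _; rewrite indicE memNset ?mulr0 ?addr0//.
    by move=> Ai; apply: nA; exists i.
  apply: (@osc0_cvg g _ 1) => //.
    split.
      apply: (measurable_fun_cvg (h := g)) => //.
      by move=> n; have [[]] := og n.
    by exists 1 => x; rewrite indicE; case: (_ \in _); rewrite ?normr1 ?normr0.
  move=> n x; have /andP[i0 i1] := p01 n x.
  by rewrite /g mulN1r ger0_norm; lra.
Qed.

Lemma osc0_measurable_coord (pr : R * R -> R) (A : set R) : measurable_fun setT pr ->
  (forall w : R -> R, bm w -> torus_int (fun x => w (pr x)) =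
     \int[lebesgue_measure]_(s in `[0%R, 1%R]) w s) ->
  (forall m, dint m (fun p => spi (pr p.1 - pr p.2) ^+ 2) = (2 * m%:R + 2)^-1) ->
  measurable A -> osc0 (fun x => \1_A (pr x)).
Proof.
move=> mpr tpr dpr mA.
have : (@RGenInftyO.G R).-sigma.-measurable A by rewrite -RGenInftyO.measurableE.
suff sub : <<s @RGenInftyO.G R >> `<=` [set B : set R | osc0 (fun x => \1_B (pr x))] by exact: sub.
apply: smallest_sub; first exact: osc0_sigma_algebra.
by move=> _ [a ->]; exact: osc0_ray.
Qed.

Lemma dint_spi_fst m : dint m (fun p => spi (p.1.1 - p.2.1) ^+ 2) = (2 * m%:R + 2)^-1.
Proof.
rewrite -[RHS]tint_cst -int01_spi2; apply: eq_tint => x /=.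
exact: tint_kern_spi1.
Qed.

Lemma dint_spi_snd m : dint m (fun p => spi (p.1.2 - p.2.2) ^+ 2) = (2 * m%:R + 2)^-1.
Proof.
rewrite -[RHS]tint_cst -int01_spi2; apply: eq_tint => x /=.
exact: tint_kern_spi2.
Qed.

Lemma dint_spi4_fst m : dint m (fun p => spi (p.1.1 - p.2.1) ^+ 4) =
  3 / ((2 * m%:R + 2) * (2 * m%:R + 4)).
Proof.
rewrite -[RHS]tint_cst -int01_spi4; apply: eq_tint => x /=.
exact: tint_kern_spi1.
Qed.

Lemma dint_spi4_snd m : dint m (fun p => spi (p.1.2 - p.2.2) ^+ 4) =
  3 / ((2 * m%:R + 2) * (2 * m%:R + 4)).
Proof.
rewrite -[RHS]tint_cst -int01_spi4; apply: eq_tint => x /=.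
exact: tint_kern_spi2.
Qed.

Lemma tint_fst (w : R -> R) : bm w -> torus_int (fun x => w x.1) =
  \int[lebesgue_measure]_(s in `[0%R, 1%R]) w s.
Proof.
move=> bw; rewrite torus_intE; last exact: (bm_comp measurable_fst bw).
by apply: eq_Rintegral => a _ /=; rewrite Rint01_cst.
Qed.

Lemma tint_snd (w : R -> R) : bm w -> torus_int (fun x => w x.2) =
  \int[lebesgue_measure]_(s in `[0%R, 1%R]) w s.
Proof.
move=> bw; rewrite torus_intE; last exact: (bm_comp measurable_snd bw).
by rewrite /= Rint01_cst.
Qed.

Lemma osc0_measurable (A : set (R * R)) : measurable A -> osc0 (fun x => \1_A x).
Proof.
have sub : @measurable _ (R * R)%type `<=` [set A : set (R * R) | osc0 (fun x => \1_A x)].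
  apply: smallest_sub; first exact: (@osc0_sigma_algebra _ id).
  move=> _ [|] [B mB <-]; rewrite setTI /=.
    exact: (osc0_measurable_coord measurable_fst tint_fst dint_spi_fst mB).
  exact: (osc0_measurable_coord measurable_snd tint_snd dint_spi_snd mB).
exact: sub.
Qed.

(* Layer-cake approximation of [g] by sums of indicators of superlevel sets. *)
Lemma osc0_bm g : bm g -> osc0 g.
Proof.
move=> bg; have [mg [M0 gM0]] := bg.
pose M : R := `|M0| + 1.
have M_gt0 : 0 < M by rewrite ltr_wpDl.
have gM x : `|g x| <= M by rewrite (le_trans (gM0 x))// (le_trans (ler_norm _))// lerDl.
apply: osc0_close => // e e0.
(* Large enough for the squared level spacing d^2 = 4 M^2 / N^2 to be at most e; the added 1 is used
   to pass from N to N^2. *)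
pose N := (Num.truncn (4 * M ^+ 2 / e + 1)).+1.
have N0 : 0 < N%:R :> R by rewrite ltr0n.
pose d : R := 2 * M / N%:R.
have d0 : 0 < d by rewrite divr_gt0// mulr_gt0.
pose A (k : nat) : set (R * R) := [set x | - M + k%:R * d < g x].
have mA k : measurable (A k).
  rewrite -[A k]setTI; apply: (measurable_fun_ltr (measurable_cst _) mg) => //.
pose h x : R := - M + d * \sum_(k < N) \1_(A k) x.
exists h.
  exact: (osc0D (osc0_cst (- M)) (osc0Zl d (osc0_sum N (fun k => osc0_measurable (mA k))))).
(* The number of integers k >= 0 below u is u rounded up, so in units of [d] the staircase [h]
   overshoots [g] by at most one step. *)
have step (u : R) (n : nat) : 0 <= u <= n%:R ->
    u <= \sum_(k < n) ((k%:R < u)%R%:R) <= u + 1.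
  elim: n => [|n ih] /andP[u0 un].
    by rewrite big_ord0; apply/andP; split; lra.
  rewrite big_ord_recr/=; have [nu|nu] := ltP n%:R u.
    rewrite (eq_bigr (fun=> 1)); last first.
      by move=> i _; rewrite (lt_trans _ nu)// ltr_nat.
    by rewrite sumr_const card_ord natr1 un/= -natr1 lerD2r ltW.
  by rewrite addr0 ih// u0.
have gh x : `|g x - h x| <= d.
  pose u := (g x + M) / d.
  have guE : g x = - M + d * u by rewrite /u mulrCA divff ?gt_eqF// mulr1 addrC addrK.
  have : 0 <= u <= N%:R.
    have := gM x; rewrite ler_norml => /andP[g1 g2]; apply/andP; split.
      by apply: divr_ge0; [lra|exact: ltW].
    by rewrite ler_pdivrMr// /d mulrCA divff ?gt_eqF// mulr1; lra.
  move=> /step /andP[u1 u2].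
  have -> : h x = - M + d * \sum_(k < N) ((k%:R < u)%R%:R).
    rewrite /h; congr (_ + _ * _); apply: eq_bigr => k _; rewrite indicE; congr ((nat_of_bool _)%:R).
    by apply/idP/idP; rewrite inE /A /= guE ltrD2l mulrC ltr_pM2l.
  rewrite guE ler_norml; apply/andP; split; nra.
have bh : bm h.
  by have [] := osc0D (osc0_cst (- M)) (osc0Zl d (osc0_sum N (fun k => osc0_measurable (mA k)))).
have b2 : bm (fun x => (g x - h x) ^+ 2) by exact: (bmX 2 (bmB bg bh)).
rewrite -[leRHS]tint_cst; apply: (le_tint b2 (bm_cst e)) => x.
have : `|g x - h x| ^+ 2 <= d ^+ 2.
  by apply: lerXn2r; [rewrite nnegrE|rewrite nnegrE ltW|exact: gh].
rewrite real_normK ?num_real// => /le_trans; apply.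
rewrite /d exprMn exprVn ler_pdivrMr ?exprn_gt0// exprMn.
have h1 : 4 * M ^+ 2 / e + 1 <= N%:R by exact: ltW (truncnS_gt _).
have h2 : 1 <= N%:R :> R by rewrite ler1n.
have h3 : 4 * M ^+ 2 <= e * N%:R.
  by rewrite [leRHS]mulrC -ler_pdivrMr//; lra.
have : e * N%:R <= e * N%:R ^+ 2 by rewrite ler_pM2l// expr2 ler_peMl// ltW.
lra.
Qed.

End Mollification.

(** * The commutator estimate *)

Section Commutator.
Context {R : realType}.
Implicit Types (f g w psi : R * R -> R) (m : nat).

Lemma le_tint_sq f g : bm f -> bm g -> (forall x, unit_square x -> f x <= g x) ->
  torus_int f <= torus_int g.
Proof.
by move=> bf bg fg; exact: (le_Rint (mu := leb2 R) measurable_unit_square leb2_unit_square_ltoo).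
Qed.

Lemma eq_tint_sq f g : (forall x, unit_square x -> f x = g x) -> torus_int f = torus_int g.
Proof. by move=> fg; apply: eq_Rintegral => x; rewrite inE => /fg. Qed.

Lemma measurable_add2 : measurable_fun [set: (R * R) * (R * R)]
  (fun p : (R * R) * (R * R) => (p.1 + p.2 : R * R)).
Proof.
have m1 : measurable_fun setT (fun p : (R * R) * (R * R) => p.1.1).
  exact: (measurableT_comp measurable_fst measurable_fst).
have m2 : measurable_fun setT (fun p : (R * R) * (R * R) => p.1.2).
  exact: (measurableT_comp measurable_snd measurable_fst).
have m3 : measurable_fun setT (fun p : (R * R) * (R * R) => p.2.1).
  exact: (measurableT_comp measurable_fst measurable_snd).
have m4 : measurable_fun setT (fun p : (R * R) * (R * R) => p.2.2).
  exact: (measurableT_comp measurable_snd measurable_snd).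
by apply: measurable_fun_pair; exact: measurable_funD.
Qed.

(** On [0, 1/4] the derivative pi cos(pi c) is at least 2 * 1/2, and the mean value theorem applies.
    On [1/4, 1/2] the sine is increasing and already at least 1/2 at 1/4, where sine and cosine
    coincide. *)
Lemma spi_ge_id (s : R) : 0 <= s <= 2^-1 -> s <= spi s.
Proof.
move=> /andP[s0 s2].
have pi2 : 2 <= pi :> R by exact: pi_ge2.
have s14 : 2^-1 <= spi 4^-1 :> R.
  have e1 : cpi 4^-1 = spi (4^-1 : R).
    rewrite /cpi /spi -[in RHS]cosBpihalf -[RHS]cosN; congr cos.
    by field.
  have := cpi_spi (4^-1 : R); rewrite e1 => h.
  have h0 : 0 <= spi (4^-1 : R).
    by apply: sin_ge0_pi; rewrite mulr_ge0 ?pi_ge0//= ler_piMr ?pi_ge0// invf_le1// ler1n.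
  by rewrite leNgt; apply/negP => h1; nra.
have [s4|s4] := leP s 4^-1.
  have [->|sn0] := eqVneq s 0; first by rewrite /spi mulr0 sin0.
  have sgt0 : 0 < s by rewrite lt0r sn0.
  have [c] := MVT sgt0 (fun x _ => is_derive_spi x)
    (continuous_subspaceT (@continuous_spi R)).
  rewrite in_itv/= => /andP[c0 cs].
  have -> : spi 0 = 0 :> R by rewrite /spi mulr0 sin0.
  rewrite !subr0 => ->.
  suff : 1 <= pi * cpi c by move=> h; rewrite ler_peMl.
  have c1 : 2^-1 <= cpi c.
    apply: (@le_trans _ _ (cpi 4^-1)).
      have e1 : cpi 4^-1 = spi (4^-1 : R).
        rewrite /cpi /spi -[in RHS]cosBpihalf -[RHS]cosN; congr cos.
        by field.
      by rewrite e1.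
    have c4 : c <= 4^-1 by rewrite (le_trans (ltW cs)).
    have [cc|cc] := eqVneq c 4^-1; first by rewrite cc.
    rewrite ltW// /cpi ltr_cos ?ltr_pM2l ?pi_gt0 ?lt_neqAle ?cc//.
      by rewrite in_itv/= mulr_ge0 ?pi_ge0//= ?(ltW c0)// ler_piMr ?pi_ge0//; lra.
    by rewrite in_itv/= mulr_ge0 ?pi_ge0//= ler_piMr ?pi_ge0//; lra.
  nra.
apply: (le_trans s2); apply: (le_trans s14).
rewrite /spi.
have pi0 := @pi_gt0 R.
have [ss|ss] := eqVneq s 4^-1; first by rewrite ss.
rewrite ltW// ltr_sin ?ltr_pM2l//.
- by rewrite in_itv/=; apply/andP; split; nra.
- by rewrite in_itv/=; apply/andP; split; nra.
Qed.

(** The distance to the nearest integer is dominated by |sin(pi s)|. This converts the |z|^2 of the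
    translation estimate into a quantity whose kernel average is known. *)
Lemma period_dist_spi (s : R) : 0 <= s <= 1 ->
  exists2 k : int, `|s + k%:~R| <= 1 & (s + k%:~R) ^+ 2 <= spi s ^+ 2.
Proof.
move=> /andP[s0 s1]; have [s2|s2] := leP s 2^-1.
  exists 0; rewrite addr0; first by rewrite ger0_norm.
  by rewrite lerXn2r ?nnegrE//; have := @spi_ge_id s; rewrite s0 s2 => /(_ isT); lra.
exists (-1); first by rewrite mulrN1z ler_norml; apply/andP; split; lra.
have h : 1 - s <= spi (1 - s) by apply: spi_ge_id; apply/andP; split; lra.
have e : spi (1 - s) = spi s by rewrite addrC spi_addr1 spiN opprK.
rewrite mulrN1z -sqrrN opprB -e lerXn2r ?nnegrE//; lra.
Qed.

Lemma on_torus_addz_shift f (x z : R * R) (k l : int) : on_torus f ->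
  f (x + (z.1 + k%:~R, z.2 + l%:~R)) = f (x + z).
Proof.
move=> tf; rewrite -[RHS](on_torus_addz k l _ tf); congr f.
by apply/pair_equal_spec; split => /=; rewrite addrA.
Qed.

(** Average [poisson_translation] over [z] against the kernel, with each [z] replaced by its
    representative nearest to the lattice. The two second moments add up to 1 / (m + 1), which the
    prefactor cancels. *)
Lemma poisson_osc psi w (B : R) m :
  on_torus psi -> C1 psi -> weak_poisson psi w -> bm w ->
  (forall x, `|w x - torus_mean w| <= B) ->
  m.+1%:R * dint m (fun p => (d1 psi p.1 - d1 psi p.2) ^+ 2 +
                 (d2 psi p.1 - d2 psi p.2) ^+ 2) <= B ^+ 2.
Proof.
move=> tp cp wp bw wB.
have bd1 := bm_d1 tp cp; have bd2 := bm_d2 tp cp.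
have td1 : on_torus (d1 psi) by exact: on_torus_derive.
have td2 : on_torus (d2 psi) by exact: on_torus_derive.
pose D (p : (R * R) * (R * R)) := (d1 psi p.1 - d1 psi p.2) ^+ 2 + (d2 psi p.1 - d2 psi p.2) ^+ 2.
have bD : bm D by exact: (bmD (bm_osc bd1) (bm_osc bd2)).
pose Z (p : (R * R) * (R * R)) := D (p.1, p.1 + p.2) * kern m p.2.
have bZ : bm Z.
  apply: bmM; last exact: (bm_snd (bm_kern m)).
  apply: (bm_comp (h := fun p : (R * R) * (R * R) => (p.1, p.1 + p.2 : R * R))) bD.
  by apply: measurable_fun_pair; [exact: measurable_fst|exact: measurable_add2].
have -> : dint m D = torus_int (fun x => torus_int (fun z => Z (x, z))).
  (* Keeping [x] in the unit square makes y = x + z an admissible shift for [tint_shift]. *)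
  apply: eq_tint_sq => x [/= x1 x2].
  move: x1 x2; rewrite !in_itv/= => /andP[x10 x11] /andP[x20 x21].
  have bF := bm_dint2 m x bD.
  rewrite -(tint_shift (f := fun y => D (x, y) * kern m (x - y)) (z := x) bF); last 3 first.
  - apply: on_torusM.
      apply: (on_torusD (f := fun y => (d1 psi x - d1 psi y) ^+ 2) (g := fun y => (d2 psi x - d2 psi y) ^+ 2)).
        exact: (on_torus_comp (fun r => (d1 psi x - r) ^+ 2) td1).
      exact: (on_torus_comp (fun r => (d2 psi x - r) ^+ 2) td2).
    move=> y; rewrite !(kern_subC m x).
    by have [<- <-] := on_torus_shift (- x) (@on_torus_kern _ m) y.
  - by rewrite ger0_norm.
  - by rewrite ger0_norm.
  apply: eq_tint => z; rewrite /Z /= (addrC z x); congr (D (x, _) * _).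
  by rewrite opprD addrA subrr sub0r kernN.
rewrite (tint_swap bZ).
have bI : bm (fun z : R * R => torus_int (fun x => Z (x, z))).
  apply: (bm_tint (H := fun p : (R * R) * (R * R) => Z (p.2, p.1))).
  apply: (bm_comp (h := fun p : (R * R) * (R * R) => (p.2, p.1))) bZ.
  by apply: measurable_fun_pair; [exact: measurable_snd|exact: measurable_fst].
pose s1 (z : R * R) := spi (0 - z.1) ^+ 2 * kern m (0 - z).
pose s2 (z : R * R) := spi (0 - z.2) ^+ 2 * kern m (0 - z).
have bk0 : bm (fun z : R * R => kern m (0 - z)) by exact: (bm_section1 (0 : R * R) (bm_sub2 (bm_kern m))).
have b0 (pr : R * R -> R) : measurable_fun setT pr -> bm (fun z => spi (0 - pr z) ^+ 2).
  move=> mpr; apply: bmX; apply: (bm_comp (h := fun z => 0 - pr z)) bm_spi.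
  exact: measurable_funB.
have bs1 : bm s1 by exact: (bmM (b0 fst measurable_fst) bk0).
have bs2 : bm s2 by exact: (bmM (b0 snd measurable_snd) bk0).
have bs := bmM (bm_cst (B ^+ 2)) (bmD bs1 bs2).
have h2 : 2 * m%:R + 2 = 2 * m.+1%:R :> R by rewrite -[m.+1%:R]natr1 mulrDr mulr1.
have e1 : torus_int s1 = (2 * m.+1%:R)^-1.
  by rewrite -h2 -int01_spi2 -(tint_kern_spi1 m (n := 2) 0).
have e2 : torus_int s2 = (2 * m.+1%:R)^-1.
  by rewrite -h2 -int01_spi2 -(tint_kern_spi2 m (n := 2) 0).
have m0 : 0 < m.+1%:R :> R by [].
apply: (@le_trans _ _ (m.+1%:R * (B ^+ 2 * (torus_int s1 + torus_int s2)))); last first.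
  by rewrite e1 e2 le_eqVlt; apply/orP; left; apply/eqP; field; rewrite gt_eqF.
rewrite ler_pM2l// -(tintD bs1 bs2) -(tintZl _ (bmD bs1 bs2)).
apply: (le_tint_sq bI bs) => z [/= z1 z2].
have [k k1 k2] : exists2 k : int, `|z.1 + k%:~R| <= 1 & (z.1 + k%:~R) ^+ 2 <= spi z.1 ^+ 2.
  by apply: period_dist_spi; move: z1; rewrite in_itv.
have [l l1 l2] : exists2 k : int, `|z.2 + k%:~R| <= 1 & (z.2 + k%:~R) ^+ 2 <= spi z.2 ^+ 2.
  by apply: period_dist_spi; move: z2; rewrite in_itv.
pose z' := (z.1 + k%:~R, z.2 + l%:~R).
have bE : bm (fun x : R * R => D (x, x + z)).
  apply: (bm_comp (h := fun x : R * R => (x, x + z : R * R))) bD.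
  by apply: measurable_fun_pair => //; exact: measurable_addr.
have -> : torus_int (fun x => Z (x, z)) = torus_int (fun x => D (x, x + z)) * kern m z.
  by rewrite -(tintZr _ bE).
have -> : torus_int (fun x => D (x, x + z)) = torus_int (fun x => (d1 psi (x + z') - d1 psi x) ^+ 2 +
                      (d2 psi (x + z') - d2 psi x) ^+ 2).
  apply: eq_tint => x; rewrite /D /z' /= !on_torus_addz_shift//.
  by rewrite -sqrrN opprB -[in X in _ + X]sqrrN opprB.
rewrite /s1 /s2 -mulrDl mulrA !sub0r kernN !spiN !sqrrN.
apply: ler_wpM2r; first exact: kern_ge0.
apply: le_trans (poisson_translation (z := z') tp cp wp bw wB k1 l1) _.
by apply: ler_wpM2l; [exact: sqr_ge0|exact: lerD].
Qed.

Lemma d1_kernN m (z : R * R) : d1 (kern m) (- z) = - d1 (kern m) z.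
Proof.
have c : C1 (fun s : R => ck m s / ci m) by exact: (C1M (C1_ck m) (C1_cst _)).
rewrite !(d1_prod _ c c) !derive_ckn !derive_ck /= spiN cpiN !ckN; ring.
Qed.

Lemma d2_kernN m (z : R * R) : d2 (kern m) (- z) = - d2 (kern m) z.
Proof.
have c : C1 (fun s : R => ck m s / ci m) by exact: (C1M (C1_ck m) (C1_cst _)).
rewrite !(d2_prod _ c c) !derive_ckn !derive_ck /= spiN cpiN !ckN; ring.
Qed.

Lemma tint_d1_kern m (x : R * R) : torus_int (fun y => d1 (kern m) (y - x)) = 0.
Proof.
have := tint_d1 (on_torus_shift (- x) (@on_torus_kern R m)) (C1_shift (- x) (C1_kern m)).
by under [X in torus_int X]eq_fun do rewrite /d1 derive_shiftE.
Qed.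

Lemma tint_d2_kern m (x : R * R) : torus_int (fun y => d2 (kern m) (y - x)) = 0.
Proof.
have := tint_d2 (on_torus_shift (- x) (@on_torus_kern R m)) (C1_shift (- x) (C1_kern m)).
by under [X in torus_int X]eq_fun do rewrite /d2 derive_shiftE.
Qed.

Definition comm_kern psi m (p : (R * R) * (R * R)) : R :=
  ((grad_perp psi p.1).1 - (grad_perp psi p.2).1) * d1 (kern m) (p.1 - p.2) +
  ((grad_perp psi p.1).2 - (grad_perp psi p.2).2) * d2 (kern m) (p.1 - p.2).

Lemma bm_comm_kern psi m : on_torus psi -> C1 psi -> bm (comm_kern psi m).
Proof.
move=> tp cp.
have bd1 := bm_d1 tp cp; have bd2 := bm_d2 tp cp; have bd1N := bmN bd1.
have k1 := bm_sub2 (bm_d1 (@on_torus_kern R m) (C1_kern m)).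
have k2 := bm_sub2 (bm_d2 (@on_torus_kern R m) (C1_kern m)).
exact: (bmD (bmM (bmB (bm_fst bd2) (bm_snd bd2)) k1)
  (bmM (bmB (bm_fst bd1N) (bm_snd bd1N)) k2)).
Qed.

(** The part with the velocity at [y] vanishes because the velocity is divergence free, the part
    with the velocity at [x] because a derivative of the kernel has mean zero. Hence a function of
    [x] may be subtracted from [g y] in the commutator. *)
Lemma tint_comm_kern psi m (x : R * R) : on_torus psi -> C1 psi ->
  torus_int (fun y => comm_kern psi m (x, y)) = 0.
Proof.
move=> tp cp.
have tk := on_torus_shift (- x) (@on_torus_kern R m).
have ck := C1_shift (- x) (@C1_kern R m).
have bk1 : bm (fun y : R * R => d1 (kern m) (y - x)).
  exact: (bm_addr (- x) (bm_d1 (@on_torus_kern R m) (C1_kern m))).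
have bk2 : bm (fun y : R * R => d2 (kern m) (y - x)).
  exact: (bm_addr (- x) (bm_d2 (@on_torus_kern R m) (C1_kern m))).
have bg1 : bm (fun y => (grad_perp psi y).1) by exact: (bm_d2 tp cp).
have bg2 : bm (fun y => (grad_perp psi y).2) by exact: (bmN (bm_d1 tp cp)).
have h := tint_grad_perp tp cp tk ck.
have -> : (fun y => comm_kern psi m (x, y)) = (fun y =>
    ((grad_perp psi y).1 * d1 (fun y => kern m (y - x)) y +
     (grad_perp psi y).2 * d2 (fun y => kern m (y - x)) y) -
    ((grad_perp psi x).1 * d1 (kern m) (y - x) +
     (grad_perp psi x).2 * d2 (kern m) (y - x))).
  apply/funext => y; rewrite /comm_kern [(x, y).1]/= [(x, y).2]/= -(opprB y x) d1_kernN d2_kernN.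
  by rewrite [in RHS]/d1 [in RHS]/d2 !derive_shiftE -/(d1 _ _) -/(d2 _ _) /=; ring.
have bA : bm (fun y => (grad_perp psi y).1 * d1 (fun y => kern m (y - x)) y +
     (grad_perp psi y).2 * d2 (fun y => kern m (y - x)) y).
  exact: (bmD (bmM bg1 (bm_d1 tk ck)) (bmM bg2 (bm_d2 tk ck))).
have bB1 := bmM (bm_cst (grad_perp psi x).1) bk1.
have bB2 := bmM (bm_cst (grad_perp psi x).2) bk2.
rewrite (tintB bA (bmD bB1 bB2)) h (tintD bB1 bB2) (tintZl _ bk1) (tintZl _ bk2).
by rewrite tint_d1_kern tint_d2_kern !mulr0 addr0 subr0.
Qed.

(* The difference of the two sides is a sum of squares; it is used with
   X = |u x - u y|, S = |sin (pi * s)| and c = |g x - g y|, M being the order of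
   the kernel. *)
Lemma commutator_young (M X S c G delta : R) : 0 <= M -> 0 < delta -> c ^+ 2 <= 4 * G ^+ 2 ->
  M * c * X * S <=
  delta / 2 * M * X ^+ 2 + delta * G ^+ 2 * M ^+ 2 * (S ^+ 2) ^+ 2 + (2 * delta ^+ 3)^-1 * c ^+ 2.
Proof.
move=> M0 d0 cG; have d1 := ltW d0; rewrite -subr_ge0.
have -> : delta / 2 * M * X ^+ 2 + delta * G ^+ 2 * M ^+ 2 * (S ^+ 2) ^+ 2 +
    (2 * delta ^+ 3)^-1 * c ^+ 2 - M * c * X * S =
  M * delta / 2 * (X - c * S / delta) ^+ 2 +
  delta / 4 * c ^+ 2 * (M * S ^+ 2 - 1 / delta ^+ 2) ^+ 2 +
  4^-1 * (delta * (M * S ^+ 2) ^+ 2 * (4 * G ^+ 2 - c ^+ 2)) + (4 * delta ^+ 3)^-1 * c ^+ 2.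
  by field; rewrite gt_eqF.
have i1 : 0 <= M * delta / 2 * (X - c * S / delta) ^+ 2.
  by apply: mulr_ge0; [apply: divr_ge0 => //; exact: mulr_ge0|exact: sqr_ge0].
have i2 : 0 <= delta / 4 * c ^+ 2 * (M * S ^+ 2 - 1 / delta ^+ 2) ^+ 2.
  apply: mulr_ge0; last exact: sqr_ge0.
  by apply: mulr_ge0; [exact: divr_ge0|exact: sqr_ge0].
have i3 : 0 <= delta * (M * S ^+ 2) ^+ 2 * (4 * G ^+ 2 - c ^+ 2).
  apply: mulr_ge0; last by rewrite subr_ge0.
  by apply: mulr_ge0 => //; exact: sqr_ge0.
have i4 : 0 <= (4 * delta ^+ 3)^-1 * c ^+ 2.
  apply: mulr_ge0; last exact: sqr_ge0.
  by rewrite invr_ge0; apply: mulr_ge0 => //; exact: exprn_ge0.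
apply: addr_ge0 => //; apply: addr_ge0; first exact: addr_ge0.
exact: mulr_ge0.
Qed.

(** After replacing [g y] by g y - g x, [commutator_young] is applied in each coordinate. The
    velocity term is bounded by [poisson_osc], the sine term by the fourth moment, both uniformly in
    [m]; only the last term involves the oscillation of [g]. *)
Lemma commutator_bound psi w f g (B F G delta : R) m :
  on_torus psi -> C1 psi -> weak_poisson psi w -> bm w ->
  (forall x, `|w x - torus_mean w| <= B) ->
  bm f -> (forall x, `|f x| <= F) -> bm g -> (forall x, `|g x| <= G) -> 0 < delta ->
  `|torus_int (fun x => torus_int (fun y => f x * g y * comm_kern psi m.+1 (x, y)))| <=
  32 * F * (delta * (B ^+ 2 + 2 * G ^+ 2) + osc m g / delta ^+ 3).
Proof.
move=> tp cp wp bw wB bf fF bg gG d0.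
have F0 : 0 <= F by exact: le_trans (fF 0).
have bck := bm_comm_kern m.+1 tp cp.
have bd1 := bm_d1 tp cp; have bd2 := bm_d2 tp cp.
pose H0 (p : (R * R) * (R * R)) := f p.1 * (g p.2 - g p.1) * comm_kern psi m.+1 p.
have bdg : bm (fun p : (R * R) * (R * R) => g p.2 - g p.1).
  exact: (bmB (bm_snd bg) (bm_fst bg)).
have bH0 : bm H0 by exact: (bmM (bmM (bm_fst bf) bdg) bck).
have -> : torus_int (fun x => torus_int (fun y => f x * g y * comm_kern psi m.+1 (x, y))) =
    torus_int (fun x => torus_int (fun y => H0 (x, y))).
  apply: eq_tint => x.
  have bx : bm (fun y => comm_kern psi m.+1 (x, y)) by exact: (bm_section1 x bck).
  have b1 : bm (fun y => f x * g y * comm_kern psi m.+1 (x, y)).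
    exact: (bmM (bmM (bm_cst _) bg) bx).
  have -> : (fun y => H0 (x, y)) = (fun y => f x * g y * comm_kern psi m.+1 (x, y) -
     f x * g x * comm_kern psi m.+1 (x, y)) by apply/funext => y; rewrite /H0 /=; ring.
  rewrite (tintB b1 (bmM (bm_cst _) bx)) (tintZl _ bx) tint_comm_kern//.
  by rewrite mulr0 subr0.
pose s1 (p : (R * R) * (R * R)) := spi (p.1.1 - p.2.1) ^+ 4.
pose s2 (p : (R * R) * (R * R)) := spi (p.1.2 - p.2.2) ^+ 4.
have b4 (pr : R * R -> R) : measurable_fun setT pr ->
    bm (fun p : (R * R) * (R * R) => spi (pr p.1 - pr p.2) ^+ 4).
  move=> mpr; apply: bmX.
  apply: (bm_comp (h := fun p : (R * R) * (R * R) => pr p.1 - pr p.2)) bm_spi.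
  apply: measurable_funB; first exact: (measurableT_comp mpr measurable_fst).
  exact: (measurableT_comp mpr measurable_snd).
have bs1 : bm s1 by exact: (b4 fst measurable_fst).
have bs2 : bm s2 by exact: (b4 snd measurable_snd).
pose D (p : (R * R) * (R * R)) := (d1 psi p.1 - d1 psi p.2) ^+ 2 + (d2 psi p.1 - d2 psi p.2) ^+ 2.
have bD : bm D by exact: (bmD (bm_osc bd1) (bm_osc bd2)).
have bog := bm_osc bg.
(* Coefficients of [commutator_young] times the gradient constant 32 and the bound of [f]. The final
   factor 2 in [c3] counts the two coordinates, which share the same increment of [g]. *)
pose c1 := 32 * F * (delta / 2 * m.+1%:R).
pose c2 := 32 * F * (delta * G ^+ 2 * m.+1%:R ^+ 2).
pose c3 := 32 * F * (2 * delta ^+ 3)^-1 * 2.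
pose H1 (p : (R * R) * (R * R)) := (c1 * D p + c2 * (s1 p + s2 p)) + c3 * (g p.1 - g p.2) ^+ 2.
have bc1 := bmM (bm_cst c1) bD; have bc2 := bmM (bm_cst c2) (bmD bs1 bs2).
have bc3 := bmM (bm_cst c3) bog.
have bH1 : bm H1 by exact: (bmD (bmD bc1 bc2) bc3).
apply: (@le_trans _ _ (dint m H1)).
  have bk1 := bm_dint1 m bH1.
  apply: (normr_tint_le (bm_tint bH0) bk1) => x.
  apply: (normr_tint_le (bm_section1 x bH0) (bm_dint2 m x bH1)) => y.
  rewrite /H0 /H1 /D /s1 /s2 /comm_kern /grad_perp /=.
  set k := kern m (x - y); set gd := g y - g x.
  set u1 := d2 psi x - d2 psi y; set u2 := - d1 psi x - - d1 psi y.
  have -> : (d1 psi x - d1 psi y) ^+ 2 = u2 ^+ 2 by rewrite /u2; ring.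
  have -> : (g x - g y) ^+ 2 = gd ^+ 2 by rewrite /gd; ring.
  have n1 := norm_d1_kern m (x - y); have n2 := norm_d2_kern m (x - y).
  move: n1 n2 => /=; set r1 := spi _; set r2 := spi _ => n1 n2.
  have k0 : 0 <= k by exact: kern_ge0.
  have g2 : `|gd| <= 2 * G.
    by rewrite (le_trans (ler_normB _ _))// mulr_natl mulr2n lerD.
  set M := m.+1%:R : R.
  have M0 : 0 <= M by [].
  have key (u s : R) : M * `|gd| * `|u| * `|s| <=
      delta / 2 * M * u ^+ 2 + delta * G ^+ 2 * M ^+ 2 * s ^+ 4 + (2 * delta ^+ 3)^-1 * gd ^+ 2.
    have gG2 : gd ^+ 2 <= 4 * G ^+ 2.
      rewrite -(real_normK (num_real gd)) (_ : 4 * G ^+ 2 = (2 * G) ^+ 2); last by ring.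
      by apply: lerXn2r; [rewrite nnegrE|rewrite nnegrE (le_trans _ g2)|exact: g2].
    have -> : u ^+ 2 = `|u| ^+ 2 by rewrite real_normK ?num_real.
    have -> : s ^+ 4 = (`|s| ^+ 2) ^+ 2 by rewrite real_normK ?num_real// -exprM.
    rewrite -(real_normK (num_real gd)) in gG2 *.
    exact: commutator_young.
  have k1 := key u1 r1; have k2 := key u2 r2.
  have -> : (c1 * (u2 ^+ 2 + u1 ^+ 2) + c2 * (r1 ^+ 4 + r2 ^+ 4) + c3 * gd ^+ 2) * k =
    32 * F * k * ((delta / 2 * M * u1 ^+ 2 + delta * G ^+ 2 * M ^+ 2 * r1 ^+ 4 + (2 * delta ^+ 3)^-1 * gd ^+ 2) +
      (delta / 2 * M * u2 ^+ 2 + delta * G ^+ 2 * M ^+ 2 * r2 ^+ 4 + (2 * delta ^+ 3)^-1 * gd ^+ 2)).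
    by rewrite /c1 /c2 /c3 -/M; ring.
  apply: (@le_trans _ _ (32 * F * k * (M * `|gd| * `|u1| * `|r1| + M * `|gd| * `|u2| * `|r2|))); last first.
    apply: ler_wpM2l; last exact: lerD.
    by apply: mulr_ge0 => //; apply: mulr_ge0.
  rewrite !normrM.
  have -> : 32 * F * k * (M * `|gd| * `|u1| * `|r1| + M * `|gd| * `|u2| * `|r2|) =
    F * `|gd| * (`|u1| * (32 * M * `|r1| * k) + `|u2| * (32 * M * `|r2| * k)) by ring.
  apply: (ler_pM (mulr_ge0 (normr_ge0 _) (normr_ge0 _)) (normr_ge0 _)).
    by apply: ler_wpM2r; [exact: normr_ge0|exact: fF].
  apply: le_trans (ler_normD _ _) _; rewrite (normrM u1) (normrM u2).
  by apply: lerD; (apply: ler_wpM2l; first exact: normr_ge0).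
rewrite (dintD m (bmD bc1 bc2) bc3) (dintD m bc1 bc2) (dintZl m c1 bD).
rewrite (dintZl m c2 (bmD bs1 bs2)) (dintD m bs1 bs2) (dintZl m c3 bog).
rewrite dint_spi4_fst dint_spi4_snd -/(osc m g).
have U := poisson_osc m tp cp wp bw wB; rewrite -/D in U.
set U' := dint m D in U *; set M := m.+1%:R : R in U c1 c2 bc1 bc2 bc3 H1 bH1 *.
have M0 : 0 < M by rewrite /M.
have -> : 2 * m%:R + 2 = 2 * M :> R by rewrite /M -[m.+1%:R]natr1 mulrDr mulr1.
have -> : 2 * m%:R + 4 = 2 * (M + 1) :> R by rewrite /M -[m.+1%:R]natr1; ring.
(* The fourth moment times M^2 stays below 3/4; twice this, for two coordinates, is rounded up to
   the 2 in the statement. *)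
have q : M ^+ 2 * (3 / (2 * M * (2 * (M + 1)))) <= 3 / 4.
  have -> : M ^+ 2 * (3 / (2 * M * (2 * (M + 1)))) = 3 / 4 * (M / (M + 1)).
    by field; rewrite !gt_eqF// addr_gt0.
  by rewrite ler_piMr// ler_pdivrMr ?addr_gt0// mul1r lerDl.
set q0 := 3 / _ in q *.
rewrite /c1 /c2 /c3.
have -> : 32 * F * (delta / 2 * M) * U' + 32 * F * (delta * G ^+ 2 * M ^+ 2) * (q0 + q0) +
    32 * F * (2 * delta ^+ 3)^-1 * 2 * osc m g =
  32 * F * (delta * ((M * U') / 2 + G ^+ 2 * (2 * (M ^+ 2 * q0))) + osc m g / delta ^+ 3).
  by field; rewrite gt_eqF.
apply: ler_wpM2l; first exact: mulr_ge0.
rewrite lerD2r; apply: ler_wpM2l; first exact: ltW.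
apply: lerD; first by have := sqr_ge0 B; lra.
by rewrite [leRHS]mulrC; apply: ler_wpM2l; [exact: sqr_ge0|lra].
Qed.

(** The pointwise bound |a| <= delta + a^2 / delta for the increment of [g] replaces Cauchy-Schwarz
    and has the same shape as the commutator bound. *)
Lemma kern_mean_cvg f g (F delta : R) m : bm f -> (forall x, `|f x| <= F) -> bm g -> 0 < delta ->
  `|torus_int (fun x => torus_int (fun y => f x * g y * kern m (x - y))) -
    torus_int (fun x => f x * g x)| <= F * (delta + osc m g / delta).
Proof.
move=> bf fF bg d0.
have bfg : bm (fun p : (R * R) * (R * R) => f p.1 * g p.2) by exact: (bmM (bm_fst bf) (bm_snd bg)).
have bff : bm (fun p : (R * R) * (R * R) => f p.1 * g p.1) by exact: (bmM (bm_fst bf) (bm_fst bg)).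
rewrite -/(dint m (fun p => f p.1 * g p.2)) -(dint_fst m (bmM bf bg)).
have -> : dint m (fun p => f p.1 * g p.2) - dint m (fun p => f p.1 * g p.1) =
    dint m (fun p => f p.1 * g p.2 + -1 * (f p.1 * g p.1)).
  by rewrite (dintD m bfg (bmM (bm_cst (-1)) bff)) (dintZl m (-1) bff) mulN1r.
have bog := bm_osc bg.
have -> : F * (delta + osc m g / delta) = dint m (fun p => F * delta + F / delta * (g p.1 - g p.2) ^+ 2).
  rewrite (dintD m (bm_cst _) (bmM (bm_cst _) bog)) (dintZl m _ bog) dint_cst /osc.
  ring.
apply: normr_dint_le.
- exact: (bmD bfg (bmM (bm_cst (-1)) bff)).
- exact: (bmD (bm_cst _) (bmM (bm_cst _) bog)).
move=> [x y] /=.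
have -> : f x * g y + -1 * (f x * g x) = f x * (g y - g x) by ring.
rewrite normrM.
have -> : F * delta + F / delta * (g x - g y) ^+ 2 = F * (delta + (g x - g y) ^+ 2 / delta) by ring.
apply: ler_pM => //.
rewrite distrC -(real_normK (num_real (g x - g y))); set a := `|_|.
have a0 : 0 <= a by exact: normr_ge0.
rewrite -(ler_pM2r d0) mulrDl divfK ?gt_eqF//; nra.
Qed.

End Commutator.

(** * Weak solutions of the transport equation *)

Section TimeCalculus.
Context {R : realType}.
Local Notation leb := (@lebesgue_measure R).

Definition below : set (R * R) := [set p | p.2 <= p.1].

Lemma bm_below : bm (fun p : R * R => \1_below p : R).
Proof.
split; last by exists 1 => p; rewrite indicE; case: (_ \in _); rewrite ?normr1 ?normr0.
apply: measurable_indic.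
rewrite -[below]setTI; apply: measurable_fun_le => //; exact: measurable_snd || exact: measurable_fst.
Qed.

Lemma Rint_below (h : R -> R) (s t : R) : s <= t ->
  \int[leb]_(r in `[0%R, t]) (h r * \1_below (s, r)) = \int[leb]_(r in `[0%R, s]) h r.
Proof.
move=> st.
have -> : `[0%R, s]%classic = `[0%R, t] `&` [set r | r <= s].
  apply/seteqP; split => r /=; rewrite !in_itv/=.
    by move=> /andP[r0 rs]; split => //; rewrite r0 (le_trans rs).
  by move=> [/andP[-> _] ->].
rewrite Rintegral_mkcondr; apply: eq_Rintegral => r _.
rewrite patchE indicE; have [rs|sr] := leP r s.
  by rewrite !mem_set// mulr1.
have n1 : ~ below (s, r) by rewrite /below /= leNgt sr.
have n2 : ~ [set r0 | r0 <= s] r by rewrite /= leNgt sr.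
by rewrite (memNset n1) (memNset n2) mulr0.
Qed.

(** The complement of [below] is an open triangle, so the integral runs over the half-open interval;
    its endpoint is null. *)
Lemma Rint_above (h : R -> R) (s t : R) : bm h -> s <= t ->
  \int[leb]_(r in `[0%R, t]) (h r * (1 - \1_below (r, s))) = \int[leb]_(r in `[0%R, s]) h r.
Proof.
move=> bh st.
have fin : (leb `[0%R, s[ < +oo)%E.
  apply: le_lt_trans (leb_itv_ltoo 0 s); apply: le_measure; rewrite ?inE.
  - exact: measurable_itv.
  - exact: measurable_itv.
  - by move=> r /=; rewrite !in_itv/= => /andP[-> /ltW].
rewrite -[RHS]Rintegral_itv_bndo_bndc; last exact: (bm_integrable (mu := leb) (measurable_itv _) fin bh).
have -> : `[0%R, s[%classic = `[0%R, t] `&` [set r | r < s].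
  apply/seteqP; split => r /=; rewrite !in_itv/=.
    by move=> /andP[r0 rs]; split => //; rewrite r0 (le_trans (ltW rs)).
  by move=> [/andP[-> _] ->].
rewrite Rintegral_mkcondr; apply: eq_Rintegral => r _.
rewrite patchE indicE; have [sr|rs] := leP s r.
  have n2 : ~ [set r0 | r0 < s] r by rewrite /= ltNge sr.
  by rewrite (memNset n2) mem_set// subrr mulr0.
have n1 : ~ below (r, s) by rewrite /below /= leNgt rs.
by rewrite (memNset n1) mem_set// subr0 mulr1.
Qed.

Lemma bm_Rint_itv_param (H : R * R -> R) (t : R) : bm H ->
  bm (fun s => \int[leb]_(r in `[0%R, t]) H (s, r)).
Proof. by move=> bH; apply: (bm_Rint2 (m2 := leb)) => //; exact: leb_itv_ltoo. Qed.

(* Fubini on the two triangles of the square [0, t]^2. *)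
Lemma product_rule_int (F G a b : R -> R) (F0 G0 t : R) :
  bm F -> bm G -> bm a -> bm b -> 0 <= t ->
  (forall s, 0 <= s <= t -> F s - F0 = \int[leb]_(r in `[0%R, s]) a r) ->
  (forall s, 0 <= s <= t -> G s - G0 = \int[leb]_(r in `[0%R, s]) b r) ->
  F t * G t - F0 * G0 = \int[leb]_(s in `[0%R, t]) (a s * G s + F s * b s).
Proof.
move=> bF bG ba bb t0 hF hG.
have mI : measurable (`[0%R, t] : set R) by exact: measurable_itv.
have fI : (leb `[0%R, t] < +oo)%E by exact: leb_itv_ltoo.
have ID (f g : R -> R) := RintD (mu := leb) mI fI (f := f) (g := g).
have IZl (f : R -> R) c := RintZl (mu := leb) mI fI (f := f) c.
have IZr (f : R -> R) c := RintZr (mu := leb) mI fI (f := f) c.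
have tt : 0 <= t <= t by rewrite t0/=.
have hFt := hF t tt; have hGt := hG t tt.
have ba1 : bm (fun p : R * R => a p.1) by exact: (bm_comp (h := fst) measurable_fst ba).
have bb2 : bm (fun p : R * R => b p.2) by exact: (bm_comp (h := snd) measurable_snd bb).
have bH1 : bm (fun p : R * R => a p.1 * (b p.2 * \1_below p)).
  exact: (bmM ba1 (bmM bb2 bm_below)).
have bH2 : bm (fun p : R * R => b p.2 * (a p.1 * (1 - \1_below p))).
  exact: (bmM bb2 (bmM ba1 (bmB (bm_cst 1) bm_below))).
have e1 : \int[leb]_(s in `[0%R, t]) (a s * G s) = G0 * (F t - F0) +
    \int[leb]_(s in `[0%R, t]) \int[leb]_(r in `[0%R, t]) (a s * (b r * \1_below (s, r))).
  rewrite hFt -(IZl _ _ ba) -(ID _ _ (bmM (bm_cst _) ba) (bm_Rint_itv_param t bH1)).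
  apply: eq_Rintegral => s; rewrite inE/= in_itv/= => st.
  have bs : bm (fun r => b r * \1_below (s, r)) by exact: (bmM bb (bm_section1 s bm_below)).
  rewrite (IZl _ _ bs) Rint_below; last by case/andP: st.
  by rewrite -hG//; ring.
have e2 : \int[leb]_(r in `[0%R, t]) (F r * b r) = F0 * (G t - G0) +
    \int[leb]_(r in `[0%R, t]) \int[leb]_(s in `[0%R, t]) (b r * (a s * (1 - \1_below (s, r)))).
  have bH2' : bm (fun p : R * R => b p.1 * (a p.2 * (1 - \1_below (p.2, p.1)))).
    apply: (bm_comp (h := fun p : R * R => (p.2, p.1))) bH2.
    by apply: measurable_fun_pair; [exact: measurable_snd|exact: measurable_fst].
  rewrite hGt -(IZl _ _ bb) -(ID _ _ (bmM (bm_cst _) bb) (bm_Rint_itv_param t bH2')).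
  apply: eq_Rintegral => s; rewrite inE/= in_itv/= => st.
  have bs : bm (fun r => a r * (1 - \1_below (r, s))).
    exact: (bmM ba (bmB (bm_cst 1) (bm_section2 s bm_below))).
  rewrite (IZl _ _ bs) Rint_above//; last by case/andP: st.
  by rewrite -hF//; ring.
have e3 := Rint_Fubini (m1 := leb) (m2 := leb) mI fI mI fI bH2.
rewrite (ID _ _ (bmM ba bG) (bmM bF bb)) e1 e2 -e3 /=.
(* The closed triangle and its complement fill the square, over which the integrand a(s) b(r)
   separates. *)
have e4 : \int[leb]_(s in `[0%R, t]) \int[leb]_(r in `[0%R, t]) (a s * (b r * \1_below (s, r))) +
    \int[leb]_(s in `[0%R, t]) \int[leb]_(r in `[0%R, t]) (b r * (a s * (1 - \1_below (s, r)))) =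
    (F t - F0) * (G t - G0).
  rewrite -(ID _ _ (bm_Rint_itv_param t bH1) (bm_Rint_itv_param t bH2)).
  rewrite hFt -(IZr _ _ ba); apply: eq_Rintegral => s _.
  rewrite -(ID _ _ (bm_section1 s bH1) (bm_section1 s bH2)) hGt -(IZl _ _ bb).
  by apply: eq_Rintegral => r _ /=; ring.
by rewrite addrACA e4; ring.
Qed.

End TimeCalculus.

(** * Doubling of variables with a separable kernel *)

Section KernelSums.
Context {R : realType}.
Implicit Types (f g psi eta chi : R * R -> R) (m : nat).

Lemma C1_sum (V : normedModType R) (I : Type) (r : seq I) (F : I -> V -> R) :
  (forall i, C1 (F i)) -> C1 (fun x => \sum_(i <- r) F i x).
Proof.
move=> cF; elim: r => [|i r ih].
  by under eq_fun do rewrite big_nil; exact: C1_cst.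
by under eq_fun do rewrite big_cons; exact: C1D.
Qed.

Lemma derive_sumE (V : normedModType R) (I : Type) (r : seq I) (F : I -> V -> R) (v x : V) :
  (forall i, C1 (F i)) ->
  'D_v (fun x => \sum_(i <- r) F i x) x = \sum_(i <- r) 'D_v (F i) x.
Proof.
move=> cF; elim: r => [|i r ih].
  by under eq_fun do rewrite big_nil; rewrite big_nil; exact: derive_cst.
under eq_fun do rewrite big_cons.
by rewrite deriveDE ?big_cons ?ih//; exact: C1_sum.
Qed.

Lemma tint_mul f g : bm f -> bm g ->
  torus_int f * torus_int g = torus_int (fun x => torus_int (fun y => f x * g y)).
Proof.
move=> bf bg; rewrite -(tintZr _ bf); apply: eq_tint => x.
by rewrite (tintZl _ bg).
Qed.

Definition adv psi eta (x : R * R) : R :=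
  (grad_perp psi x).1 * d1 eta x + (grad_perp psi x).2 * d2 eta x.

Lemma advM psi eta chi x : C1 eta -> C1 chi ->
  adv psi (fun x => eta x * chi x) x = eta x * adv psi chi x + adv psi eta x * chi x.
Proof.
move=> ce cc; rewrite /adv.
have -> : d1 (fun x => eta x * chi x) x = eta x * d1 chi x + d1 eta x * chi x by exact: deriveME.
have -> : d2 (fun x => eta x * chi x) x = eta x * d2 chi x + d2 eta x * chi x by exact: deriveME.
ring.
Qed.

Lemma bm_adv psi eta : on_torus psi -> C1 psi -> on_torus eta -> C1 eta -> bm (adv psi eta).
Proof.
move=> tp cp te ce.
exact: (bmD (bmM (bm_d2 tp cp) (bm_d1 te ce)) (bmM (bmN (bm_d1 tp cp)) (bm_d2 te ce))).
Qed.

Section Separable.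
Variables (m : nat) (I : finType) (E E' : I -> R * R -> R).
Hypothesis hE : forall i, [/\ on_torus (E i), C1 (E i), on_torus (E' i) & C1 (E' i)].
Hypothesis hk : forall x y, kern m (x - y) = \sum_i E i x * E' i y.

Lemma sum_derive_kern_l (v x y : R * R) : \sum_i 'D_v (E i) x * E' i y = 'D_v (kern m) (x - y).
Proof.
rewrite -(derive_shiftE (kern m) (- y) v x).
under [X in _ = 'D_v X x]eq_fun do rewrite hk.
rewrite derive_sumE; last first.
  by move=> i; have [_ cE _ _] := hE i; exact: (C1M cE (C1_cst _)).
apply: eq_bigr => i _; have [_ cE _ _] := hE i.
under eq_fun do rewrite mulrC.
by rewrite deriveZlE// mulrC.
Qed.

Lemma sum_derive_kern_r (v x y : R * R) : \sum_i E i x * 'D_v (E' i) y = 'D_v (kern m) (y - x).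
Proof.
rewrite -(derive_shiftE (kern m) (- x) v y).
under [X in _ = 'D_v X y]eq_fun do rewrite -kern_subC hk.
rewrite derive_sumE; last first.
  by move=> i; have [_ _ _ cE] := hE i; exact: (C1M (C1_cst _) cE).
by apply: eq_bigr => i _; have [_ _ _ cE] := hE i; rewrite deriveZlE.
Qed.

(** The kernel is even, so its derivatives in [x] and in [y] are opposite. The two velocities
    therefore enter as a difference, and what remains besides the commutator is the derivative
    falling on [chi]. *)
Lemma sum_adv_kern psi chi f g (x y : R * R) : C1 chi ->
  \sum_i (f x * adv psi (fun x => chi x * E i x) x * (g y * E' i y) +
     f x * (chi x * E i x) * (g y * adv psi (E' i) y)) =
  f x * adv psi chi x * g y * kern m (x - y) + f x * chi x * g y * comm_kern psi m (x, y).
Proof.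
move=> cc.
have e1 := sum_derive_kern_l (1, 0) x y; have e2 := sum_derive_kern_l (0, 1) x y.
have e3 := sum_derive_kern_r (1, 0) x y; have e4 := sum_derive_kern_r (0, 1) x y.
rewrite -/(d1 _ _) -opprB d1_kernN in e3; rewrite -/(d2 _ _) -opprB d2_kernN in e4.
rewrite -/(d1 _ _) in e1; rewrite -/(d2 _ _) in e2.
transitivity (f x * adv psi chi x * g y * (\sum_i E i x * E' i y) + f x * chi x * g y *
    (d2 psi x * (\sum_i 'D_(1, 0) (E i) x * E' i y) - d1 psi x * (\sum_i 'D_(0, 1) (E i) x * E' i y) +
     d2 psi y * (\sum_i E i x * 'D_(1, 0) (E' i) y) - d1 psi y * (\sum_i E i x * 'D_(0, 1) (E' i) y))).
  rewrite !mulr_sumr -sumrB -big_split/= -sumrB mulr_sumr -big_split/=.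
  apply: eq_bigr => i _; have [_ cE _ _] := hE i.
  rewrite advM// {1 3}/adv /grad_perp /=.
  rewrite -!/(d1 _ _) -!/(d2 _ _).
  move: (adv psi chi x) (d1 (E i) x) (d2 (E i) x) (d1 (E' i) y) (d2 (E' i) y) => a b1 b2 b3 b4.
  move: (E i x) (E' i y) (d2 psi x) (d1 psi x) (d2 psi y) (d1 psi y) => a1 a2 c1 c2 c3 c4.
  by ring.
by rewrite -hk e1 e2 e3 e4 /comm_kern /=; ring.
Qed.

End Separable.

End KernelSums.

Section WeakTransport.
Context {R : realType}.
Implicit Types (eta chi : R * R -> R).
Local Notation leb := (@lebesgue_measure R).

Lemma osc_le (g : R * R -> R) (G : R) m : bm g -> (forall x, `|g x| <= G) -> osc m g <= 4 * G ^+ 2.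
Proof.
move=> bg gG; rewrite -(dint_cst m (4 * G ^+ 2)).
apply: (le_dint m (bm_osc bg) (bm_cst _)) => p.
rewrite -(real_normK (num_real (_ - _))) (_ : 4 * G ^+ 2 = (2 * G) ^+ 2); last by ring.
have G0 : 0 <= G by exact: le_trans (gG 0).
apply: lerXn2r; rewrite ?nnegrE ?mulr_ge0//.
by rewrite (le_trans (ler_normB _ _))// mulr_natl mulr2n lerD.
Qed.

(** Time derivative of the doubled integral of f chi g against the kernel. The first term tends to
    the weak right-hand side for the product, the second is the commutator. *)
Definition mollified psi f g chi m : R :=
  torus_int (fun x => torus_int (fun y => f x * adv psi chi x * g y * kern m (x - y))) +
  torus_int (fun x => torus_int (fun y => f x * chi x * g y * comm_kern psi m (x, y))).

Lemma mollified_bound psi w f g chi (B F F' G delta : R) m :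
  on_torus psi -> C1 psi -> weak_poisson psi w -> bm w ->
  (forall x, `|w x - torus_mean w| <= B) ->
  bm f -> bm g -> (forall x, `|g x| <= G) -> on_torus chi -> C1 chi ->
  (forall x, `|f x * chi x| <= F) -> (forall x, `|f x * adv psi chi x| <= F') -> 0 < delta ->
  `|mollified psi f g chi m.+1 - torus_int (fun x => f x * adv psi chi x * g x)| <=
  F' * (delta + osc m.+1 g / delta) +
  32 * F * (delta * (B ^+ 2 + 2 * G ^+ 2) + osc m g / delta ^+ 3).
Proof.
move=> tp cp wp bw wB bf bg gG tc cc fF fF' d0; rewrite /mollified addrAC.
apply: le_trans (ler_normD _ _) _; apply: lerD.
  exact: (kern_mean_cvg m.+1 (bmM bf (bm_adv tp cp tc cc)) fF' bg d0).
exact: (commutator_bound m tp cp wp bw wB (bmM bf (bm_C1 tc cc)) fF bg gG d0).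
Qed.

(** The bound holds for all positive [delta]: [delta] is fixed first, then [n] is taken large enough
    to beat the negative powers of [delta]. *)
Lemma cvg_of_bound (a : nat -> R) (l C C' : R) (e e' : nat -> R) :
  e n @[n --> \oo] --> (0 : R) -> e' n @[n --> \oo] --> (0 : R) ->
  (forall n, 0 <= e n) -> (forall n, 0 <= e' n) -> 0 <= C -> 0 <= C' ->
  (forall delta, 0 < delta -> forall n,
     `|a n - l| <= C * (delta + e n / delta) + C' * (delta + e' n / delta ^+ 3)) ->
  a n @[n --> \oo] --> l.
Proof.
move=> ce ce' e0 e0' C0 C0' h; apply/cvgrPdist_le => eps eps0.
(* With delta = d and e n <= d^2, e' n <= d^4, each bracket is at most 2 d, for a total of at most 2
   d K = eps. The added 1 keeps [K] positive. *)
pose K := C + C' + 1; have K0 : 0 < K by rewrite /K; lra.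
pose d := eps / (2 * K); have d0 : 0 < d by rewrite divr_gt0// mulr_gt0.
have t0 : 0 < d * d by rewrite mulr_gt0.
have t0' : 0 < d ^+ 3 * d by rewrite mulr_gt0// exprn_gt0.
move/cvgrPdist_le : ce => /(_ _ t0) h1; move/cvgrPdist_le : ce' => /(_ _ t0') h2.
near=> n.
have g1 : e n <= d * d.
  have : `|0 - e n| <= d * d by near: n.
  by rewrite sub0r normrN ger0_norm.
have g2 : e' n <= d ^+ 3 * d.
  have : `|0 - e' n| <= d ^+ 3 * d by near: n.
  by rewrite sub0r normrN ger0_norm.
rewrite distrC (le_trans (h d d0 n))//.
have g1' : e n / d <= d by rewrite ler_pdivrMr.
have g2' : e' n / d ^+ 3 <= d by rewrite ler_pdivrMr ?exprn_gt0// mulrC.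
have -> : eps = 2 * d * K by rewrite /d; field; rewrite gt_eqF.
rewrite /K; nra.
Unshelve. all: by end_near. Qed.

Definition tint2 (H : (R * R) * (R * R) -> R) : R :=
  torus_int (fun x => torus_int (fun y => H (x, y))).

Lemma tint2D (H H' : (R * R) * (R * R) -> R) : bm H -> bm H' ->
  tint2 (fun p => H p + H' p) = tint2 H + tint2 H'.
Proof.
move=> bH bH'; rewrite /tint2 -(tintD (bm_tint bH) (bm_tint bH')).
by apply: eq_tint => x; rewrite (tintD (bm_section1 x bH) (bm_section1 x bH')).
Qed.

Lemma tint2_sum (I : Type) (r : seq I) (H : I -> (R * R) * (R * R) -> R) :
  (forall i, bm (H i)) ->
  tint2 (fun p => \sum_(i <- r) H i p) = \sum_(i <- r) tint2 (H i).
Proof.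
move=> bH; rewrite /tint2 -tint_sum; last by move=> i; exact: (bm_tint (bH i)).
by apply: eq_tint => x; rewrite -tint_sum// => i; exact: (bm_section1 x (bH i)).
Qed.

Lemma bm_time_space (h : R * R -> R) : bm h -> bm (fun p : R * (R * R) => h p.2).
Proof. exact: (bm_comp (h := snd) measurable_snd). Qed.

Lemma bound_ge0 (U : Type) (h : U -> R) (M : R) (x : U) : (forall x, `|h x| <= M) -> 0 <= M.
Proof. by move=> hM; exact: le_trans (normr_ge0 _) (hM x). Qed.

Lemma oscS_cvg (k : R * R -> R) : bm k -> osc n.+1 k @[n --> \oo] --> (0 : R).
Proof. by move=> bk; rewrite (cvg_shiftS (fun n => osc n k)); exact: (osc0_bm bk).2. Qed.

Lemma tint2_kern_cvg (h k : R * R -> R) : bm h -> bm k ->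
  tint2 (fun p => h p.1 * k p.2 * kern n.+1 (p.1 - p.2)) @[n --> \oo] -->
  torus_int (fun x => h x * k x).
Proof.
move=> bh bk; have [_ [M hM]] := bh.
have o0 n := osc_ge0 n.+1 k.
apply: (cvg_of_bound (oscS_cvg bk) (oscS_cvg bk) o0 o0 (bound_ge0 (0 : R * R) hM) (lexx 0)).
by move=> delta d0 n; rewrite mul0r addr0; exact: (kern_mean_cvg n.+1 bh hM bk d0).
Qed.

(** At delta = 1 the mollification estimate becomes a bound uniform in the order of the kernel and
    in time, which dominates the time integral in [weak_solutionM]. *)
Lemma unit_scale_bound (d F F' a b c X : R) : 0 <= F -> 0 <= F' -> a <= c -> b <= c ->
  d <= F' * (1 + a / 1) + 32 * F * (1 * X + b / 1 ^+ 3) ->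
  d <= F' * (1 + c) + 32 * F * (X + c).
Proof.
move=> F0 F0' ac bc; rewrite expr1n !divr1 mul1r => /le_trans; apply; apply: lerD.
  by apply: ler_wpM2l => //; rewrite lerD2l.
by apply: ler_wpM2l; [exact: mulr_ge0|rewrite lerD2l].
Qed.

Lemma bm_expR d (U : measurableType d) (h : U -> R) : bm h -> bm (fun x => expR (h x)).
Proof.
move=> [mh [M hM]]; split; first exact: (measurableT_comp (@measurable_expR R)).
by exists (expR M) => x; rewrite ger0_norm ?expR_ge0// ler_expR (le_trans (ler_norm _)).
Qed.

Lemma series_exp_le (r M : R) n : `|r| <= M -> `|series (exp_coeff r) n| <= expR M.
Proof.
move=> rM; have M0 : 0 <= M by exact: le_trans (normr_ge0 _) rM.
apply: (@le_trans _ _ (series (exp_coeff M) n)).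
  rewrite /series /=; apply: le_trans (ler_norm_sum _ _ _) _.
  apply: ler_sum => i _; rewrite /exp_coeff /= normrM normrX [`|_^-1|]ger0_norm ?invr_ge0//.
  by apply: ler_wpM2r; rewrite ?invr_ge0// lerXn2r// nnegrE.
apply: nondecreasing_cvgn_le; last exact: is_cvg_series_exp_coeff.
by apply: nondecreasing_series => i _ _; exact: exp_coeff_ge0.
Qed.

(** * The algebra of bounded weak solutions *)

Section WeakSolutions.
Variables (psi w : R -> R * R -> R) (B T : R).
Hypothesis bm_d1psi : bm (fun p : R * (R * R) => d1 (psi p.1) p.2).
Hypothesis bm_d2psi : bm (fun p : R * (R * R) => d2 (psi p.1) p.2).
Hypothesis torus_psi : forall t, on_torus (psi t).
Hypothesis C1_psi : forall t, C1 (psi t).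
Hypothesis poisson_psi : forall t, weak_poisson (psi t) (w t).
Hypothesis bm_w : forall t, bm (w t).
Hypothesis w_le : forall t x, `|w t x - torus_mean (w t)| <= B.

(* Test functions independent of time suffice. The datum f0 is kept apart from
   f 0, with which it agrees only almost everywhere. *)
Definition weak_solution (f0 : R * R -> R) (f : R -> R * R -> R) : Prop :=
  [/\ bm f0, bm (fun p : R * (R * R) => f p.1 p.2)
    & forall eta, on_torus eta -> C1 eta -> forall t : R, 0 <= t <= T ->
      torus_int (fun x => f t x * eta x) - torus_int (fun x => f0 x * eta x) =
      \int[leb]_(s in `[0%R, t]) torus_int (fun x => f s x * adv (psi s) eta x)].

Lemma bm_adv_time eta : on_torus eta -> C1 eta ->
  bm (fun p : R * (R * R) => adv (psi p.1) eta p.2).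
Proof.
move=> te ce; exact: (bmD (bmM bm_d2psi (bm_time_space (bm_d1 te ce)))
  (bmM (bmN bm_d1psi) (bm_time_space (bm_d2 te ce)))).
Qed.

(* The kernel is a sum of products, so both sides are sums over the factors of
   the product rule for the scalar functions t |-> \int f t * eta * E and
   t |-> \int g t * E'. *)
Lemma mollified_balance f0 f g0 g eta m (t : R) : weak_solution f0 f -> weak_solution g0 g ->
  on_torus eta -> C1 eta -> 0 <= t <= T ->
  bm (fun s => mollified (psi s) (f s) (g s) eta m) /\
  tint2 (fun p => f t p.1 * eta p.1 * g t p.2 * kern m (p.1 - p.2)) -
  tint2 (fun p => f0 p.1 * eta p.1 * g0 p.2 * kern m (p.1 - p.2)) =
  \int[leb]_(s in `[0%R, t]) mollified (psi s) (f s) (g s) eta m.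
Proof.
move=> [bf0 bf hf] [bg0 bg hg] te ce tT; have /andP[t0 tleT] := tT.
have [I [E [E' [hE hk]]]] := @kern_separable R m.
pose X i x := eta x * E i x.
have tX i : on_torus (X i) by have [tE _ _ _] := hE i; exact: on_torusM.
have cX i : C1 (X i) by have [_ cE _ _] := hE i; exact: C1M.
have tE' i : on_torus (E' i) by have [] := hE i.
have cE' i : C1 (E' i) by have [] := hE i.
have bX i := bm_C1 (tX i) (cX i); have bE' i := bm_C1 (tE' i) (cE' i).
have bft s : bm (f s) by exact: (bm_section1 s bf).
have bgt s : bm (g s) by exact: (bm_section1 s bg).
pose F i s := torus_int (fun x => f s x * X i x).
pose G i s := torus_int (fun x => g s x * E' i x).
pose a i s := torus_int (fun x => f s x * adv (psi s) (X i) x).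
pose b i s := torus_int (fun x => g s x * adv (psi s) (E' i) x).
have bF i : bm (F i) by exact: (bm_tint (bmM bf (bm_time_space (bX i)))).
have bG i : bm (G i) by exact: (bm_tint (bmM bg (bm_time_space (bE' i)))).
have ba i : bm (a i) by exact: (bm_tint (bmM bf (bm_adv_time (tX i) (cX i)))).
have bb i : bm (b i) by exact: (bm_tint (bmM bg (bm_adv_time (tE' i) (cE' i)))).
have hF i (s : R) : 0 <= s <= t -> F i s - torus_int (fun x => f0 x * X i x) =
    \int[leb]_(r in `[0%R, s]) a i r.
  by move=> /andP[s0 st]; apply: hf => //; rewrite s0 (le_trans st).
have hG i (s : R) : 0 <= s <= t -> G i s - torus_int (fun x => g0 x * E' i x) =
    \int[leb]_(r in `[0%R, s]) b i r.
  by move=> /andP[s0 st]; apply: hg => //; rewrite s0 (le_trans st).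
have endp (h k : R * R -> R) : bm h -> bm k ->
    tint2 (fun p => h p.1 * eta p.1 * k p.2 * kern m (p.1 - p.2)) =
    \sum_i torus_int (fun x => h x * X i x) * torus_int (fun x => k x * E' i x).
  move=> bh bk.
  have -> : (fun p : (R * R) * (R * R) => h p.1 * eta p.1 * k p.2 * kern m (p.1 - p.2)) =
      (fun p => \sum_i (h p.1 * X i p.1) * (k p.2 * E' i p.2)).
    apply/funext => p; rewrite hk mulr_sumr; apply: eq_bigr => i _.
    by rewrite /X; ring.
  rewrite tint2_sum; last first.
    by move=> i; exact: (bmM (bm_fst (bmM bh (bX i))) (bm_snd (bmM bk (bE' i)))).
  by apply: eq_bigr => i _; rewrite tint_mul//; exact: bmM.
(* This is [sum_adv_kern] integrated in both variables, each summand being a product of integrals by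
   [tint_mul]. *)
have mol s : mollified (psi s) (f s) (g s) eta m = \sum_i (a i s * G i s + F i s * b i s).
  have bA := bm_adv (torus_psi s) (C1_psi s) te ce.
  have bAX i := bm_adv (torus_psi s) (C1_psi s) (tX i) (cX i).
  have bAE i := bm_adv (torus_psi s) (C1_psi s) (tE' i) (cE' i).
  have bk2 := bm_sub2 (bm_kern (R := R) m).
  have bc := bm_comm_kern m (torus_psi s) (C1_psi s).
  transitivity (tint2 (fun p => f s p.1 * adv (psi s) eta p.1 * g s p.2 * kern m (p.1 - p.2) +
      f s p.1 * eta p.1 * g s p.2 * comm_kern (psi s) m p)).
    rewrite tint2D//; first exact: (bmM (bmM (bm_fst (bmM (bft s) bA)) (bm_snd (bgt s))) bk2).
    exact: (bmM (bmM (bm_fst (bmM (bft s) (bm_C1 te ce))) (bm_snd (bgt s))) bc).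
  have -> : (fun p : (R * R) * (R * R) =>
      f s p.1 * adv (psi s) eta p.1 * g s p.2 * kern m (p.1 - p.2) +
      f s p.1 * eta p.1 * g s p.2 * comm_kern (psi s) m p) =
    (fun p => \sum_i (f s p.1 * adv (psi s) (X i) p.1 * (g s p.2 * E' i p.2) +
       f s p.1 * X i p.1 * (g s p.2 * adv (psi s) (E' i) p.2))).
    by apply/funext => -[x y]; rewrite -(sum_adv_kern hE hk (psi s) (f s) (g s) x y ce).
  have b1 i : bm (fun p : (R * R) * (R * R) => f s p.1 * adv (psi s) (X i) p.1 * (g s p.2 * E' i p.2)).
    exact: (bmM (bm_fst (bmM (bft s) (bAX i))) (bm_snd (bmM (bgt s) (bE' i)))).
  have b2 i : bm (fun p : (R * R) * (R * R) => f s p.1 * X i p.1 * (g s p.2 * adv (psi s) (E' i) p.2)).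
    exact: (bmM (bm_fst (bmM (bft s) (bX i))) (bm_snd (bmM (bgt s) (bAE i)))).
  rewrite tint2_sum; last by move=> i; exact: (bmD (b1 i) (b2 i)).
  apply: eq_bigr => i _; rewrite (tint2D (b1 i) (b2 i)); congr (_ + _).
    exact: (esym (tint_mul (bmM (bft s) (bAX i)) (bmM (bgt s) (bE' i)))).
  exact: (esym (tint_mul (bmM (bft s) (bX i)) (bmM (bgt s) (bAE i)))).
have bs i : bm (fun s => a i s * G i s + F i s * b i s).
  exact: (bmD (bmM (ba i) (bG i)) (bmM (bF i) (bb i))).
have -> : (fun s => mollified (psi s) (f s) (g s) eta m) =
    (fun s => \sum_i (a i s * G i s + F i s * b i s)) by apply/funext.
split; first exact: bm_sum.
rewrite (endp _ _ (bft t) (bgt t)) (endp _ _ bf0 bg0) -sumrB.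
rewrite (Rint_sum (mu := leb) (measurable_itv _) (leb_itv_ltoo 0 t) _ bs).
apply: eq_bigr => i _.
exact: (product_rule_int (bF i) (bG i) (ba i) (bb i) t0 (hF i) (hG i)).
Qed.

(** Limit of [mollified_balance]. At the two end times only the kernel has to concentrate; under the
    time integral, convergence holds at each time by [mollified_bound] and is dominated
    uniformly. *)
Lemma weak_solutionM f0 f g0 g : weak_solution f0 f -> weak_solution g0 g ->
  weak_solution (fun x => f0 x * g0 x) (fun t x => f t x * g t x).
Proof.
move=> sf sg; have [bf0 bf hf] := sf; have [bg0 bg hg] := sg.
split; [exact: (bmM bf0 bg0)|exact: (bmM bf bg)|].
move=> eta te ce t tT.
have be := bm_C1 te ce.
have bft s : bm (f s) by exact: (bm_section1 s bf).
have bgt s : bm (g s) by exact: (bm_section1 s bg).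
have [_ [F hF]] := bmM bf (bm_time_space be).
have [_ [F' hF']] := bmM bf (bm_adv_time te ce).
have [_ [G hG]] := bg.
pose L s := torus_int (fun x => f s x * adv (psi s) eta x * g s x).
have bL : bm L by exact: (bm_tint (bmM (bmM bf (bm_adv_time te ce)) bg)).
pose S n s := mollified (psi s) (f s) (g s) eta n.+1.
have bS n : bm (S n) by have [] := mollified_balance n.+1 sf sg te ce tT.
have F0 : 0 <= F by exact: (bound_ge0 (0 : R * (R * R)) hF).
have F0' : 0 <= F' by exact: (bound_ge0 (0 : R * (R * R)) hF').
have SL n s delta : 0 < delta -> `|S n s - L s| <= F' * (delta + osc n.+1 (g s) / delta) +
    32 * F * (delta * (B ^+ 2 + 2 * G ^+ 2) + osc n (g s) / delta ^+ 3).
  move=> d0; apply: (mollified_bound n (torus_psi s) (C1_psi s) (poisson_psi s) (bm_w s) (w_le s)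
    (bft s) (bgt s) (fun x => hG (s, x)) te ce (fun x => hF (s, x)) (fun x => hF' (s, x)) d0).
have cS s : S n s @[n --> \oo] --> L s.
  have og := (osc0_bm (bgt s)).2.
  have K0 : 0 <= B ^+ 2 + 2 * G ^+ 2 by rewrite addr_ge0 ?sqr_ge0// mulr_ge0 ?sqr_ge0.
  (* With Y = B^2 + 2 G^2, the inequality delta Y + X <= (Y + 1) (delta + X) brings the estimate
     into the form required by [cvg_of_bound]. *)
  have C0 : 0 <= 32 * F * (B ^+ 2 + 2 * G ^+ 2 + 1).
    by apply: mulr_ge0; [exact: mulr_ge0|exact: addr_ge0].
  apply: (cvg_of_bound (oscS_cvg (bgt s)) og (fun n => osc_ge0 n.+1 (g s))
    (fun n => osc_ge0 n (g s)) F0' C0).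
  move=> delta d0 n; apply: le_trans (SL n s delta d0) _; rewrite lerD2l.
  rewrite -[leRHS]mulrA; apply: ler_wpM2l; first exact: mulr_ge0.
  have o0 : 0 <= osc n (g s) / delta ^+ 3.
    by apply: divr_ge0; [exact: osc_ge0|rewrite exprn_ge0// ltW].
  move: (osc n (g s) / _) (B ^+ 2 + _) K0 o0 => X Y Y0 X0.
  have -> : (Y + 1) * (delta + X) = delta * Y + X + (delta + Y * X) by ring.
  by rewrite lerDl addr_ge0 ?mulr_ge0// ltW.
have [_ [ML hML]] := bL.
(* The estimate at delta = 1, with each oscillation replaced by its trivial bound 4 G^2. *)
pose M := ML + (F' * (1 + 4 * G ^+ 2) + 32 * F * (B ^+ 2 + 2 * G ^+ 2 + 4 * G ^+ 2)).
have SM n s : `|S n s| <= M.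
  have -> : S n s = L s + (S n s - L s) by rewrite addrC subrK.
  apply: le_trans (ler_normD _ _) _; apply: lerD; first exact: hML.
  exact: (unit_scale_bound F0 F0' (osc_le n.+1 (bgt s) (fun x => hG (s, x)))
    (osc_le n (bgt s) (fun x => hG (s, x))) (SL n s 1 ltr01)).
have cI : \int[leb]_(s in `[0%R, t]) S n s @[n --> \oo] --> \int[leb]_(s in `[0%R, t]) L s.
  apply: (Rint_bounded_cvg (mu := leb) (measurable_itv _) (leb_itv_ltoo 0 t) (M := M)) => //.
have cl : \int[leb]_(s in `[0%R, t]) S n s @[n --> \oo] -->
    torus_int (fun x => f t x * eta x * g t x) - torus_int (fun x => f0 x * eta x * g0 x).
  have -> : (fun n => \int[leb]_(s in `[0%R, t]) S n s) =
     (fun n => tint2 (fun p => f t p.1 * eta p.1 * g t p.2 * kern n.+1 (p.1 - p.2)) -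
       tint2 (fun p => f0 p.1 * eta p.1 * g0 p.2 * kern n.+1 (p.1 - p.2))).
    by apply/funext => n; have [_ <-] := mollified_balance n.+1 sf sg te ce tT.
  apply: cvgB.
    exact: (tint2_kern_cvg (bmM (bft t) be) (bgt t)).
  exact: (tint2_kern_cvg (bmM bf0 be) bg0).
have e := etrans (esym (cvg_lim (@Rhausdorff R) cl)) (cvg_lim (@Rhausdorff R) cI).
transitivity (torus_int (fun x => f t x * eta x * g t x) - torus_int (fun x => f0 x * eta x * g0 x)).
  by congr (_ - _); apply: eq_tint => x; rewrite mulrAC.
rewrite e; apply: eq_Rintegral => s _; apply: eq_tint => x; by rewrite mulrAC.
Qed.

Lemma bm_weak_rhs (f : R -> R * R -> R) eta : bm (fun p : R * (R * R) => f p.1 p.2) ->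
  on_torus eta -> C1 eta -> bm (fun p : R * (R * R) => f p.1 p.2 * adv (psi p.1) eta p.2).
Proof. by move=> bf te ce; exact: (bmM bf (bm_adv_time te ce)). Qed.

(* The velocity is divergence free. *)
Lemma weak_solution_cst (c : R) : weak_solution (fun=> c) (fun _ _ => c).
Proof.
split; [exact: bm_cst|exact: bm_cst|] => eta te ce t tT.
rewrite subrr -[LHS](_ : \int[leb]_(s in `[0%R, t]) (0 : R) = 0); last first.
  by rewrite Rintegral_cst ?mul0r//; exact: measurable_itv.
apply: eq_Rintegral => s _.
rewrite (tintZl _ (bm_adv (torus_psi s) (C1_psi s) te ce)).
by rewrite [torus_int _](tint_grad_perp (torus_psi s) (C1_psi s) te ce) mulr0.
Qed.

Lemma weak_solutionD f0 f g0 g : weak_solution f0 f -> weak_solution g0 g ->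
  weak_solution (fun x => f0 x + g0 x) (fun t x => f t x + g t x).
Proof.
move=> [bf0 bf hf] [bg0 bg hg].
split; [exact: (bmD bf0 bg0)|exact: (bmD bf bg)|] => eta te ce t tT.
have be := bm_C1 te ce.
have bft s : bm (f s) by exact: (bm_section1 s bf).
have bgt s : bm (g s) by exact: (bm_section1 s bg).
have add (h k e : R * R -> R) : bm h -> bm k -> bm e ->
    torus_int (fun x => (h x + k x) * e x) =
    torus_int (fun x => h x * e x) + torus_int (fun x => k x * e x).
  move=> bh bk b; rewrite -(tintD (bmM bh b) (bmM bk b)).
  by apply: eq_tint => x; rewrite mulrDl.
rewrite (add _ _ _ (bft t) (bgt t) be) (add _ _ _ bf0 bg0 be) opprD addrACA.
rewrite (hf _ te ce t tT) (hg _ te ce t tT).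
rewrite -(RintD (mu := leb) (measurable_itv _) (leb_itv_ltoo 0 t)
  (bm_tint (bm_weak_rhs bf te ce)) (bm_tint (bm_weak_rhs bg te ce))).
apply: eq_Rintegral => s _.
by rewrite (add _ _ _ (bft s) (bgt s) (bm_adv (torus_psi s) (C1_psi s) te ce)).
Qed.

Lemma weak_solutionZ (c : R) f0 f : weak_solution f0 f ->
  weak_solution (fun x => c * f0 x) (fun t x => c * f t x).
Proof. exact: (weak_solutionM (weak_solution_cst c)). Qed.

Lemma weak_solution_ext f0 f g0 g : (forall x, f0 x = g0 x) -> (forall t x, f t x = g t x) ->
  weak_solution f0 f -> weak_solution g0 g.
Proof.
move=> /funext <- e; have -> // : f = g by apply/funext => t; exact/funext.
Qed.

Lemma weak_solution_sum (I : Type) (r : seq I) (f0 : I -> R * R -> R) (f : I -> R -> R * R -> R) :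
  (forall i, weak_solution (f0 i) (f i)) ->
  weak_solution (fun x => \sum_(i <- r) f0 i x) (fun t x => \sum_(i <- r) f i t x).
Proof.
move=> sf; elim: r => [|i r ih].
  by apply: weak_solution_ext (weak_solution_cst 0) => *; rewrite big_nil.
by apply: weak_solution_ext (weak_solutionD (sf i) ih) => *; rewrite big_cons.
Qed.

Lemma weak_solutionX n f0 f : weak_solution f0 f ->
  weak_solution (fun x => f0 x ^+ n) (fun t x => f t x ^+ n).
Proof.
move=> sf; elim: n => [|n ih]; first exact: weak_solution_cst.
by apply: weak_solution_ext (weak_solutionM sf ih) => *; rewrite exprS.
Qed.

Lemma weak_solution_cvg (f0_ : nat -> R * R -> R) (f_ : nat -> R -> R * R -> R) f0 f (M : R) :
  (forall n, weak_solution (f0_ n) (f_ n)) ->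
  bm f0 -> bm (fun p : R * (R * R) => f p.1 p.2) ->
  (forall n x, `|f0_ n x| <= M) -> (forall n t x, `|f_ n t x| <= M) ->
  (forall x, f0_ n x @[n --> \oo] --> f0 x) ->
  (forall t x, f_ n t x @[n --> \oo] --> f t x) ->
  weak_solution f0 f.
Proof.
move=> sf bf0 bf M0 M1 c0 c1; split=> // eta te ce t tT.
have be := bm_C1 te ce.
have lim (h_ : nat -> R * R -> R) (h e : R * R -> R) : (forall n, bm (h_ n)) -> bm h -> bm e ->
    (forall n x, `|h_ n x| <= M) -> (forall x, h_ n x @[n --> \oo] --> h x) ->
    torus_int (fun x => h_ n x * e x) @[n --> \oo] --> torus_int (fun x => h x * e x).
  move=> bh_ bh b hM ch; have [_ [N hN]] := b.
  apply: (tint_cvg (M := M * N)).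
  - by move=> n; exact: (bmM (bh_ n) b).
  - exact: (bmM bh b).
  - by move=> n x; rewrite normrM; apply: ler_pM.
  - by move=> x; apply: cvgMr_tmp; exact: ch.
have b0 n : bm (f0_ n) by have [] := sf n.
have b1 n : bm (fun p : R * (R * R) => f_ n p.1 p.2) by have [] := sf n.
have l0 := lim _ _ _ b0 bf0 be M0 c0.
have lt s e (b : bm e) := lim (fun n => f_ n s) (f s) e (fun n => bm_section1 s (b1 n))
  (bm_section1 s bf) b (fun n => M1 n s) (c1 s).
have [_ [N hN]] := bm_adv_time te ce.
have cI : \int[leb]_(s in `[0%R, t]) torus_int (fun x => f_ n s x * adv (psi s) eta x)
    @[n --> \oo] --> \int[leb]_(s in `[0%R, t]) torus_int (fun x => f s x * adv (psi s) eta x).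
  apply: (Rint_bounded_cvg (mu := leb) (measurable_itv _) (leb_itv_ltoo 0 t) (M := M * N)).
  - by move=> n; exact: (bm_tint (bm_weak_rhs (b1 n) te ce)).
  - exact: (bm_tint (bm_weak_rhs bf te ce)).
  - move=> n s _; apply: normr_tint_bound.
      exact: (bm_section1 s (bm_weak_rhs (b1 n) te ce)).
    move=> x; rewrite normrM; apply: ler_pM => //; exact: (hN (s, x)).
  - move=> s _; exact: (lt s _ (bm_adv (torus_psi s) (C1_psi s) te ce)).
have cl : torus_int (fun x => f_ n t x * eta x) - torus_int (fun x => f0_ n x * eta x) @[n --> \oo] -->
    torus_int (fun x => f t x * eta x) - torus_int (fun x => f0 x * eta x).
  by apply: cvgB; [exact: (lt t _ be)|exact: l0].
have e : (fun n => torus_int (fun x => f_ n t x * eta x) - torus_int (fun x => f0_ n x * eta x)) =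
    (fun n => \int[leb]_(s in `[0%R, t]) torus_int (fun x => f_ n s x * adv (psi s) eta x)).
  by apply/funext => n; have [_ _ ->] := sf n.
rewrite -e in cI.
exact: (etrans (esym (cvg_lim (@Rhausdorff R) cl)) (cvg_lim (@Rhausdorff R) cI)).
Qed.

(** Partial sums of the exponential series are polynomials in the solution and stay below the
    exponential of the sup bound. The maximum of [M0] and [M1] serves datum and solution at once. *)
Lemma weak_solution_expR f0 f : weak_solution f0 f ->
  weak_solution (fun x => expR (f0 x)) (fun t x => expR (f t x)).
Proof.
move=> sf; have [bf0 bf _] := sf; have [_ [M0 hM0]] := bf0; have [_ [M1 hM1]] := bf.
apply: (weak_solution_cvg (f0_ := fun n x => series (exp_coeff (f0 x)) n)
  (f_ := fun n t x => series (exp_coeff (f t x)) n) (M := expR (Num.max M0 M1))).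
- move=> n; rewrite /series /=.
  apply: (weak_solution_sum (index_iota 0 n) (f0 := fun k x => exp_coeff (f0 x) k)
    (f := fun k t x => exp_coeff (f t x) k)) => k.
  by apply: weak_solution_ext (weak_solutionZ (k`!%:R^-1) (weak_solutionX k sf)) => *; rewrite mulrC.
- exact: bm_expR.
- exact: (bm_expR bf).
- by move=> n x; apply: series_exp_le; rewrite le_max hM0.
- by move=> n t x; apply: series_exp_le; rewrite le_max (hM1 (t, x)) orbT.
- by move=> x; exact: is_cvg_series_exp_coeff.
- by move=> t x; exact: is_cvg_series_exp_coeff.
Qed.

Lemma weak_solution_mass f0 f (t : R) : weak_solution f0 f -> 0 <= t <= T ->
  torus_int (f t) = torus_int f0.
Proof.
move=> [_ _ hf] tT; have := hf _ (on_torus_cst 1) (C1_cst 1) t tT.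
have adv0 s x : adv (psi s) (fun=> 1) x = 0 by rewrite /adv /d1 /d2 !derive_cst !mulr0 addr0.
under [in RHS]eq_Rintegral => s _.
  under eq_tint => x do rewrite adv0 mulr0.
  rewrite tint_cst; over.
rewrite Rintegral_cst ?mul0r; last exact: measurable_itv.
under eq_tint => x do rewrite mulr1.
under [X in _ - X = _ -> _]eq_tint => x do rewrite mulr1.
by move/eqP; rewrite subr_eq0 => /eqP.
Qed.

(** The relation is multiplied out by the denominator, so no reciprocal of a solution is ever
    formed. *)
Lemma weak_solution_softmax (K : nat) (beta : R) (c : 'I_K -> R)
    (f0 : R * R -> R) (f : R -> R * R -> R)
    (phi0 : 'I_K -> R * R -> R) (phi : 'I_K -> R -> R * R -> R) :
  weak_solution f0 f -> (forall k, weak_solution (phi0 k) (phi k)) ->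
  (forall x, f0 x * (\sum_(j < K) expR (beta * phi0 j x)) =
     \sum_(k < K) c k * expR (beta * phi0 k x)) ->
  forall t : R, 0 <= t <= T ->
  torus_int (fun x => (f t x * (\sum_(j < K) expR (beta * phi j t x)) -
     \sum_(k < K) c k * expR (beta * phi k t x)) ^+ 2) = 0.
Proof.
move=> sf sphi e0 t tT.
have sE k := weak_solution_expR (weak_solutionZ beta (sphi k)).
have sD := weak_solution_sum (index_enum 'I_K) sE.
have sN := weak_solution_sum (index_enum 'I_K) (fun k => weak_solutionZ (c k) (sE k)).
have sW := weak_solutionX 2 (weak_solutionD (weak_solutionM sf sD) (weak_solutionZ (-1) sN)).
have := weak_solution_mass sW tT.
under eq_tint => x do rewrite mulN1r.
move=> ->; under eq_tint => x do rewrite e0 mulN1r subrr expr0n.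
exact: tint_cst.
Qed.

End WeakSolutions.

End WeakTransport.

(** * Null sets of periodic functions *)

Section PeriodicNull.
Context {R : realType}.
Local Notation leb := (@lebesgue_measure R).

(** Integer translates of the part in [0, 1] cover [A], and there are countably many of them. *)
Lemma periodic_null (A : set R) : measurable A -> (forall s, A (s + 1) <-> A s) ->
  leb (A `&` `[0%R, 1%R]) = 0%E -> leb A = 0%E.
Proof.
move=> mA pA A0.
have pn n s : A (s + n%:R) <-> A s.
  elim: n s => [|n ih] s; first by rewrite addr0.
  by rewrite -natr1 addrA pA.
pose A01 := A `&` `[0%R, 1%R].
have mA01 : measurable A01 by apply: measurableI => //; exact: measurable_itv.
pose S c := (fun s : R => s + c) @^-1` A01.
have nS c : leb.-negligible (S c).
  exists (S c); split=> //; last by rewrite leb_shift.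
  have ma : measurable_fun setT (fun s : measurableTypeR R => (s + c : measurableTypeR R)).
    exact: measurable_funD.
  by have := ma measurableT A01 mA01; rewrite setTI.
suff nA : leb.-negligible A by exact: measure_negligible.
apply: (@negligibleS _ _ _ leb ((\bigcup_(n : nat) S n%:R) `|` (\bigcup_(n : nat) S (- n%:R)))); last first.
  by apply: negligibleU; apply: negligible_bigcup => n; exact: nS.
move=> s As.
have h01 : 0 <= s - (Num.floor s)%:~R <= 1.
  rewrite subr_ge0 floor_le/= lerBlDr addrC -intrD1 ltW// floorD1_gt//.
case: (Num.floor s) h01 => n h01.
  right; exists n => //; split; last by rewrite /= in_itv.
  by apply/(pn n); rewrite subrK.
(* [Negz n] stands for -(n + 1), hence the translate of index [n.+1]. *)
left; exists n.+1 => //; split; last first.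
  by move: h01; rewrite NegzE mulrNz opprK /= in_itv.
exact/(pn n.+1).
Qed.

(** The energy argument only sees the unit square, whereas the final statement concerns the plane.
    By Tonelli a set is null when almost all its sections are; periodicity is used once in each
    section and once for the set [A] of exceptional abscissae. *)
Lemma torus_null (N : set (R * R)) : measurable N ->
  (forall x, (N (x.1 + 1, x.2) <-> N x) /\ (N (x.1, x.2 + 1) <-> N x)) ->
  leb2 R (N `&` unit_square) = 0%E -> leb2 R N = 0%E.
Proof.
move=> mN pN N0.
have mN01 : measurable (N `&` unit_square).
  by apply: measurableI => //; exact: measurable_unit_square.
have mphi (M : set (R * R)) : measurable M -> measurable_fun setT (fun x => leb (xsection M x)).
  by move=> mM; exact: (measurable_fun_xsection leb mM).
have zero (M : set (R * R)) : measurable M -> leb2 R M = 0%E <->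
    ae_eq leb setT (fun x => leb (xsection M x)) (cst 0%E).
  move=> mM; rewrite -(ae_eq_integral_abs leb measurableT (mphi M mM)).
  by under eq_integral do rewrite gee0_abs//.
apply/(zero _ mN).
have [X [mX X0 sX]] := (zero _ mN01).1 N0.
pose A := [set x | leb (xsection N x) <> 0%E].
have mA : measurable A.
  have := mphi _ mN measurableT (~` [set 0%E]) (measurableC (emeasurable_set1 _)).
  by rewrite setTI.
have xsA x : leb (xsection N (x + 1)) = leb (xsection N x).
  congr (leb _); apply/seteqP; split => y; rewrite /xsection/= !inE => h.
    by apply/((pN (x, y)).1).
  by apply/((pN (x, y)).1).
have pA s : A (s + 1) <-> A s by rewrite /A /= xsA.
have A0 : leb A = 0%E.
  apply: periodic_null => //; apply: measure_negligible.
    by apply: measurableI => //; exact: measurable_itv.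
  exists X; split=> // x [Ax x01]; apply: sX => /= /(_ I) h; apply: Ax.
  apply: periodic_null.
  - exact: measurable_xsection.
  - by move=> s; rewrite /xsection /= !inE; exact: (pN (x, s)).2.
  - rewrite -[RHS]h; congr (leb _); apply/seteqP; split => y; rewrite /xsection/= !inE.
      by move=> [yN y01]; split.
    by move=> [yN [_ y01]]; split.
exists A; split=> // x /= h Ax; apply: h => _.
by apply: contrapT.
Qed.

Lemma ball_leb2_gt0 (x : R * R) (r : R) : 0 < r -> (0 < leb2 R (ball x r))%E.
Proof.
move=> r0.
have -> : ball x r = `]x.1 - r, x.1 + r[ `*` `]x.2 - r, x.2 + r[.
  case: x => x1 x2; apply/seteqP; split => -[a b].
    move=> [/=]; rewrite /ball/= !ltr_norml => /andP[a1 a2] /andP[b1 b2].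
    by split; rewrite /= in_itv/=; apply/andP; split; lra.
  move=> [/=]; rewrite !in_itv/= => /andP[a1 a2] /andP[b1 b2].
  by split; rewrite /ball/= ltr_norml; apply/andP; split; lra.
rewrite product_measure1E; [|exact: measurable_itv|exact: measurable_itv].
have pos (a : R) : (0%E < leb `]a - r, a + r[)%O.
  rewrite lebesgue_measure_itv/= lte_fin (_ : a - r < a + r); last by lra.
  by rewrite -EFinB lte_fin; lra.
by apply: mule_gt0; exact: pos.
Qed.

End PeriodicNull.

(** * From a vanishing mean square to pointwise identities *)

Section Uniqueness.
Context {R : realType}.
Local Notation leb := (@lebesgue_measure R).

Lemma torus_sq_null (W : R * R -> R) : bm W -> on_torus W ->
  torus_int (fun x => W x ^+ 2) = 0 ->
  measurable [set x | W x != 0] /\ leb2 R [set x | W x != 0] = 0%E.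
Proof.
move=> bW tW W0.
have mN : measurable [set x | W x != 0].
  have := bW.1 measurableT (~` [set 0]) (measurableC (measurable_set1 _)); rewrite setTI.
  by congr measurable; apply/seteqP; split => x /= /eqP.
split=> //; apply: torus_null => //.
  by move=> x; rewrite /= !(tW x).1 !(tW x).2.
have bW2 := bmX 2 bW.
have mE : measurable_fun unit_square (fun x => (W x ^+ 2)%:E).
  by apply/measurable_EFinP; exact: measurable_funTS bW2.1.
have iE : (\int[leb2 R]_(x in unit_square) `|(W x ^+ 2)%:E|)%E = 0%E.
  under eq_integral do rewrite gee0_abs ?lee_fin ?sqr_ge0//.
  apply/eqP; rewrite -fine_eq0; first exact/eqP.
  apply: integrable_fin_num; first exact: measurable_unit_square.
  exact: (bm_integrable (mu := leb2 R) measurable_unit_square leb2_unit_square_ltoo bW2).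
have [X [mX X0 sX]] := (ae_eq_integral_abs (leb2 R) measurable_unit_square mE).1 iE.
apply: measure_negligible; first by apply: measurableI => //; exact: measurable_unit_square.
exists X; split=> // x [/= /eqP Wx xs]; apply: sX => /= /(_ xs) [] /eqP.
by rewrite sqrf_eq0 => /eqP.
Qed.

(** A nonzero value at a point of continuity would persist on a ball, which has positive measure. *)
Lemma null_set_continuous (W : R * R -> R) (x : R * R) :
  leb2 R [set x | W x != 0] = 0%E -> measurable [set x | W x != 0] ->
  {for x, continuous W} -> W x = 0.
Proof.
move=> W0 mW cW; apply: contrapT => /eqP Wx.
have := cW _ (open_nbhs_nbhs (conj (@open_neq R 0) Wx)).
rewrite nbhs_simpl /= => /nbhs_ballP [r /= r0 br].
have := ball_leb2_gt0 x r0.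
suff -> : leb2 R (ball x r) = 0%E by rewrite ltxx.
apply/eqP; rewrite -measure_le0 -W0; apply: le_measure; rewrite ?inE//.
  apply: open_measurable2; exact: ball_open.
Qed.

(* Solutions are bounded only locally in time; freezing them outside [0, T]
   makes them bounded on the whole line without changing them up to time T. *)
Definition clip (T s : R) : R := Num.max 0 (Num.min T s).

Lemma clip_itv (T s : R) : 0 <= T -> 0 <= clip T s <= T.
Proof. by move=> T0; rewrite /clip le_max lexx/= ge_max T0/= ge_min lexx. Qed.

Lemma clip_id (T s : R) : 0 <= s <= T -> clip T s = s.
Proof. by move=> /andP[s0 sT]; rewrite /clip (min_idPr sT) (max_idPr s0). Qed.

Lemma measurable_clip (T : R) : measurable_fun setT (clip T).
Proof.
apply: measurable_maxr; first exact: measurable_cst.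
by apply: measurable_minr; [exact: measurable_cst|exact: measurable_id].
Qed.

Lemma bm_clip (f : R -> R * R -> R) (T : R) : 0 <= T -> Linfty_loc f ->
  bm (fun p : R * (R * R) => f (clip T p.1) p.2).
Proof.
move=> T0 [mf /(_ T) [M hM]]; split; last first.
  by exists M => p; apply: hM; exact: clip_itv.
have mh : measurable_fun setT (fun p : R * (R * R) => (clip T p.1, p.2)).
  apply: measurable_fun_pair; last exact: measurable_snd.
  exact: (measurableT_comp (measurable_clip T) measurable_fst).
apply: (measurable_comp _ _ mf mh).
  by apply: measurableX => //; exact: measurable_itv.
move=> _ [p _ <-]; split => //=; rewrite in_itv/= andbT.
by have /andP[] := clip_itv p.1 T0.
Qed.

(** Test functions constant in time are inserted, so the time derivative drops out. Up to the final
    time clipping is the identity, and the equation is asked for no further. *)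
Lemma transport_weak_solution (u : R -> R * R -> R * R) (psi : R -> R * R -> R) (T : R) f0 f :
  0 <= T -> (forall s x, u (clip T s) x = grad_perp (psi s) x) -> bm f0 ->
  transport_solution u f0 f -> weak_solution psi T f0 (fun s => f (clip T s)).
Proof.
move=> T0 hu bf0 [tf Lf hf]; split=> //; first exact: bm_clip.
move=> eta te ce t tT; have /andP[t0 tleT] := tT.
have csnd : continuous (snd : R * (R * R) -> R * R) by move=> x; exact: cvg_snd.
have cchi : test_function (fun p : R * (R * R) => eta p.2).
  by split; [exact: (C1_comp_linear (L := snd) csnd)|move=> s; exact: te].
rewrite (clip_id tT) (hf _ _ cchi t0); apply: eq_Rintegral => s.
rewrite inE /= in_itv/= => /andP[s0 st].
have sT : 0 <= s <= T by rewrite s0 (le_trans st).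
rewrite (clip_id sT); apply: eq_tint => x.
rewrite /dt /dx1 /dx2 !(derive_comp_linear snd) /=.
have -> : 'D_(0, 0) eta x = 0 by rewrite deriveE ?linear0//; exact: ce.1.
by have := hu s x; rewrite (clip_id sT) => ->; rewrite add0r.
Qed.

Lemma continuous_sum_at (K : nat) (F : 'I_K -> R * R -> R) (x : R * R) :
  (forall k, {for x, continuous (F k)}) -> {for x, continuous (fun y => \sum_(k < K) F k y)}.
Proof. by move=> cF; apply: cvg_big => [|k _]; [exact: add_continuous|exact: cF]. Qed.

Lemma bm_softmax_datum (K : nat) (beta : R) (c : 'I_K -> R) (phi0 : 'I_K -> R * R -> R) :
  (forall k, on_torus (phi0 k)) -> (forall k, C1 (phi0 k)) ->
  (forall x, 0 < \sum_(j < K) expR (beta * phi0 j x)) ->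
  bm (fun x => \sum_(k < K) c k * softmax beta phi0 k x).
Proof.
move=> tphi cphi D0.
have cE k : continuous (fun x => expR (beta * phi0 k x)).
  move=> x; apply: continuous_comp; last exact: continuous_expR.
  by apply: cvgMl_tmp; exact: (C1_continuous (cphi k)).
apply: bm_continuous.
  move=> x; split; apply: eq_bigr => k _; rewrite /softmax.
    by rewrite (tphi k x).1; under eq_bigr => j _ do rewrite (tphi j x).1.
  by rewrite (tphi k x).2; under eq_bigr => j _ do rewrite (tphi j x).2.
move=> x; apply: (@continuous_sum_at _ (fun k y => c k * softmax beta phi0 k y)) => k.
apply: cvgMl_tmp; apply: cvgM; first exact: cE.
apply: cvgV; first by rewrite gt_eqF.
by apply: (@continuous_sum_at _ (fun j y => expR (beta * phi0 j y))) => j; exact: cE.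
Qed.

End Uniqueness.

(* Solutions are L^oo functions of x at each time: the identity holds almost
   everywhere, and at every point for the continuous representatives. *)
Theorem theorem3p1 (R : realType) (K : nat) (hK : (2 <= K)%N)
  (alpha beta : R) (halpha : 0 < alpha < 1) (hbeta : 0 < beta)
  (c : 'I_K -> R) (phi_in : 'I_K -> R * R -> R)
  (hphi_in : forall k, C1alpha_torus alpha (phi_in k))
  (omega : R -> R * R -> R) (u : R -> R * R -> R * R)
  (homega : yudovich_solution
     (fun x => \sum_(k < K) c k * softmax beta phi_in k x) omega u)
  (phi : 'I_K -> R -> R * R -> R)
  (hphi : forall k, transport_solution u (phi_in k) (phi k)) :
  forall t : R, 0 <= t ->
    {ae leb2 R, forall x,
       omega t x = \sum_(k < K) c k * softmax beta (fun j => phi j t) k x} /\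
    (forall x, {for x, continuous (omega t)} ->
       (forall k, {for x, continuous (phi k t)}) ->
       omega t x = \sum_(k < K) c k * softmax beta (fun j => phi j t) k x).
Proof.
(* The time of the statement is called [T], being the final time at which all functions are
   frozen. *)
move=> T T0; have [Lu1 Lu2 bs tom] := homega.
have Dgt (h : 'I_K -> R * R -> R) x : 0 < \sum_(j < K) expR (beta * h j x).
  case: K hK h {c phi_in hphi_in homega phi hphi tom} => // n _ h.
  rewrite big_ord_recl; apply: ltr_pwDl; first exact: expR_gt0.
  by apply: sumr_ge0 => j _; exact: expR_ge0.
have softE (h : 'I_K -> R * R -> R) x :
    \sum_(k < K) c k * softmax beta h k x =
    (\sum_(k < K) c k * expR (beta * h k x)) / \sum_(j < K) expR (beta * h j x).
  by rewrite mulr_suml; apply: eq_bigr => k _; rewrite /softmax mulrA.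
have tphi k : on_torus (phi_in k) by have [] := hphi_in k.
have cphi k : C1 (phi_in k) by have [] := hphi_in k.
have clip0 s : 0 <= clip T s by have /andP[] := clip_itv s T0.
(* Stream functions are chosen separately at each clipped time, with no regularity in time. *)
have /choice [psi hpsi] : forall s, exists psi, [/\ on_torus psi, C1 psi,
    weak_poisson psi (omega (clip T s)) & forall x, u (clip T s) x = grad_perp psi x].
  by move=> s; exact: bs.
have torus_psi s : on_torus (psi s) by have [] := hpsi s.
have C1_psi s : C1 (psi s) by have [] := hpsi s.
have poisson_psi s : weak_poisson (psi s) (omega (clip T s)) by have [] := hpsi s.
have u_psi s x : u (clip T s) x = grad_perp (psi s) x by have [] := hpsi s.
(* Joint measurability is needed only for the gradient of [psi], whose components are those of the
   velocity up to sign and order; the choice of [psi] at each time does not affect them. *)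
have bd2 : bm (fun p : R * (R * R) => d2 (psi p.1) p.2).
  have -> : (fun p : R * (R * R) => d2 (psi p.1) p.2) = (fun p => (u (clip T p.1) p.2).1).
    by apply/funext => p; rewrite u_psi.
  exact: (bm_clip T0 Lu1).
have bd1 : bm (fun p : R * (R * R) => d1 (psi p.1) p.2).
  have -> : (fun p : R * (R * R) => d1 (psi p.1) p.2) = (fun p => - (u (clip T p.1) p.2).2).
    by apply/funext => p; rewrite u_psi opprK.
  exact: (bmN (bm_clip T0 Lu2)).
have bom : bm (fun p : R * (R * R) => omega (clip T p.1) p.2).
  by apply: bm_clip => //; have [] := tom.
have bw s : bm (omega (clip T s)) by exact: (bm_section1 s bom).
have [_ [M hM]] := bom.
(* One [M] bounds the vorticity and the other its mean over the torus, which has area one. *)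
have w_le s x : `|omega (clip T s) x - torus_mean (omega (clip T s))| <= M + M.
  apply: le_trans (ler_normB _ _) _; apply: lerD; first exact: (hM (s, x)).
  by apply: normr_tint_bound => // y; exact: (hM (s, y)).
have som := transport_weak_solution T0 u_psi (bm_softmax_datum c tphi cphi (Dgt phi_in)) tom.
have sphi k := transport_weak_solution T0 u_psi (bm_C1 (tphi k) (cphi k)) (hphi k).
have TT : 0 <= T <= T by rewrite T0 lexx.
have W0 := weak_solution_softmax (c := c) bd1 bd2 torus_psi C1_psi poisson_psi bw w_le (beta := beta) som sphi.
pose W x := omega T x * (\sum_(j < K) expR (beta * phi j T x)) -
  \sum_(k < K) c k * expR (beta * phi k T x).
have sqW : torus_int (fun x => W x ^+ 2) = 0.
  have := W0 _ T TT; rewrite (clip_id TT); apply => x.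
  by rewrite softE divfK// gt_eqF.
have tW : on_torus W.
  have [tT _ _] := tom; have tp k : on_torus (phi k T) by have [h _ _] := hphi k; exact: h.
  move=> x; rewrite /W (tT T T0 x).1 (tT T T0 x).2; split.
    by under eq_bigr => j _ do rewrite (tp j x).1;
       under [X in _ - X = _]eq_bigr => j _ do rewrite (tp j x).1.
  by under eq_bigr => j _ do rewrite (tp j x).2;
     under [X in _ - X = _]eq_bigr => j _ do rewrite (tp j x).2.
have bphi k : bm (phi k T).
  have [_ Lp _] := hphi k.
  by have := bm_section1 T (bm_clip T0 Lp); rewrite /= (clip_id TT).
have bE k : bm (fun x => expR (beta * phi k T x)).
  exact: (bm_expR (bmM (bm_cst beta) (bphi k))).
have bW : bm W.
  have bo := bw T; rewrite (clip_id TT) in bo.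
  apply: (bmB (bmM bo (bm_sum _ bE)) (bm_sum _ (fun k => bmM (bm_cst (c k)) (bE k)))).
have [mW W_null] := torus_sq_null bW tW sqW.
have WE x : W x = 0 -> omega T x = \sum_(k < K) c k * softmax beta (fun j => phi j T) k x.
  move/eqP; rewrite subr_eq0 => /eqP h.
  by rewrite softE -h mulfK// gt_eqF// (Dgt (fun j => phi j T)).
split.
  exists [set x | W x != 0]; split=> // x /= h; apply/eqP => Wx; exact/h/WE.
move=> x co cp; apply: WE; apply: (null_set_continuous W_null mW).
have cE k : {for x, continuous (fun x => expR (beta * phi k T x))}.
  apply: continuous_comp; last exact: continuous_expR.
  by apply: cvgMl_tmp; exact: cp.
apply: cvgB.
  apply: cvgM; first exact: co.
  exact: (@continuous_sum_at _ _ (fun j y => expR (beta * phi j T y))).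
apply: (@continuous_sum_at _ _ (fun k y => c k * expR (beta * phi k T y))) => k.
by apply: cvgMl_tmp; exact: cE.
Qed.
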